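(* Let $M$ be a manifold and let $F$ be a bounded Filippov system on $M$ such that the tangent region $\Sigma^t$ is finite and each tangency point has finite multiplicity. (1) If the orbit space flow $\widetilde\Phi$ is transitive, then the Filippov vector field $F$ is also transitive. (2) Suppose that $M$ is connected and that there is a subset $\mathcal T\subseteq\Sigma^t$ with the following properties: (i) for every $T,T'\in\mathcal T$ there is an orbit segment $\theta:[-s,s]\to M$ of $F$ connecting $T$ to $T'$, i.e. $\theta(-s)=T$ and $\theta(s)=T'$ (if $T=T'$ one may take $s=0$); (ii) for every orbit $\gamma\in\widetilde M$ there are a tangency point $T_\gamma\in\mathcal T$ and a time $s_\gamma>0$ such that $\gamma(s_\gamma)=T_\gamma$; (iii) for every orbit $\gamma\in\widetilde M$ there are a tangency point $T_\gamma\in\mathcal T$ and a time $s_\gamma<0$ such that $\gamma(s_\gamma)=T_\gamma$. Then $\widetilde\Phi$ is topologically transitive (and, in particular, $F$ is transitive).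
   Context: Setting. $M$ is a manifold (possibly with boundary) with a Riemannian metric and induced distance $d$; the metric space $(M,d)$ is assumed separable, complete and perfect (no isolated points). There is a $C^r$ function $h:M\to\mathbb R$ ($r>1$ large enough) with $0$ as a regular value such that $\Sigma=h^{-1}(0)$ is a compact embedded codimension $1$ submanifold (the switching manifold); put $M_+=\{h>0\}$, $M_-=\{h<0\}$. A piecewise smooth vector field (Filippov system) $F=(F_+,F_-)$ is given by two $C^r$ vector fields $F_+,F_-$ on $M$, via $F(p)=\frac{F_+(p)+F_-(p)}2+\mathrm{sgn}(h(p))\frac{F_+(p)-F_-(p)}2$, where $\mathrm{sgn}$ is multivalued at $0$ with values in $[-1,1]$; so $F=F_\pm$ on $M_\pm$. $\|F\|$ denotes the supremum norm; $F$ is bounded if $\|F\|<\infty$ (equivalently $F_+$ and $F_-$ are bounded). It is assumed that $\|F\|>0$. Regions. For a vector field $X$, $Xh(p)=\langle\nabla h(p),X(p)\rangle_p$, and recursively $X^kh=X(X^{k-1}h)$. The tangent, crossing and sliding regions are $\Sigma^t=\{p\in\Sigma: F_+h(p)F_-h(p)=0\}$ (its points are the tangency points), $\Sigma^c=\{p\in\Sigma: F_+h(p)F_-h(p)>0\}$, $\Sigma^s=\{p\in\Sigma: F_+h(p)F_-h(p)<0\}$. A tangency point $p$ has finite multiplicity if there are natural numbers $m_+,m_-\ge2$ with $F_+^{m_+}h(p)\ne0$ and $F_-^{m_-}h(p)\neq0$. The sliding vector field on $\Sigma^s$ is $F_s(p)=\frac{F_-h(p)F_+(p)-F_+h(p)F_-(p)}{F_-h(p)-F_+h(p)}$.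 Filippov orbits. A Filippov solution (orbit) of $F$ is a continuous, piecewise smooth curve in $M$ whose smooth pieces are integral trajectories of $F_+$ (in $M_+$), of $F_-$ (in $M_-$) or of $F_s$ (in $\Sigma^s$, including its extension to points of $\Sigma^t$ when possible), the pieces being glued to each other at points of $\Sigma$: at points of $\Sigma^c$ by concatenating trajectories of $F_+$ in $M_+$ and $F_-$ in $M_-$, and at points of $\Sigma^s\cup\Sigma^t$ by any such concatenation. An orbit is maximal if its interval of definition cannot be enlarged. Standing assumption: maximal orbits are defined for all $t\in\mathbb R$. Orbit space. $\widetilde M$ is the set of all maximal orbits of $F$, with flow $\widetilde\Phi^t(\gamma)(s)=\gamma(t+s)$ and distance $$\widetilde d(\gamma_0,\gamma_1)=\sum_{i\in\mathbb Z}\frac1{2^{|i|}}\int_i^{i+1}d(\gamma_0(t),\gamma_1(t))\,dt .$$ Transitivity. A continuous flow $\Phi$ on a metric space $X$ is topologically transitive if for all nonempty open $U,V\subseteq X$ there is $t>0$ with $\Phi^t(U)\cap V\ne\emptyset$; it is transitive if some orbit $\{\Phi^t(x):t\in\mathbb R\}$ is dense in $X$. The Filippov vector field $F$ is transitive if there is a Filippov orbit whose image is dense in $M$. *)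

(* Defs.v *)
(* MathComp-Analysis. *)
From mathcomp Require Import all_boot all_order all_algebra.
From mathcomp Require Import all_classical all_reals all_analysis.

Set Implicit Arguments.
Unset Strict Implicit.
Unset Printing Implicit Defensive.

Import Order.TTheory GRing.Theory Num.Theory.
Import numFieldNormedType.Exports.

Local Open Scope classical_set_scope.
Local Open Scope ring_scope.

(** * Differential calculus on subsets of R^n *)

Section Calculus.
Context {R : realType}.

(* All partial derivatives of order at most [k] exist and are continuous on
   [U]; used for open [U]. *)
Fixpoint Ck_on n (W : normedModType R) (k : nat) (U : set 'rV[R]_n)
    (f : 'rV[R]_n -> W) : Prop :=
  (forall x, U x -> {for x, continuous f}) /\
  (if k is k'.+1 then
     forall i : 'I_n, (forall x, U x -> derivable f x (delta_mx 0 i)) /\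
       Ck_on k' U (fun x => 'D_(delta_mx 0 i) f x)
   else True).

(* Class C^k near [x], relatively to [A]: there is a local C^k extension to an
   open neighbourhood of [x] in R^n. *)
Definition Ck_at n (W : normedModType R) (k : nat) (A : set 'rV[R]_n)
    (f : 'rV[R]_n -> W) (x : 'rV[R]_n) : Prop :=
  exists (V : set 'rV[R]_n) (g : 'rV[R]_n -> W),
    [/\ open V, V x, Ck_on k V g & forall y, V y -> A y -> g y = f y].

(* Differential at [x] of the restriction of [f] to [A]. It is unique when [A]
   is open, or relatively open in a half-space. *)
Definition diff_within (V W : normedModType R) (A : set V) (f : V -> W)
    (x : V) : V -> W :=
  get [set L : V -> W | exists g : V -> W,
    [/\ \forall y \near x, A y -> g y = f y, differentiable g x
      & L = 'd g x]].

(* [{x | 0 <= x_0}] for [0 < n]; for [n = 0] it is the whole (one-point) space. *)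
Definition half_space {n} : set 'rV[R]_n :=
  [set x : 'rV[R]_n | forall i : 'I_n, i = 0%N :> nat -> 0 <= x 0 i].

Definition model_open n (C : set 'rV[R]_n) : Prop :=
  open C \/ exists2 W, open W & C = W `&` half_space.

End Calculus.

(** * Smooth manifolds with boundary *)

Section Manifold.
Variables (R : realType) (n : nat) (M : topologicalType).

Record chart := Chart {
  cdom : set M;
  ccod : set 'rV[R]_n;
  cmap : M -> 'rV[R]_n;
  cinv : 'rV[R]_n -> M;
  cdom_open : open cdom;
  ccod_open : model_open ccod;
  cmap_cod : forall p, cdom p -> ccod (cmap p);
  cinv_dom : forall x, ccod x -> cdom (cinv x);
  cmapK : forall p, cdom p -> cinv (cmap p) = p;
  cinvK : forall x, ccod x -> cmap (cinv x) = x;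
  cmap_continuous : {within cdom, continuous cmap};
  cinv_continuous : {within ccod, continuous cinv} }.

(* The atlas is presented as a choice of a chart around each point; tangent
   vectors at [p] are represented by their components in [chart_at p]. *)
Record manifold := Manifold {
  chart_at : M -> chart;
  chart_at_dom : forall p, cdom (chart_at p) p;
  transition_smooth : forall p q k x,
    ccod (chart_at p) x -> cdom (chart_at q) (cinv (chart_at p) x) ->
    Ck_at k (ccod (chart_at p))
      (cmap (chart_at q) \o cinv (chart_at p)) x;
  manifold_hausdorff : hausdorff_space M;
  manifold_second_countable : @second_countable M }.

End Manifold.

Section Tangent.
Variables (R : realType) (n : nat) (M : topologicalType) (A : manifold R n M).
Local Notation chart := (chart_at A).

(* Change of components, at the point [p], of a tangent vector [v], from the
   chart [c] to the chart [c']. *)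
Definition tchange (c c' : Defs.chart R n M) (p : M) (v : 'rV[R]_n) :
    'rV[R]_n :=
  diff_within (ccod c) (cmap c' \o cinv c) (cmap c p) v.

Definition Ck_fun (k : nat) (f : M -> R) : Prop :=
  forall q x, ccod (chart q) x ->
    Ck_at k (ccod (chart q)) (f \o cinv (chart q) : _ -> R^o) x.

Definition Ck_vfield (k : nat) (X : M -> 'rV[R]_n) : Prop :=
  forall q x, ccod (chart q) x ->
    Ck_at k (ccod (chart q))
      (fun y => let p := cinv (chart q) y in tchange (chart p) (chart q) p (X p))
      x.

Definition mdiff (f : M -> R) (p : M) (v : 'rV[R]_n) : R :=
  diff_within (ccod (chart p)) (f \o cinv (chart p) : _ -> R^o)
    (cmap (chart p) p) v.

(* [S] is an embedded C^k submanifold of codimension 1 (possibly with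
   boundary): around each of its points it is parametrized by an immersion
   of class C^k which is a homeomorphism onto an open subset of [S]. *)
Definition hypersurface (k : nat) (S : set M) : Prop :=
  forall p, S p -> exists (O : set M) (W : set 'rV[R]_n.-1)
      (s : 'rV[R]_n.-1 -> M) (s' : M -> 'rV[R]_n.-1),
    [/\ [/\ open O, O p & model_open W],
        [/\ s @` W = O `&` S, {in W, cancel s s'},
            {within W, continuous s} & {within O `&` S, continuous s'}],
        (forall q x, W x -> cdom (chart q) (s x) ->
           Ck_at k W (cmap (chart q) \o s) x) &
        (forall x, W x ->
           injective (diff_within W (cmap (chart (s x)) \o s) x))].

(* The entry [g p i j] is the inner product of the [i]-th and [j]-th coordinate
   vectors of [chart_at p]. *)
Definition inner (g : M -> 'M[R]_n) (p : M) (u v : 'rV[R]_n) : R :=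
  (u *m g p *m v^T) 0 0.

Record riemannian := Riemannian {
  metric :> M -> 'M[R]_n;
  metric_sym : forall p, (metric p)^T = metric p;
  metric_pos : forall p v, v != 0 -> 0 < inner metric p v v;
  metric_smooth : forall k q x (i j : 'I_n), ccod (chart q) x ->
    Ck_at k (ccod (chart q))
      (fun y => let p := cinv (chart q) y in
         inner metric p (tchange (chart q) (chart p) p (delta_mx 0 i))
                        (tchange (chart q) (chart p) p (delta_mx 0 j)) : R^o)
      x }.

Variable g : riemannian.

Definition tnorm (p : M) (v : 'rV[R]_n) : R := Num.sqrt (inner g p v v).

Definition gradient (f : M -> R) (p : M) : 'rV[R]_n :=
  (\row_i mdiff f p (delta_mx 0 i)) *m invmx (g p).

Definition lie (X : M -> 'rV[R]_n) (f : M -> R) : M -> R :=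
  fun p => inner g p (gradient f p) (X p).

(** ** Riemannian distance *)

Definition C1_arc (a b : R) (gamma : R -> M) : Prop :=
  forall t, a <= t <= b -> exists f : R -> 'rV[R]_n,
    [/\ \forall s \near t, derivable f s 1,
        \forall s \near t, {for s, continuous (derive1 f)} &
        \forall s \near t, a <= s <= b ->
          f s = cmap (chart (gamma t)) (gamma s)].

Definition piecewise_C1 (gamma : R -> M) : Prop :=
  {within `[0, 1], continuous gamma} /\
  exists2 S : set R, finite_set S &
    forall a b, 0 <= a -> a < b -> b <= 1 -> S `&` `]a, b[ = set0 ->
      C1_arc a b gamma.

Definition velocity (gamma : R -> M) (t : R) : 'rV[R]_n :=
  derive1 (cmap (chart (gamma t)) \o gamma) t.

Definition arc_length (gamma : R -> M) : \bar R :=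
  \int[@lebesgue_measure R]_(t in `[0, 1])
    (tnorm (gamma t) (velocity gamma t))%:E.

(* The value is [+oo] on pairs of points in distinct components of [M]. *)
Definition rdist (p q : M) : \bar R :=
  ereal_inf [set arc_length gamma | gamma in
    [set gamma | [/\ piecewise_C1 gamma, gamma 0 = p & gamma 1 = q]]].

End Tangent.

(** * Metric notions for a subset [X] of [T] and a distance [d] with values in
      the extended reals *)

Section Metric.
Variables (R : realType) (T : Type) (X : set T) (d : T -> T -> \bar R).
Local Open Scope ereal_scope.

Definition dopen (U : set T) : Prop :=
  U `<=` X /\ forall x, U x ->
    exists2 e : R, (0 < e)%R & forall y, X y -> d x y < e%:E -> U y.

Definition ddense (S : set T) : Prop :=
  S `<=` X /\ forall x, X x -> forall e : R, (0 < e)%R ->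
    exists2 y, S y & d x y < e%:E.

Definition dseparable : Prop := exists2 S : set T, countable S & ddense S.

Definition dcomplete : Prop :=
  forall u : nat -> T, (forall k, X (u k)) ->
    (forall e : R, (0 < e)%R -> exists N, forall k l, (N <= k)%N -> (N <= l)%N ->
       d (u k) (u l) < e%:E) ->
    exists2 x, X x & forall e : R, (0 < e)%R -> exists N, forall k, (N <= k)%N ->
       d (u k) x < e%:E.

Definition dperfect : Prop :=
  forall x, X x -> forall e : R, (0 < e)%R ->
    exists y, [/\ X y, y <> x & d x y < e%:E].

Variable Phi : R -> T -> T.

Definition topologically_transitive : Prop :=
  forall U V : set T, dopen U -> dopen V -> U !=set0 -> V !=set0 ->
    exists2 t : R, (0 < t)%R & (Phi t @` U) `&` V !=set0.

Definition flow_transitive : Prop :=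
  exists2 x, X x & ddense [set Phi t x | t in [set: R]].

End Metric.

(** * Filippov systems *)

Section Filippov.
Variables (R : realType) (n : nat) (M : topologicalType) (A : manifold R n M).
Variable g : riemannian A.
Local Notation chart := (chart_at A).

Record filippov := Filippov {
  reg : nat;
  switch : M -> R;
  Fplus : M -> 'rV[R]_n;
  Fminus : M -> 'rV[R]_n;
  reg_gt1 : (1 < reg)%N;
  switch_Ck : Ck_fun A reg switch;
  Fplus_Ck : Ck_vfield A reg Fplus;
  Fminus_Ck : Ck_vfield A reg Fminus;
  switch_regular : forall p, switch p = 0 -> exists v, mdiff A switch p v != 0;
  switch_compact : compact [set p | switch p = 0];
  switch_hypersurface : hypersurface A reg [set p | switch p = 0] }.

Variable F : filippov.
Local Notation h := (switch F).

Definition Sigma : set M := [set p | h p = 0].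
Definition Mplus : set M := [set p | 0 < h p].
Definition Mminus : set M := [set p | h p < 0].

Definition msgn (x : R) : set R :=
  [set s | [/\ 0 < x -> s = 1, x < 0 -> s = -1 & -1 <= s <= 1]].

Definition Fval (p : M) : set 'rV[R]_n :=
  [set 2^-1 *: (Fplus F p + Fminus F p)
       + s *: (2^-1 *: (Fplus F p - Fminus F p)) | s in msgn (h p)].

Definition Fnorm : \bar R :=
  ereal_sup [set e | exists p v, Fval p v /\ e = (tnorm g p v)%:E].

Definition Fplus_h : M -> R := lie g (Fplus F) h.
Definition Fminus_h : M -> R := lie g (Fminus F) h.

Definition Sigma_t : set M := [set p | Sigma p /\ Fplus_h p * Fminus_h p = 0].
Definition Sigma_c : set M := [set p | Sigma p /\ 0 < Fplus_h p * Fminus_h p].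
Definition Sigma_s : set M := [set p | Sigma p /\ Fplus_h p * Fminus_h p < 0].

(* The bound by [reg F] ensures that the iterated derivatives are defined. *)
Definition finite_multiplicity (p : M) : Prop :=
  exists mp mm : nat,
    [/\ (2 <= mp <= reg F)%N, (2 <= mm <= reg F)%N,
        iter mp (lie g (Fplus F)) h p != 0 &
        iter mm (lie g (Fminus F)) h p != 0].

Definition sliding (p : M) : 'rV[R]_n :=
  (Fminus_h p - Fplus_h p)^-1 *:
    (Fminus_h p *: Fplus F p - Fplus_h p *: Fminus F p).

(* [v] is the value at [p] of the sliding vector field, extended by continuity
   to the points of [Sigma_t] where this is possible. *)
Definition sliding_value (p : M) (v : 'rV[R]_n) : Prop :=
  (Sigma_s p /\ v = sliding p) \/
  [/\ Sigma_t p, closure Sigma_s p &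
      (fun q => tchange (chart q) (chart p) q (sliding q))
        @ within Sigma_s (nbhs p) --> v].

(** ** Orbits *)

Definition has_velocity (gamma : R -> M) (t : R) (v : 'rV[R]_n) : Prop :=
  is_derive (t : R^o) (1 : R^o) (cmap (chart (gamma t)) \o gamma) v.

Definition plus_piece (J : set R) (gamma : R -> M) : Prop :=
  forall t, J t -> Mplus (gamma t) /\ has_velocity gamma t (Fplus F (gamma t)).

Definition minus_piece (J : set R) (gamma : R -> M) : Prop :=
  forall t, J t -> Mminus (gamma t) /\ has_velocity gamma t (Fminus F (gamma t)).

Definition sliding_piece (J : set R) (gamma : R -> M) : Prop :=
  forall t, J t -> exists2 v, sliding_value (gamma t) v & has_velocity gamma t v.

Definition smooth_piece (J : set R) (gamma : R -> M) : Prop :=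
  [\/ plus_piece J gamma, minus_piece J gamma | sliding_piece J gamma].

(* [gamma] restricted to the nondegenerate interval [I] is a Filippov orbit; [S]
   is the (locally finite) set of gluing times. *)
Definition filippov_orbit (I : set R) (gamma : R -> M) : Prop :=
  [/\ is_interval I, (exists a b, [/\ I a, I b & a < b]),
      {within I, continuous gamma} &
      exists S : set R,
        [/\ S `<=` I `&` gamma @^-1` Sigma,
            (forall a b, I a -> I b -> finite_set (S `&` `[a, b])),
            (forall a b, I a -> I b -> a < b -> S `&` `]a, b[ = set0 ->
               smooth_piece `]a, b[ gamma) &
            (forall a t b, I a -> I b -> a < t < b ->
               S `&` `]a, b[ = [set t] -> Sigma_c (gamma t) ->
               (plus_piece `]a, t[ gamma /\ minus_piece `]t, b[ gamma) \/
               (minus_piece `]a, t[ gamma /\ plus_piece `]t, b[ gamma))]].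

Definition maximal_orbit (I : set R) (gamma : R -> M) : Prop :=
  filippov_orbit I gamma /\
  forall J gamma', filippov_orbit J gamma' -> I `<=` J ->
    (forall t, I t -> gamma' t = gamma t) -> J = I.

Definition filippov_transitive : Prop :=
  exists (I : set R) (gamma : R -> M),
    filippov_orbit I gamma /\ ddense [set: M] (rdist g) (gamma @` I).

(** ** Orbit space, under the assumption that maximal orbits are global *)

Definition orbit_space : set (R -> M) := maximal_orbit [set: R].

Definition orbit_flow (t : R) (gamma : R -> M) : R -> M :=
  fun s => gamma (t + s).

Definition orbit_dist (gamma0 gamma1 : R -> M) : \bar R :=
  (\esum_(i in [set: int])
     ((2^-1 ^+ `|i|%N)%:E *
      \int[@lebesgue_measure R]_(t in `[i%:~R, (i%:~R + 1)%R])
        rdist g (gamma0 t) (gamma1 t)))%E.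

End Filippov.

(* Main.v *)
Require Import Defs.
From HB Require Import structures.
From mathcomp Require Import all_boot all_order all_algebra.
From mathcomp Require Import all_classical all_reals all_analysis.
From mathcomp Require Import measurable_realfun zify ring lra.

(* The length metric is controlled from above by straight segments in charts: a
   curve which is differentiable at [t], with speed less than [K], satisfies
   [rdist (gamma s) (gamma t) <= K * |s - t|] for [s] near [t], and a continuous
   induction along the curve turns this into a Lipschitz bound. Hence all orbits
   are [C]-Lipschitz with [C] slightly larger than the norm of the system.

   (1) By Peano's theorem there is an orbit through a point near any given point
   (an interior point off the switching manifold), and by Zorn's lemma it extends
   to an element of the orbit space. If a translate of [gamma0] is close to it in
   the integral distance, then, orbits being Lipschitz, [gamma0] passes close to
   the given point.

   (2) Orbits may be glued freely at tangency points. Given [gamma0] and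
   [gamma1], follow [gamma0] up to a late visit to [TT], connect inside [TT], and
   continue with [gamma1] from an early visit to [TT]: the result agrees with
   [gamma0] on a long past and, after a translation, with [gamma1] on a long
   future, and the linear growth of the distance is beaten by the weights
   [2^-|i|]. Gluing infinitely many orbit segments in the same way, so that they
   visit neighbourhoods of the points of a countable dense set, yields a dense
   orbit without any Baire category argument. *)

Set Implicit Arguments.
Unset Strict Implicit.
Unset Printing Implicit Defensive.

Import Order.TTheory GRing.Theory Num.Theory.
Import numFieldNormedType.Exports.

Local Open Scope classical_set_scope.
Local Open Scope ring_scope.

(** * Mean value inequality and C^1 maps *)

(** Symmetry of [rdist] is not established, so estimates along curves are carried in both directions
    and the triangle inequality can be used in whichever order the orbit distance requires. Two
    features of manifolds shape the first half. At boundary points differentials are those of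
    extensions across the boundary; they are well defined because the inward directions span. The
    chart that gives the components of vectors at [p] may jump with [p], so speeds are compared in
    one fixed chart through [gnorm]. An orbit is defined through a gluing set on its whole interval,
    which is awkward to restrict, translate or concatenate. The local condition [orbit_at] replaces
    it, and free gluing at a tangency point then means that the crossing clause is vacuous there,
    because the product of the two derivatives of [h] is 0. The distance between two orbits as a
    function of time comes without measurability, so its integrals are estimated directly as suprema
    over simple functions. *)

Section RealLine.
Context {R : realType}.

(** Continuous induction: the supremum [c0] of the times reached from [a] can be passed, since the
    interval around [c0] given by the local hypothesis joins a reached time just before [c0] to a
    time beyond it. *)
Lemma cousin (a b : R) (P : R -> R -> Prop) : a <= b ->
  (forall s t u, a <= s -> s <= t -> t <= u -> u <= b ->
     P s t -> P t u -> P s u) ->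
  (forall x, a <= x <= b -> exists2 d, 0 < d &
     forall s t, a <= s -> s <= x -> x <= t -> t <= b -> x - d < s -> t < x + d ->
       P s t) ->
  P a b.
Proof.
move=> ab Ptrans Ploc.
pose E := [set c | a <= c <= b /\ P a c].
have Ea : E a.
  split; first by rewrite lexx.
  have [|d d0 +] := Ploc a; first by rewrite lexx.
  by apply => //; lra.
have supE : has_sup E by split; [exists a | exists b => c [/andP[]]].
set c0 := sup E.
have ac0 : a <= c0 by apply: sup_upper_bound.
have c0b : c0 <= b.
  by apply: ge_sup; [exists a|move=> c [/andP[]]].
have [|d d0 Hd] := Ploc c0; first by rewrite ac0.
have [c [/andP[ac cb] Pac] cc0] := sup_adherent d0 supE.
have cc0' : c <= c0 by apply: sup_upper_bound => //; split; [rewrite ac cb|].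
have [c0db|bc0d] := leP (c0 + d / 2) b; last first.
  by apply: (Ptrans _ c) => //; apply: Hd => //; rewrite -/c0 in cc0 *; lra.
exfalso.
suff : c0 + d / 2 <= c0 by lra.
apply: sup_upper_bound => //; split; first by apply/andP; split=> //; lra.
apply: (Ptrans _ c) => //; first by lra.
by apply: Hd => //; rewrite -/c0 in cc0 *; lra.
Qed.

Lemma le_addgt0_mul (x y : R) (K : R) : 0 <= K -> (forall e, 0 < e -> x <= y + e * K) -> x <= y.
Proof.
move=> K0 H; apply/ler_addgt0Pr => e e0.
apply: (le_trans (H (e / (K + 1)) _)); first by rewrite divr_gt0 ?ltr_wpDl.
rewrite lerD2l mulrAC ler_pdivrMr ?ltr_wpDl//.
by rewrite ler_pM2l// lerDl.
Qed.

(** The values are vectors, so Rolle's theorem does not apply. With [K + e] in place of [K] the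
    bound holds near each point by differentiability and adds up along intervals; then [e] tends to
    0. *)
Lemma mean_value_ineq (W : normedModType R) (f df : R -> W) (a b K : R) :
  a <= b -> (forall t, a <= t <= b -> is_derive (t : R^o) (1 : R^o) f (df t)) ->
  (forall t, a <= t <= b -> `|df t| <= K) ->
  `|f b - f a| <= K * (b - a).
Proof.
move=> ab fdf dfK.
have ba0 : 0 <= b - a by rewrite subr_ge0.
apply: (@le_addgt0_mul _ _ (b - a)) => // e e0; rewrite -mulrDl.
apply: (@cousin a b (fun s t => `|f t - f s| <= (K + e) * (t - s))) => //.
  move=> s t u _ st tu _ H1 H2.
  rewrite -(subrK (f t) (f u)) -addrA (le_trans (ler_normD _ _))//.
  by rewrite (le_trans (lerD H2 H1))//; lra.
move=> x xab.
have [fx dfx] := fdf x xab.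
have : h^-1 *: (f (h *: (1 : R^o) + x) - f x) @[h --> 0^'] --> df x.
  by rewrite -dfx; exact: fx.
move/cvgrPdist_lt => /(_ e e0).
rewrite near_withinE => /nbhs_ballP[d /= d0 Hd].
have key s : `|s - x| < d -> `|f s - f x| <= (K + e) * `|s - x|.
  have [->|sx] := eqVneq s x; first by rewrite !subrr !normr0 mulr0.
  move=> sxd.
  have := Hd (s - x); rewrite /ball /= sub0r normrN => /(_ sxd).
  rewrite subr_eq0 => /(_ sx).
  have -> : (s - x) *: (1 : R^o) + x = s by rewrite [_ *: _]mulr1 subrK.
  move=> H.
  have {}H : `|(s - x)^-1 *: (f s - f x)| <= K + e.
    rewrite -[X in `|X|](subrK (df x)) (le_trans (ler_normD _ _))// addrC lerD ?dfK//.
    by rewrite distrC ltW.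
  move: H; rewrite normrZ normfV -ler_pdivlMl ?invr_gt0 ?normr_gt0 ?subr_eq0//.
  by rewrite invrK mulrC.
exists d => // s t as_ sx xt tb sd td.
have /key Hs : `|s - x| < d by rewrite ler0_norm; lra.
have /key Ht : `|t - x| < d by rewrite ger0_norm; lra.
rewrite -(subrK (f x) (f t)) -addrA (le_trans (ler_normD _ _))//.
rewrite distrC ler0_norm ?subr_le0// in Hs.
rewrite ger0_norm ?subr_ge0// in Ht.
by rewrite (le_trans (lerD Ht Hs))//; lra.
Qed.

Lemma is_derive_chain (V W : normedModType R) (f : V -> W) (y : R -> V) (t : R) (v : V) :
  differentiable f (y t) -> is_derive (t : R^o) (1 : R^o) y v ->
  is_derive (t : R^o) (1 : R^o) (f \o y) ('d f (y t) v).
Proof.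
move=> fd [yd yv].
have yt : differentiable (y : R^o -> V) t by exact/derivable1_diffP.
have fyt : differentiable (f \o y : R^o -> W) t by exact: differentiable_comp.
apply: DeriveDef; first exact: diff_derivable.
by rewrite deriveE// diff_comp//= -yv deriveE.
Qed.

Lemma is_derive_affine (W : normedModType R) (f : R -> W) (k c t : R) (d : W) :
  is_derive (k * t + c : R^o) (1 : R^o) f d ->
  is_derive (t : R^o) (1 : R^o) (fun s => f (k * s + c)) (k *: d).
Proof.
move=> fd.
have g : is_derive (t : R^o) (1 : R^o) (fun s : R => k * s + c : R^o) k.
  have := @is_deriveD R R^o R^o _ _ (t : R^o) (1 : R^o) _ _
    (@is_deriveZ R R^o R^o id k (t : R^o) (1 : R^o) 1 (is_derive_id _ _))
    (is_derive_cst (c : R^o) (t : R^o) (1 : R^o)).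
  by rewrite /GRing.scale/= mulr1 addr0.
have [fd1 fd2] := fd.
have fdiff : differentiable (f : R^o -> W) (k * t + c) by exact/derivable1_diffP.
have := @is_derive_chain R^o W f (fun s : R => k * s + c : R^o) t k fdiff g.
move=> /is_derive_eq; apply.
transitivity ('d (f : R^o -> W) (k * t + c) (k *: (1 : R^o))); first by rewrite [k *: _]mulr1.
by rewrite linearZ/= -deriveE ?fd2.
Qed.

Lemma is_derive_line (V W : normedModType R) (f : V -> W) (x v : V) (s : R) :
  derivable f (s *: v + x) v ->
  is_derive (s : R^o) (1 : R^o) (fun s => f (s *: v + x)) ('D_v f (s *: v + x)).
Proof.
move=> fv.
have E' : (fun h : R => h^-1 *: (((fun s => f (s *: v + x)) \o shift (s : R^o)) (h *: (1 : R^o)) - f (s *: v + x))) =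
         (fun h : R => h^-1 *: ((f \o shift (s *: v + x)) (h *: v) - f (s *: v + x))).
  by apply/funext => h /=; rewrite [h *: 1]mulr1 scalerDl addrA.
apply: DeriveDef; first by rewrite /derivable E'; exact: fv.
by rewrite /derive E'.
Qed.

Lemma cvg_sumr (T : Type) (W : normedModType R) (I : Type) (r : seq I)
    (F : set_system T) (f : I -> T -> W) (l : I -> W) : Filter F ->
  (forall i, f i x @[x --> F] --> l i) ->
  \sum_(i <- r) f i x @[x --> F] --> \sum_(i <- r) l i.
Proof.
move=> FF fl; elim: r => [|i r IH].
  rewrite big_nil (_ : (fun _ => _) = cst 0); first exact: cvg_cst.
  by apply/funext => x; rewrite big_nil.
rewrite big_cons (_ : (fun _ => _) = (fun x => f i x + \sum_(j <- r) f j x)).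
  exact: cvgD.
by apply/funext => x; rewrite big_cons.
Qed.

End RealLine.

(** * Continuous partial derivatives imply differentiability *)

Section C1diff.
Context {R : realType}.

Lemma Ck_on0 n (W : normedModType R) k (U : set 'rV[R]_n) (f : 'rV[R]_n -> W) :
  Ck_on k U f -> forall x, U x -> {for x, continuous f}.
Proof. by case: k => [|k] []. Qed.

Lemma rV_norm_coord n (v : 'rV[R]_n) i : `|v 0 i| <= `|v|.
Proof.
rewrite [leRHS]/Num.norm/= mx_normrE.
exact: (le_bigmax _ (fun ij : 'I_1 * 'I_n => `|v ij.1 ij.2|) (0, i)).
Qed.

Lemma rV_norm_le n (v : 'rV[R]_n) c : 0 <= c -> (forall i, `|v 0 i| <= c) -> `|v| <= c.
Proof.
move=> c0 H; rewrite [leLHS]/Num.norm/= mx_normrE.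
by apply: bigmax_le => // -[i j] _ /=; rewrite (ord1 i).
Qed.

(** The displacement [v] is added one coordinate at a time. Each increment is compared with the
    partial derivative at [x] by the mean value inequality, and continuity of the partial
    derivatives makes the total error [o(v)]. *)
Lemma C1_differentiable n (W : normedModType R) (U : set 'rV[R]_n)
    (f : 'rV[R]_n -> W) x : open U -> Ck_on 1 U f -> U x -> differentiable f x.
Proof.
move=> Uo [_ fU] Ux.
pose L (v : 'rV[R]_n) : W := \sum_i v 0 i *: 'D_(delta_mx 0 i) f x.
have Llin : linear L.
  move=> c u v; rewrite /L scaler_sumr -big_split/=; apply: eq_bigr => i _.
  by rewrite !mxE scalerDl scalerA.
pose L' := GRing.isLinear.Build _ _ _ _ L Llin.
pose LL : {linear 'rV[R]_n -> W} := HB.pack L L'.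
have Lcont : continuous LL.
  move=> v; apply: (@cvg_sumr _ _ _ _ _ (nbhs v) (fun i (u : 'rV[R]_n) => u 0 i *: 'D_(delta_mx 0 i) f x)) => i.
  by apply: (@cvgZr_tmp _ _ _ (nbhs v)); exact: coord_continuous.
have Lo : f \o shift x = cst (f x) + (LL : 'rV[R]_n -> W) +o_ (0 : 'rV[R]_n) (id : 'rV[R]_n -> 'rV[R]_n).
  apply/eqaddoP => e e0.
  (* Each of the [n] coordinate steps contributes an error [e' * |v|]; the added 1 covers
     [n = 0]. *)
  pose e' := e / (n%:R + 1).
  have e'0 : 0 < e' by rewrite divr_gt0// ltr_wpDl.
  have : \forall y \near x, U y /\ forall i, `|'D_(delta_mx 0 i) f y - 'D_(delta_mx 0 i) f x| < e'.
    apply: filterI; first exact: open_nbhs_nbhs.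
    suff H i : \forall y \near x, `|'D_(delta_mx 0 i) f y - 'D_(delta_mx 0 i) f x| < e'.
      exact: (@filter_forall _ _ (fun i y => `|'D_(delta_mx 0 i) f y - 'D_(delta_mx 0 i) f x| < e') (nbhs x) _ H).
    have [_ [/(_ x Ux) /cvgrPdist_lt/(_ _ e'0) H _]] := fU i.
    by apply: filterS H => y; rewrite distrC.
  move=> /nbhs_ballP[d /= d0 Hd].
  near=> v.
  have vd : `|v| < d.
    by near: v; apply: cvgr0_norm_lt; [exact: cvg_id|].
  (* [w k] keeps the first [k] coordinates of [v], so the differences telescope from [x] to
     [v + x]. *)
  pose w k : 'rV[R]_n := \row_i (if (i < k)%N then v 0 i else 0).
  have w0 : w 0%N = 0 by apply/rowP => i; rewrite !mxE.
  have wn : w n = v by apply/rowP => i; rewrite !mxE ltn_ord.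
  have wS (k : 'I_n) : w k.+1 = w k + v 0 k *: delta_mx 0 k.
    apply/rowP => i; rewrite !mxE eqxx /= -val_eqE ltnS leq_eqVlt/=.
    by case: (ltngtP i k) => [ik|ik|/val_inj ->]; rewrite ?mulr0 ?mulr1 ?addr0 ?add0r.
  rewrite /= [X in `|X|](_ : _ = f (v + x) - f x - LL v); last first.
    by rewrite !fctE /= opprD addrA.
  have -> : f (v + x) - f x - LL v =
     \sum_(k < n) (f (w k.+1 + x) - f (w k + x) - v 0 k *: 'D_(delta_mx 0 k) f x).
    rewrite sumrB; congr (_ - _).
    rewrite -(big_mkord xpredT (fun k => f (w k.+1 + x) - f (w k + x))).
    by rewrite telescope_sumr// wn w0 add0r.
  apply: (le_trans (ler_norm_sum _ _ _)).
  apply: (@le_trans _ _ (\sum_(k < n) e' * `|v|)); last first.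
    rewrite sumr_const card_ord -mulr_natl mulrA ler_wpM2r//.
    by rewrite /e' mulrA ler_pdivrMr ?ltr_wpDl// mulrC ler_pM2l// lerDl.
  apply: ler_sum => k _.
  pose ek : 'rV[R]_n := delta_mx 0 k.
  pose vk := v 0 k; pose D := 'D_ek f.
  (* Subtracting the linear part leaves a function whose derivative [dg] is a variation of the
     partial derivative, hence small. *)
  pose g (s : R) := f (s *: ek + (w k + x)) - s *: D x.
  pose dg (s : R) := D (s *: ek + (w k + x)) - D x.
  have bnd s : `|s| <= `|vk| -> ball x d (s *: ek + (w k + x)).
    move=> svk; rewrite -ball_normE /=.
    rewrite distrC addrA addrK (le_lt_trans _ vd)//.
    apply: rV_norm_le => // i; rewrite !mxE eqxx /= -val_eqE /=.
    case: (ltngtP i k) => [ik|ik|_]; rewrite ?mulr0 ?add0r ?mulr1 ?addr0 ?normr0//.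
      exact: rV_norm_coord.
    by rewrite (le_trans svk)// rV_norm_coord.
  (* [vk] may be negative, so the path from 0 to [vk] is reparametrized over the unit interval; the
     [+ 0] gives it the affine shape of [is_derive_affine]. *)
  have := @mean_value_ineq _ _ (fun s => g (vk * s + 0)) (fun s => vk *: dg (vk * s + 0)) 0 1 (e' * `|v|) ler01.
  have -> : g (vk * 1 + 0) = f (w k.+1 + x) - v 0 k *: D x.
    by rewrite /g mulr1 addr0 wS addrA [_ *: ek + _]addrC.
  have -> : g (vk * 0 + 0) = f (w k + x) by rewrite /g mulr0 addr0 !scale0r add0r subr0.
  rewrite subr0 mulr1 addrAC; apply.
    move=> s /andP[s0 s1]; apply: is_derive_affine; rewrite addr0.
    have Us : U ((vk * s) *: ek + (w k + x)).
      by apply: (Hd _ _).1; apply: bnd; rewrite normrM (ger0_norm s0) ler_piMr.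
    have [/(_ _ Us) fd _] := fU k.
    apply: is_deriveB; first exact: is_derive_line.
    have ld : differentiable ((fun z : R^o => z *: D x) : R^o -> W) (vk * s) by exact: differentiableZl.
    have := @is_derive_chain R R^o W (fun z : R^o => z *: D x) id (vk * s) 1 ld (is_derive_id _ _).
    move=> /is_derive_eq; apply; rewrite diffZl//=.
    by rewrite -deriveE// derive_id scale1r.
  move=> s /andP[s0 s1]; rewrite addr0 normrZ mulrC ler_pM//; last exact: rV_norm_coord.
  by rewrite ltW// (Hd _ _).2//; apply: bnd; rewrite normrM (ger0_norm s0) ler_piMr.
apply/diff_locallyP; rewrite (diff_unique Lcont Lo); split => //; exact: Lo.
Unshelve. all: by end_near.
Qed.

End C1diff.

(** * Tangent vectors in charts *)

Section DiffWithin.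
Context {R : realType} {n : nat}.
Implicit Types (W : normedModType R) (A : set 'rV[R]_n) (x v : 'rV[R]_n).

Lemma cvg_line (W : normedModType R) (v x : W) : (t *: v + x) @[t --> (0 : R)] --> x.
Proof.
rewrite -[X in _ --> X]add0r -[X in _ --> X + _](scale0r v).
by apply: cvgD; [apply: cvgZr_tmp; exact: cvg_id|exact: cvg_cst].
Qed.

(** Adding nonnegative coordinates preserves [half_space], so these directions point into a model
    set even from its boundary. *)
Lemma model_open_nneg A x v : model_open A -> A x -> (forall i, 0 <= v 0 i) ->
  \forall t \near 0, 0 <= t -> A ((t : R) *: v + x).
Proof.
move=> mA Ax v0.
have cv := @cvg_line _ v x.
case: mA => [Ao|[U Uo AE]].
  have : \forall t \near 0, A ((t : R) *: v + x).
    by apply: cv; exact: open_nbhs_nbhs.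
  by apply: filterS => t.
have Ux : U x by move: Ax; rewrite AE => -[].
have : \forall t \near 0, U ((t : R) *: v + x).
  by apply: cv; exact: open_nbhs_nbhs.
apply: filterS => t Ut t0; rewrite AE; split => // i i0; rewrite !mxE.
by rewrite addr_ge0 ?mulr_ge0//; move: Ax; rewrite AE => -[_]; apply.
Qed.

(** Nonnegative vectors span: [v] is the difference of [v + u] and [u], where [u] is the vector of
    absolute values. *)
Lemma linear_eq_nneg W (F G : {linear 'rV[R]_n -> W}) :
  (forall v : 'rV[R]_n, (forall i, 0 <= v 0 i) -> F v = G v) -> F =1 G.
Proof.
move=> FG v; pose u : 'rV[R]_n := \row_i `|v 0 i|.
rewrite -[v](addrK u) !linearB !FG// => i; rewrite !mxE//.
by rewrite -lerBlDl sub0r -normrN ler_norm.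
Qed.

(** Along a nonnegative direction the difference [D] vanishes for small positive parameters, so its
    directional derivative is 0; such directions determine a linear map. This is what makes
    differentials at boundary points well defined. *)
Lemma diff_model_unique W A (f g : 'rV[R]_n -> W) x : model_open A -> A x ->
  differentiable f x -> differentiable g x ->
  (\forall y \near x, A y -> f y = g y) -> 'd f x = 'd g x :> ('rV[R]_n -> W).
Proof.
move=> mA Ax df dg fg.
have fgx : f x = g x by exact: (nbhs_singleton fg).
pose D := f - g.
have dD : differentiable D x by exact: differentiableB.
have nn v : (forall i, 0 <= v 0 i) -> 'd f x v = 'd g x v.
  move=> v0; apply/eqP; rewrite -subr_eq0; apply/eqP.
  have -> : 'd f x v - 'd g x v = 'd D x v by rewrite diffB.
  rewrite -deriveE//; apply/eqP; rewrite -normr_le0; apply/ler_addgt0Pr => e e0.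
  have /cvg_ex[l Hl] : derivable D x v by exact: diff_derivable.
  have Dl : 'D_v D x = l by exact: cvg_lim Hl.
  rewrite Dl.
  move/cvgrPdist_lt : Hl => /(_ e e0); rewrite near_withinE /= => Hl.
  have cv := @cvg_line _ v x.
  have nfg : \forall t \near 0, A ((t:R) *: v + x) -> f (t *: v + x) = g (t *: v + x) by exact: cv fg.
  have mAv := model_open_nneg mA Ax v0.
  have /nbhs_ballP[d /= d0 Hd] : \forall t \near (0 : R),
    [/\ t != 0 -> `|l - t^-1 *: ((D \o shift x) (t *: v) - D x)| < e,
        0 <= t -> A (t *: v + x) & A (t *: v + x) -> f (t *: v + x) = g (t *: v + x)].
    by apply: filterS3 Hl mAv nfg.
  have [] := Hd (d / 2).
    by rewrite -ball_normE /= sub0r normrN ger0_norm ?ltr_pdivrMr ?divr_ge0 ?ltW// ltr_pMr// ltr1n.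
  have dd0 : 0 < d / 2 by rewrite divr_gt0.
  rewrite gt_eqF// => /(_ isT) + /(_ (ltW dd0)) AA /(_ AA) fgE.
  rewrite /D !fctE /= fgE fgx !subrr scaler0 subr0 => /ltW.
  by rewrite add0r.
by apply/funext; exact: linear_eq_nneg.
Qed.

(** Frees [diff_within] from the choice made by [get]: whichever extension was chosen, its
    differential agrees with that of [g]. *)
Lemma diff_withinE W A (f g : 'rV[R]_n -> W) x : model_open A -> A x ->
  differentiable g x -> (\forall y \near x, A y -> g y = f y) ->
  diff_within A f x = 'd g x.
Proof.
move=> mA Ax dg gf; rewrite /diff_within.
have [|g' [g'f dg' ->]] := @getPex _ [set L : 'rV[R]_n -> W | exists g : 'rV[R]_n -> W,
    [/\ \forall y \near x, A y -> g y = f y, differentiable g x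
      & L = 'd g x]].
  by exists ('d g x : 'rV[R]_n -> W), g.
apply: (diff_model_unique mA Ax) => //.
by apply: filterS2 g'f gf => y H1 H2 Ay; rewrite H1// H2.
Qed.

Lemma Ck_at_cvg W k A (f : 'rV[R]_n -> W) x : A x -> Ck_at k A f x ->
  f @ within A (nbhs x) --> f x.
Proof.
move=> Ax [V [g [Vo Vx gV gf]]].
rewrite -(gf x)//.
have : g @ within A (nbhs x) --> g x.
  by apply: cvg_trans (Ck_on0 gV Vx); apply: cvg_app; exact: cvg_within.
apply: cvg_trans; apply: near_eq_cvg; rewrite near_withinE.
have : nbhs x V by exact: open_nbhs_nbhs.
by apply: filterS => y Vy Ay; rewrite gf.
Qed.

End DiffWithin.

Section Charts.
Context {R : realType} {n : nat} {M : topologicalType} (A : manifold R n M).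
Local Notation ch := (chart_at A).
Implicit Types (p q r z : M) (x u v w : 'rV[R]_n).

Lemma cinv_near (c : chart R n M) x (O : set M) : ccod c x -> open O ->
  O (cinv c x) -> \forall y \near x, ccod c y -> O (cinv c y).
Proof.
move=> cx Oo Ox.
have /subspace_continuousP/(_ _ cx) := @cinv_continuous _ _ _ c.
by move=> /(_ O (open_nbhs_nbhs (conj Oo Ox))).
Qed.

Lemma cmap_cvg (c : chart R n M) p : cdom c p -> cmap c @ p --> cmap c p.
Proof.
move=> cp.
have /subspace_continuousP/(_ _ cp) := @cmap_continuous _ _ _ c.
have pi : (cdom c)^° p by apply: open_nbhs_nbhs; split => //; exact: cdom_open.
by rewrite (within_interior pi).
Qed.

(** Presents [tchange] as the differential of an extension of the transition map, so that linearity
    and the chain rule apply at boundary points too. *)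
Lemma tchangeP q r z : cdom (ch q) z -> cdom (ch r) z ->
  exists g : 'rV[R]_n -> 'rV[R]_n,
  [/\ differentiable g (cmap (ch q) z),
      \forall y \near cmap (ch q) z, ccod (ch q) y -> g y = cmap (ch r) (cinv (ch q) y)
    & tchange (ch q) (ch r) z = 'd g (cmap (ch q) z)].
Proof.
move=> qz rz; have cz := cmap_cod qz.
have [|V [g [Vo Vx gV gf]]] := @transition_smooth _ _ _ A q r 1 _ cz.
  by rewrite cmapK.
have dg : differentiable g (cmap (ch q) z) by exact: C1_differentiable gV Vx.
have gE : \forall y \near cmap (ch q) z, ccod (ch q) y -> g y = cmap (ch r) (cinv (ch q) y).
  have : nbhs (cmap (ch q) z) V by exact: open_nbhs_nbhs.
  by apply: filterS => y Vy Ay; rewrite gf.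
exists g; split => //.
apply/funext => v; rewrite /tchange (@diff_withinE _ _ _ _ _ g)//.
exact: ccod_open.
Qed.

Lemma tchange_sum q r z u : cdom (ch q) z -> cdom (ch r) z ->
  tchange (ch q) (ch r) z u = \sum_i u 0 i *: tchange (ch q) (ch r) z (delta_mx 0 i).
Proof.
move=> qz rz; have [g [_ _ ->]] := tchangeP qz rz.
by rewrite {1}(row_sum_delta u) linear_sum; apply: eq_bigr => i _; rewrite linearZ.
Qed.

Lemma tchange_id q z v : cdom (ch q) z -> tchange (ch q) (ch q) z v = v.
Proof.
move=> qz; rewrite /tchange (@diff_withinE _ _ _ _ _ id).
- by rewrite -deriveE// derive_id.
- exact: ccod_open.
- exact: cmap_cod.
- exact: ex_diff.
- by apply: (@filterE _ (nbhs (cmap (ch q) z))) => y cy /=; rewrite cinvK.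
Qed.

Lemma tchange_comp p q r z v :
  cdom (ch p) z -> cdom (ch q) z -> cdom (ch r) z ->
  tchange (ch q) (ch r) z (tchange (ch p) (ch q) z v) = tchange (ch p) (ch r) z v.
Proof.
move=> pz qz rz.
have [f [df fE ->]] := tchangeP pz qz.
have [g [dg gE ->]] := tchangeP qz rz.
have fz : f (cmap (ch p) z) = cmap (ch q) z.
  by rewrite (nbhs_singleton fE) ?cmapK//; exact: cmap_cod.
rewrite /tchange (@diff_withinE _ _ _ _ _ (g \o f)).
- have dg' : differentiable g (f (cmap (ch p) z)) by rewrite fz.
  rewrite -fz.
  by have /(congr1 (fun h => h v)) := diff_comp df dg'.
- exact: ccod_open.
- exact: cmap_cod.
- by apply: differentiable_comp; [exact: df|rewrite fz].
- have cf : \forall y \near cmap (ch p) z, ccod (ch q) (f y) -> g (f y) = cmap (ch r) (cinv (ch q) (f y)).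
    have cf := differentiable_continuous df.
    by rewrite -fz in gE; exact: cf gE.
  have pq := @cinv_near (ch p) _ _ (cmap_cod pz) (@cdom_open _ _ _ (ch q)).
  rewrite cmapK// in pq; have {}pq := pq qz.
  near=> y => cy.
  have qy : cdom (ch q) (cinv (ch p) y) by move: cy; near: y.
  have fy : f y = cmap (ch q) (cinv (ch p) y) by move: cy; near: y.
  have gfy : ccod (ch q) (f y) -> g (f y) = cmap (ch r) (cinv (ch q) (f y)) by near: y.
  by rewrite /= gfy fy ?cmapK//; exact: cmap_cod.
Unshelve. all: by end_near.
Qed.

Lemma tchangeK p q z v : cdom (ch p) z -> cdom (ch q) z ->
  tchange (ch q) (ch p) z (tchange (ch p) (ch q) z v) = v.
Proof. by move=> pz qz; rewrite tchange_comp// tchange_id. Qed.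

Lemma is_derive_change (gamma : R -> M) (t : R) v q r :
  (\forall s \near t, cdom (ch q) (gamma s)) -> cdom (ch r) (gamma t) ->
  is_derive (t : R^o) (1 : R^o) (cmap (ch q) \o gamma) v ->
  is_derive (t : R^o) (1 : R^o) (cmap (ch r) \o gamma)
    (tchange (ch q) (ch r) (gamma t) v).
Proof.
move=> qn rt dv.
have qt := nbhs_singleton qn.
have [f [df fE ->]] := tchangeP qt rt.
have := is_derive_chain (y := cmap (ch q) \o gamma) df dv.
apply: near_eq_is_derive => //.
have ct : {for t, continuous (cmap (ch q) \o gamma : R^o -> _)}.
  by apply: differentiable_continuous; apply/derivable1_diffP; case: dv.
have fEt : \forall s \near t, ccod (ch q) (cmap (ch q) (gamma s)) ->
    f (cmap (ch q) (gamma s)) = cmap (ch r) (cinv (ch q) (cmap (ch q) (gamma s))).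
  exact: ct _ fE.
near=> s => /=.
have qs : cdom (ch q) (gamma s) by near: s.
have -> : f (cmap (ch q) (gamma s)) = cmap (ch r) (cinv (ch q) (cmap (ch q) (gamma s))).
  by have := cmap_cod qs; near: s.
by rewrite cmapK.
Unshelve. all: by end_near.
Qed.

Lemma near_cdom (gamma : R -> M) (t : R) : {for t, continuous gamma} ->
  forall q, cdom (ch q) (gamma t) -> \forall s \near t, cdom (ch q) (gamma s).
Proof. by move=> ct q qt; apply: ct; apply: open_nbhs_nbhs; split => //; exact: cdom_open. Qed.

Variable g : riemannian A.

(* The length of the tangent vector at [cinv (ch q) x] with components [u] in the
   chart at [q]. *)
Definition gnorm q x u : R :=
  tnorm g (cinv (ch q) x) (tchange (ch q) (ch (cinv (ch q) x)) (cinv (ch q) x) u).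

Lemma gnorm_cmap q p u : cdom (ch q) p ->
  gnorm q (cmap (ch q) p) u = tnorm g p (tchange (ch q) (ch p) p u).
Proof. by move=> qp; rewrite /gnorm cmapK. Qed.

Lemma inner_sum (h : M -> 'M[R]_n) p n1 n2 (a : 'I_n1 -> R) (b : 'I_n2 -> R)
    (u : 'I_n1 -> 'rV[R]_n) (v : 'I_n2 -> 'rV[R]_n) :
  inner h p (\sum_i a i *: u i) (\sum_j b j *: v j) =
  \sum_i \sum_j a i * b j * inner h p (u i) (v j).
Proof.
rewrite /inner mulmx_suml linear_sum /= mulmx_suml summxE; apply: eq_bigr => i _.
rewrite mulmx_sumr summxE; apply: eq_bigr => j _.
by rewrite linearZ /= -!scalemxAl -scalemxAr !mxE mulrA.
Qed.

(** The matrix [g p] refers to a chart that may jump with [p]. Continuity is available for the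
    coefficients [G i j] of the metric in the fixed chart at [q], in which the squared norm is a
    quadratic form. *)
Lemma gnorm_cvg (T : Type) (F : set_system T) (FF : Filter F) q x u
    (f : T -> 'rV[R]_n) (w : T -> 'rV[R]_n) :
  ccod (ch q) x -> f @ F --> x -> (\forall s \near F, ccod (ch q) (f s)) ->
  w @ F --> u -> gnorm q (f s) (w s) @[s --> F] --> gnorm q x u.
Proof.
move=> qx fx qf wu.
apply: continuous_cvg; first exact: sqrt_continuous.
pose G i j y := let p := cinv (ch q) y in
         inner g p (tchange (ch q) (ch p) p (delta_mx 0 i))
                        (tchange (ch q) (ch p) p (delta_mx 0 j)).
have inE y v : ccod (ch q) y -> inner g (cinv (ch q) y)
    (tchange (ch q) (ch (cinv (ch q) y)) (cinv (ch q) y) v)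
    (tchange (ch q) (ch (cinv (ch q) y)) (cinv (ch q) y) v) =
    \sum_i \sum_j v 0 i * v 0 j * G i j y.
  move=> qy; rewrite tchange_sum ?inner_sum//; first exact: cinv_dom.
  exact: chart_at_dom.
rewrite inE//.
have : \sum_i \sum_j w s 0 i * w s 0 j * G i j (f s) @[s --> F] --> \sum_i \sum_j u 0 i * u 0 j * G i j x.
  apply: (@cvg_sumr _ _ R^o) => i; apply: (@cvg_sumr _ _ R^o) => j.
  have cw k : w s 0 k @[s --> F] --> u 0 k.
    by exact: (@cvg_comp _ _ _ w (fun v => v 0 k) _ _ _ wu (@coord_continuous _ _ _ 0 k u)).
  apply: cvgM; first exact: cvgM.
  have Gx := Ck_at_cvg qx (@metric_smooth _ _ _ _ g 0%N q x i j qx).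
  apply: cvg_comp Gx.
  move=> O; rewrite /within/= => HO.
  have := fx _ HO; rewrite /= near_simpl => H.
  by apply: filterS2 qf H => s qs; apply.
apply: cvg_trans; apply: near_eq_cvg.
by apply: filterS qf => s qs; rewrite inE.
Qed.

End Charts.

(** * Lebesgue integrals *)

Section Integrals.
Context {R : realType}.
Local Notation mu := (@lebesgue_measure R).
Implicit Types (D N : set R).

(** Lebesgue measure is determined by its values on half-open intervals, where the factor [k] undoes
    the rescaling of lengths under the preimage. *)
Lemma lebesgue_measure_affine (k c : R) (k0 : 0 < k) (B : set R) : measurable B ->
  mu B = (k%:E * pushforward mu ((fun t => k * t + c)%R : _ -> measurableTypeR R) B)%E.
Proof.
have mphi : measurable_fun setT ((fun t => k * t + c) : measurableTypeR R -> measurableTypeR R).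
  by apply: continuous_measurable_fun => t; apply: cvgD; [apply: cvgM; [exact: cvg_cst|exact: cvg_id]|exact: cvg_cst].
pose phi : {mfun measurableTypeR R >-> measurableTypeR R} :=
  HB.pack (fun t => k * t + c) (isMeasurableFun.Build _ _ _ _ _ mphi).
move=> mB.
apply: (@lebesgue_measure_unique R (mscale (NngNum (ltW k0)) (pushforward mu phi))) => //.
move=> _ [[a b]] _ <-.
have E : (fun t => k * t + c) @^-1` `]a, b]%classic = `](a - c) / k, (b - c) / k]%classic.
  apply/seteqP; split => t /=; rewrite !in_itv/= => /andP[h1 h2]; apply/andP; split.
  - by rewrite ltr_pdivrMr// mulrC ltrBlDr.
  - by rewrite ler_pdivlMr// mulrC lerBrDr.
  - by move: h1; rewrite ltr_pdivrMr// mulrC ltrBlDr.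
  - by move: h2; rewrite ler_pdivlMr// mulrC lerBrDr.
pose J := `](a - c) / k, (b - c) / k]%classic.
transitivity (k%:E * mu J)%E; last by rewrite /J -E.
rewrite /J !lebesgue_measure_itv/= !lte_fin ltr_pM2r ?invr_gt0// ltrD2r.
case: ifPn => _; last by rewrite mule0.
by rewrite -!EFinD -EFinM; congr (_%:E); field; rewrite gt_eqF.
Qed.

Lemma ge0_integral_affine (k c : R) D (f : R -> \bar R) : 0 < k -> measurable D ->
  measurable_fun D f -> (forall t, D t -> 0 <= f t)%E ->
  (\int[mu]_(t in (fun t => k * t + c)%R @^-1` D) (k%:E * f (k * t + c)%R) = \int[mu]_(t in D) f t)%E.
Proof.
move=> k0 mD mf f0.
have mphi : measurable_fun setT ((fun t => k * t + c) : measurableTypeR R -> measurableTypeR R).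
  by apply: continuous_measurable_fun => t; apply: cvgD; [apply: cvgM; [exact: cvg_cst|exact: cvg_id]|exact: cvg_cst].
pose phi : {mfun measurableTypeR R >-> measurableTypeR R} :=
  HB.pack (fun t => k * t + c) (isMeasurableFun.Build _ _ _ _ _ mphi).
rewrite [RHS](@eq_measure_integral _ _ _ _ (mscale (NngNum (ltW k0)) (pushforward mu phi)) mu); last first.
  by move=> B mB _; rewrite /mscale/=; exact: lebesgue_measure_affine.
have f0' : {in D, forall y, 0 <= f y}%E by move=> y; rewrite inE; exact: f0.
rewrite ge0_integral_mscale//=.
transitivity (k%:E * \int[mu]_(t in phi @^-1` D) (f \o phi) t)%E; last first.
  by have <- := ge0_integral_pushforward mphi mu mD mf f0'.
have mpre : measurable ((fun t => k * t + c)%R @^-1` D).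
  by have := mphi measurableT D mD; rewrite setTI.
rewrite /= ge0_integralZl_EFin//.
- by move=> x /f0.
- apply: (measurable_comp mD) => //; first by move=> _ [t] /= ? <-.
  exact: measurable_funTS.
- exact: ltW.
Qed.

Lemma finite_lebesgue0 N : finite_set N -> measurable N /\ mu N = 0%E.
Proof.
move=> fN; split; first by apply: countable_measurable => //; exact: finite_set_countable.
exact: countable_lebesgue_measure0 (finite_set_countable fN).
Qed.

Lemma measurable_piecewise D N (f : R -> R) : measurable D -> finite_set N ->
  (forall t, D t -> ~ N t -> {for t, continuous f}) ->
  measurable_fun D (EFin \o f).
Proof.
move=> mD fN cf; apply/measurable_EFinP.
have -> : D = (D `\` N) `|` (D `&` N) by rewrite setUC setUIDK.
have [mN _] := finite_lebesgue0 fN.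
apply/measurable_funU; [exact: measurableD|exact: measurableI|split].
  apply: subspace_continuous_measurable_fun; first exact: measurableD.
  apply/subspace_continuousP => t [Dt Nt].
  by apply: cvg_trans (cf t Dt Nt); apply: cvg_app; exact: cvg_within.
move=> _ B mB.
apply: countable_measurable => //; apply: finite_set_countable.
by apply: sub_finite_set fN => t [[]].
Qed.

Lemma ge0_eq_integral_finite D N (f g : R -> \bar R) : measurable D -> finite_set N ->
  measurable_fun D f -> measurable_fun D g ->
  (forall t, D t -> 0 <= f t)%E -> (forall t, D t -> 0 <= g t)%E ->
  (forall t, D t -> ~ N t -> f t = g t) ->
  (\int[mu]_(t in D) f t = \int[mu]_(t in D) g t)%E.
Proof.
move=> mD fN mf mg f0 g0 fg; have [mN N0] := finite_lebesgue0 fN.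
rewrite (@ge0_negligible_integral _ _ _ mu D N f mN mD mf f0 N0).
rewrite (@ge0_negligible_integral _ _ _ mu D N g mN mD mg g0 N0).
by apply: eq_integral => t /[!inE] -[Dt Nt]; exact: fg.
Qed.

(* Unlike [ge0_le_integral], this needs no measurability: the integral is a
   supremum over simple functions. *)
Lemma le_integral_nonmeasurable D (f g : R -> \bar R) :
  (forall t, D t -> 0 <= f t)%E -> (forall t, D t -> f t <= g t)%E ->
  (\int[mu]_(t in D) f t <= \int[mu]_(t in D) g t)%E.
Proof.
move=> f0 fg.
have g0 t : D t -> (0 <= g t)%E by move=> Dt; exact: le_trans (f0 _ Dt) (fg _ Dt).
rewrite !ge0_integralE//; apply: le_ereal_sup => _ [h /= hf <-].
exists h => //= t; apply: (le_trans (hf t)); rewrite /patch.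
by case: ifPn => // /[!inE] Dt; exact: fg.
Qed.

Lemma integral_le_cst D (f : R -> \bar R) (K : R) : measurable D ->
  (forall t, D t -> 0 <= f t)%E -> (forall t, D t -> f t <= K%:E)%E ->
  (\int[mu]_(t in D) f t <= K%:E * mu D)%E.
Proof.
by move=> mD f0 fK; rewrite -integral_cst//; exact: le_integral_nonmeasurable.
Qed.

Lemma integral_ge_cst D E (f : R -> \bar R) (K : R) :
  measurable D -> measurable E -> E `<=` D -> 0 <= K ->
  (forall t, D t -> 0 <= f t)%E -> (forall t, E t -> K%:E <= f t)%E ->
  (K%:E * mu E <= \int[mu]_(t in D) f t)%E.
Proof.
move=> mD mE ED K0 f0 fK.
rewrite -integral_cst// integral_mkcond [leRHS]integral_mkcond.
apply: le_integral_nonmeasurable => t _; rewrite /patch.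
  by case: ifPn => // _; rewrite lee_fin.
case: ifPn => [/[!inE] Et|_].
  by rewrite mem_set; [exact: fK|exact: ED].
by case: ifPn => // /[!inE] /f0.
Qed.

End Integrals.

(** * The triangle inequality for the Riemannian distance *)

Section RDist.
Context {R : realType} {n : nat} {M : topologicalType} {A : manifold R n M}.
Variable g : riemannian A.
Local Notation ch := (chart_at A).
Local Notation mu := (@lebesgue_measure R).
Implicit Types (p q r z : M) (x u v w : 'rV[R]_n).

Lemma tnorm_scale p (k : R) v : 0 <= k -> tnorm g p (k *: v) = k * tnorm g p v.
Proof.
move=> k0; rewrite /tnorm /inner -scalemxAl -scalemxAl linearZ/= -scalemxAr.
by rewrite !mxE mulrA -expr2 sqrtrM ?sqr_ge0// sqrtr_sqr ger0_norm.
Qed.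

Lemma tnorm_opp p v : tnorm g p (- v) = tnorm g p v.
Proof. by rewrite /tnorm /inner !linearN/= !mulNmx opprK. Qed.

Lemma tnorm0 p : tnorm g p 0 = 0.
Proof. by rewrite -(scale0r 0) tnorm_scale// mul0r. Qed.

Lemma gnorm_scale q x (k : R) v : ccod (ch q) x -> 0 <= k ->
  gnorm g q x (k *: v) = k * gnorm g q x v.
Proof.
move=> qx k0; rewrite /gnorm -tnorm_scale//; congr tnorm.
have [f [_ _ ->]] := tchangeP (cinv_dom qx) (chart_at_dom A (cinv (ch q) x)).
exact: linearZ.
Qed.

Lemma gnorm_opp q x v : ccod (ch q) x -> gnorm g q x (- v) = gnorm g q x v.
Proof.
move=> qx; rewrite /gnorm -[RHS]tnorm_opp; congr tnorm.
have [f [_ _ ->]] := tchangeP (cinv_dom qx) (chart_at_dom A (cinv (ch q) x)).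
by rewrite linearN.
Qed.

(* [R] and [R^o] carry convertible but distinct normed module structures. *)
Lemma derivableRo (W : normedModType R) (f : R -> W) (s : R) :
  derivable f s 1 <-> derivable (f : R^o -> W) s 1.
Proof. by []. Qed.

Definition speed (gamma : R -> M) (t : R) := tnorm g (gamma t) (velocity A gamma t).

Lemma speed_ge0 gamma t : 0 <= speed gamma t.
Proof. exact: sqrtr_ge0. Qed.

(** A two-sided form of [C1_arc], for interior times. Continuity of [gamma] is recorded separately
    because [cmap] is arbitrary outside the chart domain. *)
Definition C1_point (gamma : R -> M) (t : R) :=
  (\forall s \near t, {for s, continuous gamma}) /\
  exists f : R -> 'rV[R]_n,
    [/\ \forall s \near t, derivable f s 1,
        \forall s \near t, {for s, continuous (derive1 f)} &
        \forall s \near t, f s = cmap (ch (gamma t)) (gamma s)].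

Lemma velocityE gamma t q v :
  {for t, continuous gamma} -> cdom (ch q) (gamma t) ->
  is_derive (t : R^o) (1 : R^o) (cmap (ch q) \o gamma) v ->
  velocity A gamma t = tchange (ch q) (ch (gamma t)) (gamma t) v.
Proof.
move=> ct qt dv; rewrite /velocity derive1E.
by have [_ ->] := is_derive_change (near_cdom ct qt) (chart_at_dom A (gamma t)) dv.
Qed.

Lemma C1_point_derive gamma t : C1_point gamma t ->
  is_derive (t : R^o) (1 : R^o) (cmap (ch (gamma t)) \o gamma) (velocity A gamma t).
Proof.
move=> [ct [f [df _ fE]]].
apply: DeriveDef; last by rewrite /velocity derive1E.
apply: (@near_eq_derivable _ R^o _ f) => //.
by apply/derivableRo; exact: nbhs_singleton df.
Qed.

(** [velocity] at [s] is expressed in the chart at [gamma s], which varies with [s]. In the chart at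
    [gamma t] the speed near [t] becomes [gnorm] of [f] and its derivative, which is continuous. *)
Lemma C1_point_speed gamma t : C1_point gamma t -> {for t, continuous (speed gamma)}.
Proof.
move=> [ct [f [df cdf fE]]].
set q := gamma t.
have qt : cdom (ch q) (gamma t) by exact: chart_at_dom.
have qn := near_cdom (nbhs_singleton ct) qt.
have E : \forall s \near t, gnorm g q (f s) (derive1 f s) = speed gamma s.
  have fEE : \forall s \near t, \forall s' \near s, f s' = cmap (ch q) (gamma s').
    exact: near_join.
  have cq : \forall s \near t, {for s, continuous gamma} /\ cdom (ch q) (gamma s).
    exact: filterI.
  apply: filterS3 fEE cq df => s fs [cs qs] /derivableRo ds.
  have dv : is_derive (s : R^o) (1 : R^o) (cmap (ch q) \o gamma) (derive1 f s).
    apply: (@near_eq_is_derive _ R^o _ f) => //.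
    by rewrite derive1E; exact: derivableP.
  rewrite /speed (velocityE cs qs dv) (nbhs_singleton fs).
  exact: gnorm_cmap.
have Et : speed gamma t = gnorm g q (f t) (derive1 f t) by rewrite (nbhs_singleton E).
rewrite /prop_for /continuous_at Et.
have cf : f @ t --> f t.
  apply: (@differentiable_continuous _ R^o _ t f).
  apply/derivable1_diffP/derivableRo; exact: nbhs_singleton df.
have cdft : derive1 f @ t --> derive1 f t by exact: nbhs_singleton cdf.
have ftE := nbhs_singleton fE.
have cc : ccod (ch q) (f t) by rewrite ftE; exact: cmap_cod.
have nc : \forall s \near t, ccod (ch q) (f s).
  by apply: filterS2 fE qn => s -> /cmap_cod.
have H := gnorm_cvg (g := g) _ cc cf nc cdft.
apply: cvg_trans (H _); apply: near_eq_cvg; exact: E.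
Qed.

Lemma within_itv_continuous (gamma : R -> M) (a b t : R) :
  {within `[a, b], continuous gamma} -> a < t < b -> {for t, continuous gamma}.
Proof.
move=> /subspace_continuousP H tab.
have tI : (`[a, b]%classic)° t.
  rewrite /interior; have : nbhs t `]a, b[%classic.
    by apply: open_nbhs_nbhs; split; [exact: interval_open|rewrite /= in_itv].
  by apply: filterS => s /=; rewrite !in_itv/= => /andP[/ltW -> /ltW ->].
have := H t (interior_subset tI).
by rewrite (within_interior tI).
Qed.

Lemma C1_arc_point gamma (a b t : R) : {within `[a, b], continuous gamma} ->
  a < t < b -> C1_arc A a b gamma -> C1_point gamma t.
Proof.
move=> cg tab arc; have [f [df cdf fE]] := arc t (ltac:(lra)).
have nI : \forall s \near t, a < s < b.
  have : nbhs t `]a, b[%classic.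
    by apply: open_nbhs_nbhs; split; [exact: interval_open|rewrite /= in_itv].
  by apply: filterS => s /=; rewrite in_itv.
split; first by apply: filterS nI => s; exact: within_itv_continuous.
exists f; split; [exact: df|exact: cdf|].
by apply: filterS2 fE nI => s H /andP[/ltW as_ /ltW sb]; apply: H; rewrite as_.
Qed.

Lemma finite_gap (S : set R) (a b t : R) : finite_set S -> a < t < b -> ~ S t ->
  exists c d, [/\ a <= c, c < t, t < d, d <= b & S `&` `]c, d[ = set0].
Proof.
move=> fS /andP[at_ tb] St.
have : nbhs t (~` S `&` `]a, b[%classic).
  apply: filterI.
    apply: open_nbhs_nbhs; split => //; apply: closed_openC.
    by apply: accessible_finite_set_closed.1 => //; exact/hausdorff_accessible/Rhausdorff.
  by apply: open_nbhs_nbhs; split; [exact: interval_open|rewrite /= in_itv/= at_].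
move=> /nbhs_ballP[d /= d0 Hd].
exists (Num.max a (t - d)), (Num.min b (t + d)); split.
- by rewrite le_max lexx.
- by rewrite gt_max at_ ltrBlDr ltrDl.
- by rewrite lt_min tb ltrDl.
- by rewrite ge_min lexx.
apply/seteqP; split => // s [Ss]; rewrite /= in_itv/= gt_max lt_min.
move=> /andP[/andP[_ h1] /andP[_ h2]].
have [|+ _] := Hd s; last by [].
by rewrite -ball_normE/= ltr_norml; apply/andP; split; lra.
Qed.

(** The end points join the exceptional set because [C1_point] looks at both sides of a time. *)
Lemma piecewise_C1_points gamma : piecewise_C1 A gamma ->
  exists2 N, finite_set N & forall t, 0 <= t <= 1 -> ~ N t -> 0 < t < 1 /\ C1_point gamma t.
Proof.
move=> [cg [S fS arc]].
exists (S `|` [set 0; 1]); first by rewrite finite_setU; split => //; exact: finite_set2.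
move=> t t01 /not_orP[St /not_orP[/eqP t0 /eqP t1]].
have {}t01 : 0 < t < 1 by rewrite !lt_neqAle eq_sym t0 t1.
split => //.
have [c [d [c0 ct td d1 Scd]]] := finite_gap fS t01 St.
apply: (@C1_arc_point _ c d); last by apply: arc => //; lra.
- apply: continuous_subspaceW cg => s /=; rewrite !in_itv/= => /andP[h1 h2].
  by rewrite (le_trans c0 h1) (le_trans h2 d1).
- by rewrite ct td.
Qed.

Lemma measurable_speed gamma : piecewise_C1 A gamma ->
  measurable_fun (`[0, 1]%classic : set R) (EFin \o speed gamma).
Proof.
move=> /piecewise_C1_points[N fN H]; apply: (measurable_piecewise _ fN) => //.
move=> t /=; rewrite in_itv/= => t01 Nt.
by apply: C1_point_speed; exact: (H t t01 Nt).2.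
Qed.

Lemma arc_length_ge0 gamma : (0 <= arc_length g gamma)%E.
Proof. by apply: integral_ge0 => t _; rewrite lee_fin sqrtr_ge0. Qed.

Lemma rdist_ge0 p q : (0 <= rdist g p q)%E.
Proof. by apply: le_ereal_inf_tmp => _ [gamma _ <-]; exact: arc_length_ge0. Qed.

Lemma rdist_arc gamma p q : piecewise_C1 A gamma -> gamma 0 = p -> gamma 1 = q ->
  (rdist g p q <= arc_length g gamma)%E.
Proof. by move=> pg g0 g1; apply: ereal_inf_lbound; exists gamma. Qed.

(** The velocity at 0 and 1 depends on [gamma] outside the unit interval, so only interior speeds
    can be bounded; the end points are a null set. *)
Lemma arc_length_le gamma (K : R) : piecewise_C1 A gamma ->
  (forall t, 0 < t < 1 -> speed gamma t <= K) -> (arc_length g gamma <= K%:E)%E.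
Proof.
move=> pg sK; rewrite /arc_length.
have mS : measurable_fun (`]0, 1[%classic : set R) (EFin \o speed gamma).
  apply: measurable_funS (measurable_speed pg) => //.
  by move=> s /=; rewrite !in_itv/= => /andP[/ltW -> /ltW ->].
rewrite integral_itv_bndoo//.
apply: (@le_trans _ _ (K%:E * mu `]0%R, 1%R[%classic)%E).
  apply: integral_le_cst; first exact: measurable_itv.
    by move=> t _; rewrite lee_fin; exact: speed_ge0.
  by move=> t /=; rewrite in_itv/= lee_fin; exact: sK.
by rewrite lebesgue_measure_itv/= lte_fin ltr01 oppr0 adde0 mule1.
Qed.

Lemma near_affine (k c t : R) (P : R -> Prop) :
  (\forall s \near (k * t + c), P s) -> \forall s \near t, P (k * s + c).
Proof.
move=> HP.
have cv : (k * s + c) @[s --> t] --> k * t + c.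
  by apply: cvgD; [apply: cvgM; [exact: cvg_cst|exact: cvg_id]|exact: cvg_cst].
exact: cv HP.
Qed.

Lemma C1_arc_affine gamma gamma0 (k c a b : R) : 0 < k ->
  (forall s, a <= s <= b -> gamma s = gamma0 (k * s + c)) ->
  C1_arc A (k * a + c) (k * b + c) gamma0 -> C1_arc A a b gamma.
Proof.
move=> k0 gE arc t /andP[ta tb].
have [|f [df cdf fE]] := arc (k * t + c).
  by rewrite !lerD2r !ler_pM2l// ta.
exists (fun s => f (k * s + c)).
have df' s : derivable f (k * s + c) 1 ->
    is_derive (s : R^o) (1 : R^o) (fun s => f (k * s + c)) (k *: derive1 f (k * s + c)).
  by move=> /derivableRo d; apply: is_derive_affine; rewrite derive1E; exact: derivableP.
have df1 := near_affine df.
split.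
- by apply: filterS df1 => s /df' [/derivableRo].
- have df2 : \forall s \near t, \forall s' \near s, derivable f (k * s' + c) 1.
    exact: near_join.
  apply: filterS2 df2 (near_affine cdf) => s ds cs.
  have E : \forall s' \near s, k *: derive1 f (k * s' + c) = derive1 (fun s => f (k * s + c)) s'.
    by apply: filterS ds => s' /df' [_ <-]; rewrite derive1E.
  rewrite /prop_for /continuous_at -(nbhs_singleton E).
  apply: cvg_trans; first by apply: near_eq_cvg; exact: E.
  apply: cvgZl_tmp.
  apply: (@cvg_comp _ _ _ (fun s => k * s + c) (derive1 f) _ _ _ _ cs).
  by apply: cvgD; [apply: cvgM; [exact: cvg_cst|exact: cvg_id]|exact: cvg_cst].
- apply: filterS (near_affine fE) => s H /andP[as_ sb].
  rewrite H ?gE ?ta ?as_//.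
  by rewrite !lerD2r !ler_pM2l// as_.
Qed.

Lemma speed_affine gamma gamma0 (k c t : R) : 0 < k ->
  (\forall s \near t, gamma s = gamma0 (k * s + c)) ->
  C1_point gamma0 (k * t + c) -> speed gamma t = k * speed gamma0 (k * t + c).
Proof.
move=> k0 gE /C1_point_derive dv.
have gt := nbhs_singleton gE.
rewrite /speed -tnorm_scale ?ltW// gt; congr tnorm.
rewrite {1}/velocity derive1E gt.
have H : is_derive (t : R^o) (1 : R^o) (cmap (ch (gamma0 (k * t + c))) \o gamma)
    (k *: velocity A gamma0 (k * t + c)).
  apply: (@near_eq_is_derive _ R^o _ (fun s => cmap (ch (gamma0 (k * t + c))) (gamma0 (k * s + c)))).
    by apply: filterS gE => s /= ->.
  exact: is_derive_affine dv.
by have [_ <-] := H.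
Qed.

(* The trivial [+ 0] makes both halves instances of [k * t + c]. *)
Definition gcat (gamma1 gamma2 : R -> M) (t : R) : M :=
  if t <= 2^-1 then gamma1 (2 * t + 0) else gamma2 (2 * t + -1).

Section Cat.
Variables gamma1 gamma2 : R -> M.
Hypotheses (P1 : piecewise_C1 A gamma1) (P2 : piecewise_C1 A gamma2).
Hypothesis g12 : gamma1 1 = gamma2 0.
Local Notation gamma := (gcat gamma1 gamma2).

Let gammaL s : s <= 2^-1 -> gamma s = gamma1 (2 * s + 0).
Proof. by rewrite /gcat => ->. Qed.

Let gammaR s : 2^-1 <= s -> gamma s = gamma2 (2 * s + -1).
Proof.
rewrite /gcat le_eqVlt => /predU1P[<-|]; last by rewrite ltNge => /negbTE ->.
by rewrite lexx addr0 divff ?pnatr_eq0// subrr.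
Qed.

Lemma gcat_continuous : {within `[0, 1], continuous gamma}.
Proof.
have cL : {within `[0, 2^-1], continuous gamma}.
  apply/subspace_continuousP => s /=; rewrite in_itv/= => /andP[s0 s1] O HO0.
  have HO : nbhs (gamma1 (2 * s + 0)) O by rewrite -(gammaL s1).
  have /subspace_continuousP/(_ (2 * s + 0)) := P1.1.
  move=> /(_ _ _ HO); rewrite /= in_itv/= => /(_ (ltac:(lra))).
  move=> /near_affine; apply: filterS => u H; rewrite /= in_itv/= => u01.
  suff : O (gamma u) by [].
  rewrite gammaL; last by lra.
  by apply: H; rewrite /= in_itv/=; lra.
have cR : {within `[2^-1, 1], continuous gamma}.
  apply/subspace_continuousP => s /=; rewrite in_itv/= => /andP[s0 s1] O HO0.
  have HO : nbhs (gamma2 (2 * s + -1)) O by rewrite -(gammaR s0).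
  have /subspace_continuousP/(_ (2 * s + -1)) := P2.1.
  move=> /(_ _ _ HO); rewrite /= in_itv/= => /(_ (ltac:(lra))).
  move=> /near_affine; apply: filterS => u H; rewrite /= in_itv/= => u01.
  suff : O (gamma u) by [].
  rewrite gammaR; last by lra.
  by apply: H; rewrite /= in_itv/=; lra.
have -> : `[0, 1]%classic = `[0, 2^-1]%classic `|` `[2^-1, 1]%classic :> set R.
  apply/seteqP; split => s /=; rewrite !in_itv/=.
    by move=> /andP[s0 s1]; case: (leP s 2^-1) => h; [left|right]; lra.
  by case=> /andP[s0 s1]; lra.
by apply: withinU_continuous => //; exact: interval_closed.
Qed.

Lemma gcat_piecewise_C1 : piecewise_C1 A gamma.
Proof.
split; first exact: gcat_continuous.
have [_ [S1 fS1 arc1]] := P1; have [_ [S2 fS2 arc2]] := P2.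
exists ([set 2^-1] `|` ((fun s => 2^-1 * s) @` S1 `|` (fun s => 2^-1 * (s + 1)) @` S2)).
  rewrite !finite_setU; split; first exact: finite_set1.
  by split; exact: finite_image.
move=> a b a0 ab b1 NI.
have N2 : ~ (a < 2^-1 < b).
  move=> h; have : set0 (2^-1 : R) by rewrite -NI; split; [left|rewrite /= in_itv].
  by [].
have [b2|b2] := leP b 2^-1.
  apply: (@C1_arc_affine _ gamma1 2 0) => //.
    by move=> s /andP[_ sb]; rewrite gammaL//; lra.
  apply: arc1; [lra|lra|lra|].
  apply/seteqP; split => // s [S1s]; rewrite /= in_itv/= => h.
  have : set0 (2^-1 * s) by rewrite -NI; split; [right; left; exists s|rewrite /= in_itv/=; lra].
  by [].
have a2 : 2^-1 <= a by rewrite leNgt; apply/negP => h; apply: N2; rewrite h b2.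
apply: (@C1_arc_affine _ gamma2 2 (-1)) => //.
  by move=> s /andP[sa _]; rewrite gammaR//; lra.
apply: arc2; [lra|lra|lra|].
apply/seteqP; split => // s [S2s]; rewrite /= in_itv/= => h.
have : set0 (2^-1 * (s + 1)) by rewrite -NI; split; [right; right; exists s|rewrite /= in_itv/=; lra].
by [].
Qed.

Lemma gcat_length : (arc_length g gamma <= arc_length g gamma1 + arc_length g gamma2)%E.
Proof.
have mg := measurable_speed gcat_piecewise_C1.
have sp0 ga t : (0 <= (EFin \o speed ga) t)%E by rewrite lee_fin; exact: speed_ge0.
(* Treats both halves at once: up to finitely many times the speed of [gamma] is [k] times that of
   [ga], and the change of variables absorbs the factor. [D] is kept general so that one half can
   omit its initial time and the halves are disjoint. *)
have key ga (k c : R) (D : set R) : 0 < k -> measurable D -> D `<=` `[0, 1]%classic ->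
    (fun t => k * t + c) @^-1` D `<=` `[0, 1]%classic ->
    piecewise_C1 A ga ->
    (forall s, 0 < k * s + c < 1 -> gamma s = ga (k * s + c)) ->
    (\int[mu]_(t in (fun t => k * t + c)%R @^-1` D) (speed gamma t)%:E <= arc_length g ga)%E.
  move=> k0 mD D01 pD01 pg gE.
  have mpre : measurable ((fun t => k * t + c) @^-1` D).
    rewrite -[X in measurable X]setTI.
    have : measurable_fun setT ((fun t => k * t + c) : R -> R).
      by apply: continuous_measurable_fun => t; apply: cvgD; [apply: cvgM; [exact: cvg_cst|exact: cvg_id]|exact: cvg_cst].
    by apply.
  have mga : measurable_fun D (EFin \o speed ga) by exact: measurable_funS (measurable_speed pg).
  apply: (@le_trans _ _ (\int[mu]_(t in D) (speed ga t)%:E)%E); last first.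
    have m01 : measurable (`[0, 1]%classic : set R) by exact: measurable_itv.
    exact: (@ge0_subset_integral _ _ _ mu D _ mD m01 (EFin \o speed ga) (measurable_speed pg) (fun t _ => sp0 ga t) D01).
  have [N fN HN] := piecewise_C1_points pg.
  have H1 : measurable_fun ((fun t => k * t + c) @^-1` D) (EFin \o speed gamma).
    exact: measurable_funS mg.
  have H2 : measurable_fun ((fun t => k * t + c) @^-1` D) (fun t => k%:E * (EFin \o speed ga) (k * t + c)%R)%E.
    apply: measurable_funeM; apply: (measurable_comp mD) => //; first by move=> _ [t] /= ? <-.
    apply: measurable_funTS; apply: continuous_measurable_fun => t.
    by apply: cvgD; [apply: cvgM; [exact: cvg_cst|exact: cvg_id]|exact: cvg_cst].
  have H3 t : (0 <= k%:E * (EFin \o speed ga) (k * t + c)%R)%E.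
    by rewrite mule_ge0// lee_fin ltW.
  rewrite -(@ge0_integral_affine _ k c D _ k0 mD mga)//.
  rewrite le_eqVlt; apply/orP; left; apply/eqP.
  have fN' : finite_set ((fun s => k^-1 * (s - c)) @` N) by exact: finite_image.
  apply: (@ge0_eq_integral_finite R _ _ _ _ mpre fN' H1 H2 (fun t _ => sp0 gamma t) (fun t _ => H3 t)).
  - move=> t Dt Nt /=.
    have [||t01 pt] := HN (k * t + c).
    + by have := D01 _ Dt; rewrite /= in_itv.
    + by move=> Nkt; apply: Nt; exists (k * t + c) => //; rewrite addrK mulKf// gt_eqF.
    rewrite -EFinM; congr EFin; apply: speed_affine => //.
    have : \forall u \near k * t + c, 0 < u < 1.
      have : nbhs (k * t + c) `]0, 1[%classic.
        by apply: open_nbhs_nbhs; split; [exact: interval_open|rewrite /= in_itv].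
      by apply: filterS => s /=; rewrite in_itv.
    by move=> /near_affine; apply: filterS => s; exact: gE.
have I01 : `[0, 1]%classic = ((fun t => 2 * t + 0)%R @^-1` `[0, 1]%classic) `|`
    ((fun t => 2 * t + -1)%R @^-1` `]0, 1]%classic) :> set R.
  apply/seteqP; split => s /=; rewrite !in_itv/=.
    by move=> /andP[s0 s1]; case: (leP s 2^-1) => h; [left|right]; lra.
  by case=> /andP[s0 s1]; lra.
rewrite {1}/arc_length {1}I01 ge0_integral_setU.
- apply: leeD.
  + apply: key => //.
      by rewrite {2}I01; exact: subsetUl.
    by move=> s s01; apply: gammaL; lra.
  + apply: key => //.
    * by move=> s /=; rewrite !in_itv/= => /andP[/ltW -> ->].
    * by rewrite {1}I01; exact: subsetUr.
    * by move=> s s01; apply: gammaR; lra.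
- rewrite (_ : _ @^-1` _ = `[0, 2^-1]%classic)//.
  by apply/seteqP; split => s /=; rewrite !in_itv/=; lra.
- rewrite (_ : _ @^-1` _ = `]2^-1, 1]%classic)//.
  by apply/seteqP; split => s /=; rewrite !in_itv/=; lra.
- by rewrite -I01.
- by move=> t _; exact: sp0.
- apply/disj_setPS => s /= []; rewrite !in_itv/=; lra.
Qed.

End Cat.

Lemma rdist_triangle p q r : (rdist g p r <= rdist g p q + rdist g q r)%E.
Proof.
have key gamma1 gamma2 : piecewise_C1 A gamma1 -> piecewise_C1 A gamma2 ->
    gamma1 0 = p -> gamma1 1 = q -> gamma2 0 = q -> gamma2 1 = r ->
    (rdist g p r <= arc_length g gamma1 + arc_length g gamma2)%E.
  move=> C1 C2 h1 h2 h3 h4.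
  have g12 : gamma1 1 = gamma2 0 by rewrite h2.
  apply: le_trans (gcat_length C1 C2 g12); apply: rdist_arc.
  - exact: gcat_piecewise_C1.
  - by rewrite /gcat invr_ge0 ler0n mulr0 addr0.
  - rewrite /gcat ifF; last by apply/negbTE; rewrite -ltNge; lra.
    by rewrite mulr1 (_ : 2 + -1 = 1)//; lra.
have [->|pq] := eqVneq (rdist g p q) +oo%E; first by rewrite addye ?leey// gt_eqF// (lt_le_trans _ (rdist_ge0 _ _)).
have [->|qr] := eqVneq (rdist g q r) +oo%E; first by rewrite addey ?leey// gt_eqF// (lt_le_trans _ (rdist_ge0 _ _)).
have fpq : rdist g p q \is a fin_num by rewrite ge0_fin_numE ?rdist_ge0// ltey.
have fqr : rdist g q r \is a fin_num by rewrite ge0_fin_numE ?rdist_ge0// ltey.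
apply/lee_addgt0Pr => e e0.
have e2 : 0 < e / 2 by rewrite divr_gt0.
have [_ [ga [pa a0 a1] <-] La] := lb_ereal_inf_adherent e2 fpq.
have [_ [gb [pb b0 b1] <-] Lb] := lb_ereal_inf_adherent e2 fqr.
apply: (le_trans (key _ _ pa pb a0 a1 b0 b1)).
apply: (le_trans (ltW (lteD La Lb))).
by rewrite addeACA -EFinD -splitr.
Qed.

End RDist.

(** * Riemannian distance along curves *)

Section Lines.
Context {R : realType} {n : nat} {M : topologicalType} {A : manifold R n M}.
Variable g : riemannian A.
Local Notation ch := (chart_at A).
Implicit Types (p q r z : M) (x u v w : 'rV[R]_n).

Lemma gnorm_near q x u (K : R) : ccod (ch q) x -> gnorm g q x u < K ->
  exists2 d : R, 0 < d & forall y w, ccod (ch q) y -> `|x - y| < d -> `|u - w| < d ->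
    gnorm g q y w < K.
Proof.
move=> qx gK.
have c1 : fst @ filter_prod (within (ccod (ch q)) (nbhs x)) (nbhs u) --> x.
  by apply: cvg_trans cvg_fst _; exact: cvg_within.
have c2 : snd @ filter_prod (within (ccod (ch q)) (nbhs x)) (nbhs u) --> u.
  exact: cvg_snd.
have n1 : \forall y \near filter_prod (within (ccod (ch q)) (nbhs x)) (nbhs u), ccod (ch q) y.1.
  have : within (ccod (ch q)) (nbhs x) (ccod (ch q)) by apply: nearW.
  exact: cvg_fst.
have H : gnorm g q p.1 p.2 @[p --> filter_prod (within (ccod (ch q)) (nbhs x)) (nbhs u)] --> gnorm g q x u.
  exact: gnorm_cvg.
have [[Q1 Q2] /= [HQ1 HQ2] HQ] := cvgr_lt _ H K gK.
have /nbhs_ballP[d1 /= d10 Hd1] := HQ1.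
have /nbhs_ballP[d2 /= d20 Hd2] := HQ2.
exists (Num.min d1 d2); first by rewrite lt_min d10.
move=> y w qy; rewrite !lt_min => /andP[xy _] /andP[_ uw].
apply: (HQ (y, w)); split; first by apply: Hd1 => //; rewrite -ball_normE.
by apply: Hd2; rewrite -ball_normE.
Qed.

(** Balls and the half-space are convex. *)
Lemma model_open_convex (C : set 'rV[R]_n) x : model_open C -> C x ->
  exists2 d : R, 0 < d & forall y, C y -> `|x - y| < d ->
    forall t, 0 <= t <= 1 -> C (t *: (y - x) + x).
Proof.
move=> mC Cx.
have ballc y t d : 0 <= t <= 1 -> `|x - y| < d -> ball x d (t *: (y - x) + x).
  move=> /andP[t0 t1] xy; rewrite -ball_normE /= opprD addrCA subrr addr0 normrN.
  by rewrite normrZ ger0_norm// (le_lt_trans _ xy)// [`|x - y|]distrC ler_piMl.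
case: mC => [Co|[U Uo CE]].
  have /nbhs_ballP[d /= d0 Hd] : nbhs x C by exact: open_nbhs_nbhs.
  by exists d => // y _ xy t t01; apply: Hd; exact: ballc.
have Ux : U x by move: Cx; rewrite CE => -[].
have /nbhs_ballP[d /= d0 Hd] : nbhs x U by exact: open_nbhs_nbhs.
exists d => // y Cy xy t t01; rewrite CE; split; first by apply: Hd; exact: ballc.
move=> i i0; rewrite !mxE.
have xi : 0 <= x 0 i by move: Cx; rewrite CE => -[_]; apply.
have yi : 0 <= y 0 i by move: Cy; rewrite CE => -[_]; apply.
have -> : t * (y 0 i - x 0 i) + x 0 i = t * y 0 i + (1 - t) * x 0 i by ring.
by move: t01 => /andP[t0 t1]; rewrite addr_ge0// mulr_ge0// subr_ge0.
Qed.

(** * Straight segments in a chart *)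

Section Segment.
Variables (q : M) (x y : 'rV[R]_n).
Let l (t : R) : 'rV[R]_n := t *: (y - x) + x.
Hypothesis lq : forall t, 0 <= t <= 1 -> ccod (ch q) (l t).
Let gamma (t : R) : M := cinv (ch q) (l t).

Let l_cvg (t : R) : l s @[s --> t] --> l t.
Proof. by apply: cvgD; [apply: cvgZr_tmp; exact: cvg_id|exact: cvg_cst]. Qed.

Let l_derive (t : R) : is_derive (t : R^o) (1 : R^o) l (y - x).
Proof.
have did : derivable (id : 'rV[R]_n -> 'rV[R]_n) (t *: (y - x) + x) (y - x).
  exact: derivable_id.
have := @is_derive_line R _ _ id x (y - x) t did.
by move=> /is_derive_eq; apply; rewrite derive_id.
Qed.

Lemma segment_piecewise_C1 : piecewise_C1 A gamma.
Proof.
split.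
  apply/subspace_continuousP => t /=; rewrite in_itv/= => t01 O HO.
  move: HO; rewrite nbhsE => -[U [Uo Ut] UO].
  have : \forall s \near t, ccod (ch q) (l s) -> U (cinv (ch q) (l s)).
    exact: l_cvg (@cinv_near _ _ _ _ _ _ (lq t01) Uo Ut).
  apply: filterS => s H; rewrite /= in_itv/= => s01; apply: UO; apply: H.
  exact: lq.
exists set0; first exact: finite_set0.
move=> a b a0 ab b1 _ t tab.
have t01 : 0 <= t <= 1 by lra.
(* [C1_arc] asks for the chart at [gamma t], which need not be the chart at [q]: an extension [G] of
   the transition map is composed with the affine segment. *)
have [|V [G [Vo Vx GV Gf]]] := @transition_smooth _ _ _ A q (gamma t) 1 _ (lq t01).
  exact: chart_at_dom.
have nV : \forall s \near t, V (l s) by apply: l_cvg; exact: open_nbhs_nbhs.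
pose D s := \sum_i (y - x) 0 i *: 'D_(delta_mx 0 i) G (l s).
have GD s : V (l s) -> is_derive (s : R^o) (1 : R^o) (G \o l) (D s).
  move=> Vs; have dG := C1_differentiable Vo GV Vs.
  have := is_derive_chain dG (l_derive s) => /is_derive_eq; apply.
  rewrite {1}(row_sum_delta (y - x)) linear_sum; apply: eq_bigr => i _.
  by rewrite linearZ/= -deriveE.
exists (G \o l); split.
- by apply: filterS nV => s /GD[/derivableRo].
- have nV2 : \forall s \near t, \forall s' \near s, V (l s') by exact: near_join.
  apply: filterS nV2 => s Vs.
  have E : \forall s' \near s, D s' = derive1 (G \o l) s'.
    by apply: filterS Vs => s' /GD[_ <-]; rewrite derive1E.
  rewrite /prop_for /continuous_at -(nbhs_singleton E).
  suff H : D s' @[s' --> s] --> D s.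
    by apply: cvg_trans H; apply: near_eq_cvg; exact: E.
  apply: cvg_sumr => i; apply: cvgZl_tmp.
  apply: (@cvg_comp _ _ _ l ('D_(delta_mx 0 i) G) _ _ _ (l_cvg (t := s))).
  have [_ /(_ i) [_ [+ _]]] := GV.
  by apply; exact: nbhs_singleton Vs.
- apply: filterS nV => s Vs sab /=; rewrite Gf//; apply: lq; lra.
Qed.

Lemma rdist_segment (K : R) :
  (forall t, 0 < t < 1 -> gnorm g q (l t) (y - x) <= K) ->
  (rdist g (cinv (ch q) x) (cinv (ch q) y) <= K%:E)%E.
Proof.
move=> HK.
apply: le_trans (rdist_arc g segment_piecewise_C1 _ _) _.
- by rewrite /gamma /l scale0r add0r.
- by rewrite /gamma /l scale1r subrK.
apply: (arc_length_le segment_piecewise_C1) => t t01.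
have ct : {for t, continuous gamma}.
  exact: (within_itv_continuous (segment_piecewise_C1).1 t01).
have qt : cdom (ch q) (gamma t) by apply: cinv_dom; apply: lq; lra.
have dv : is_derive (t : R^o) (1 : R^o) (cmap (ch q) \o gamma) (y - x).
  apply: (@near_eq_is_derive _ R^o _ l); last exact: l_derive.
  have : nbhs t `]0, 1[%classic.
    by apply: open_nbhs_nbhs; split; [exact: interval_open|rewrite /= in_itv].
  apply: filterS => s /=; rewrite in_itv/= => s01.
  by rewrite /gamma cinvK//; apply: lq; lra.
by rewrite /speed (velocityE ct qt dv); exact: HK.
Qed.

End Segment.

Lemma rdist_refl p : rdist g p p = 0%E.
Proof.
apply/eqP; rewrite eq_le rdist_ge0 andbT.
have pp := chart_at_dom A p.
have := @rdist_segment p (cmap (ch p) p) (cmap (ch p) p) _ 0.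
rewrite subrr cmapK//; apply => [t _|t _]; rewrite scaler0 add0r.
  exact: cmap_cod.
by rewrite -(scale0r (0 : 'rV[R]_n)) gnorm_scale ?mul0r//; exact: cmap_cod.
Qed.

(** The chart segment from [p] to [z] has constant velocity [s *: w], and by continuity vectors [w]
    close to [u] have norm below [K] at all points near [p]. The case [u = 0], [s = 1] compares
    [rdist] with the topology; the case of a velocity [u] and an elapsed time [s] bounds the
    distance along a curve. *)
Lemma rdist_cmap p u (K : R) : tnorm g p u < K ->
  exists2 d : R, 0 < d & forall z (s : R), 0 <= s -> cdom (ch p) z ->
    `|cmap (ch p) p - cmap (ch p) z| < d ->
    (exists2 w, `|u - w| < d & cmap (ch p) z - cmap (ch p) p = s *: w) ->
    (rdist g p z <= (K * s)%:E)%E /\ (rdist g z p <= (K * s)%:E)%E.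
Proof.
move=> uK; have pp := chart_at_dom A p; have cp := cmap_cod pp.
have gK : gnorm g p (cmap (ch p) p) u < K by rewrite gnorm_cmap// tchange_id.
have [d1 d10 Hd1] := gnorm_near cp gK.
have [d2 d20 Hd2] := model_open_convex (@ccod_open _ _ _ (ch p)) cp.
exists (Num.min d1 d2); first by rewrite lt_min d10.
move=> z s s0 pz; rewrite lt_min => /andP[xy1 xy2] [w + zw].
rewrite lt_min => /andP[uw _].
set x := cmap (ch p) p in xy1 xy2 zw cp gK Hd1 Hd2 *.
set y := cmap (ch p) z in xy1 xy2 zw *.
have lq t : 0 <= t <= 1 -> ccod (ch p) (t *: (y - x) + x).
  by apply: Hd2 => //; exact: cmap_cod.
have bnd t : 0 <= t <= 1 -> gnorm g p (t *: (y - x) + x) (y - x) <= K * s.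
  move=> t01; rewrite {2}zw gnorm_scale//; last exact: lq.
  rewrite mulrC ler_wpM2r// ltW// Hd1//; first exact: lq.
  move: t01 => /andP[t0 t1].
  rewrite opprD addrA [x - _]addrC -addrA subrr addr0 normrN normrZ ger0_norm//.
  by rewrite (le_lt_trans _ xy1)// distrC ler_piMl.
split.
- have := @rdist_segment p x y lq (K * s).
  by rewrite !cmapK//; apply => t t01; apply: bnd; lra.
- have E t : t *: (x - y) + y = (1 - t) *: (y - x) + x.
    by apply/rowP => i; rewrite !mxE; ring.
  have := @rdist_segment p y x _ (K * s).
  rewrite !cmapK//; apply => [t t01|t t01]; rewrite E; first by apply: lq; lra.
  rewrite -(opprB y x) gnorm_opp; last by apply: lq; lra.
  by apply: bnd; lra.
Qed.

Lemma rdist_near p (e : R) : 0 < e ->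
  \forall z \near p, (rdist g p z <= e%:E)%E /\ (rdist g z p <= e%:E)%E.
Proof.
move=> e0; have pp := chart_at_dom A p.
have [|d d0 Hd] := @rdist_cmap p 0 e; first by rewrite tnorm0.
have np : \forall z \near p, cdom (ch p) z.
  by apply: open_nbhs_nbhs; split => //; exact: cdom_open.
have /cvgrPdist_lt/(_ d d0) nd := cmap_cvg pp.
apply: filterS2 np nd => z pz dz.
have := Hd z 1 ler01 pz dz; rewrite mulr1; apply.
exists (cmap (ch p) z - cmap (ch p) p); last by rewrite scale1r.
by rewrite sub0r normrN distrC.
Qed.

(** The difference quotient at [t] plays the role of [w] in [rdist_cmap]. Elapsed times there are
    nonnegative, so earlier times [s] are handled with [- v]. *)
Lemma rdist_curve (gamma : R -> M) (t : R) v (K : R) :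
  {for t, continuous gamma} ->
  is_derive (t : R^o) (1 : R^o) (cmap (ch (gamma t)) \o gamma) v ->
  tnorm g (gamma t) v < K ->
  exists2 d : R, 0 < d & forall s, `|s - t| < d ->
    (rdist g (gamma t) (gamma s) <= (K * `|s - t|)%:E)%E /\
    (rdist g (gamma s) (gamma t) <= (K * `|s - t|)%:E)%E.
Proof.
move=> ct dv vK; set p := gamma t in dv vK *.
have pp : cdom (ch p) p := chart_at_dom A p.
have [d1 d10 Hd1] := rdist_cmap vK.
have vK' : tnorm g p (- v) < K by rewrite tnorm_opp.
have [d2 d20 Hd2] := rdist_cmap vK'.
have ncd := near_cdom ct pp.
have cf : (cmap (ch p) \o gamma) s @[s --> t] --> (cmap (ch p) \o gamma) t.
  apply: (@differentiable_continuous _ R^o _ t (cmap (ch p) \o gamma)).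
  by apply/derivable1_diffP; case: dv.
have /cvgrPdist_lt/(_ d1 d10) n1 := cf.
have /cvgrPdist_lt/(_ d2 d20) n2 := cf.
have [fx dfx] := dv.
have : h^-1 *: ((cmap (ch p) \o gamma) (h *: (1 : R^o) + t) - (cmap (ch p) \o gamma) t) @[h --> 0^'] --> v.
  by rewrite -dfx; exact: fx.
move=> /cvgrPdist_lt dq.
have := dq _ d10; have {dq} := dq _ d20.
rewrite !near_withinE => /nbhs_ballP[e2 /= e20 He2] /nbhs_ballP[e1 /= e10 He1].
have /nbhs_ballP[e3 /= e30 He3] := ncd.
have /nbhs_ballP[e4 /= e40 He4] := n1.
have /nbhs_ballP[e5 /= e50 He5] := n2.
exists (Num.min e1 (Num.min e2 (Num.min e3 (Num.min e4 e5)))).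
  by rewrite !lt_min e10 e20 e30 e40.
move=> s; rewrite !lt_min => /and5P[s1 s2 s3 s4 s5].
have [->|st] := eqVneq s t.
  by rewrite subrr normr0 mulr0 -/p rdist_refl.
have bs e : `|s - t| < e -> ball (t : R^o) e s by rewrite -ball_normE /= distrC.
have b0 e : `|s - t| < e -> ball (0 : R^o) e (s - t) by rewrite -ball_normE /= sub0r normrN.
have ps := He3 _ (bs _ s3).
have st0 : s - t != 0 by rewrite subr_eq0.
have Es : (s - t) *: (1 : R^o) + t = s by rewrite [_ *: _]mulr1 subrK.
have q1 := He1 _ (b0 _ s1) st0; rewrite Es in q1.
have q2 := He2 _ (b0 _ s2) st0; rewrite Es in q2.
have [st1|st1] := leP t s.
- have st2 : 0 <= s - t by rewrite subr_ge0.
  rewrite ger0_norm//; apply: Hd1 => //; first exact: He4 (bs _ s4).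
  by eexists; [exact: q1|rewrite scalerA divff// scale1r].
- have st2 : 0 <= t - s by rewrite subr_ge0 ltW.
  rewrite distrC ger0_norm//; apply: Hd2 => //; first exact: He5 (bs _ s5).
  exists (- ((s - t)^-1 *: (cmap (ch p) (gamma s) - cmap (ch p) p))).
    by rewrite -opprD normrN; exact: q2.
  by rewrite -(opprB s t) scaleNr scalerN opprK scalerA divff// scale1r.
Qed.

Lemma rdist_lipschitz (gamma : R -> M) (a b K : R) : a <= b ->
  (forall t, a <= t <= b -> exists2 d : R, 0 < d & forall s, a <= s <= b -> `|s - t| < d ->
    (rdist g (gamma t) (gamma s) <= (K * `|s - t|)%:E)%E /\
    (rdist g (gamma s) (gamma t) <= (K * `|s - t|)%:E)%E) ->
  (rdist g (gamma a) (gamma b) <= (K * (b - a))%:E)%E /\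
  (rdist g (gamma b) (gamma a) <= (K * (b - a))%:E)%E.
Proof.
move=> ab H.
have tri (s t u : R) (p q r : M) : (rdist g p q <= (K * (t - s))%:E)%E -> (rdist g q r <= (K * (u - t))%:E)%E ->
    (rdist g p r <= (K * (u - s))%:E)%E.
  move=> h1 h2; apply: (le_trans (rdist_triangle g p q r)).
  apply: (le_trans (leeD h1 h2)); rewrite -EFinD lee_fin.
  by rewrite -mulrDr addrC addrA subrK.
have tri' (s t u : R) (p q r : M) : (rdist g p q <= (K * (u - t))%:E)%E -> (rdist g q r <= (K * (t - s))%:E)%E ->
    (rdist g p r <= (K * (u - s))%:E)%E.
  move=> h1 h2; apply: (le_trans (rdist_triangle g p q r)).
  apply: (le_trans (leeD h1 h2)); rewrite -EFinD lee_fin.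
  by rewrite -mulrDr addrA subrK.
apply: (@cousin R a b (fun s t =>
  (rdist g (gamma s) (gamma t) <= (K * (t - s))%:E)%E /\
  (rdist g (gamma t) (gamma s) <= (K * (t - s))%:E)%E) ab).
  move=> s t u _ _ _ _ [h1 h2] [h3 h4]; split; first exact: tri h1 h3.
  exact: tri' h4 h2.
move=> x xab; have [d d0 Hd] := H x xab; exists d => // s t as_ sx xt tb sd td.
have [|| h1 h2] := Hd s; [lra|by rewrite ler0_norm; lra|].
have [|| h3 h4] := Hd t; [lra|by rewrite ger0_norm; lra|].
rewrite ler0_norm ?subr_le0// opprB in h1 h2; rewrite ger0_norm ?subr_ge0// in h3 h4.
by split; [exact: tri h2 h3|exact: tri' h4 h1].
Qed.

(** At the end points only continuity is known: the interval is shrunk by [d / 3] on each side, and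
    each missing bit costs at most [e / 2] by [rdist_near]. *)
Lemma rdist_lipschitz_oo (gamma : R -> M) (a b K : R) : 0 <= K ->
  {within `[a, b], continuous gamma} ->
  (forall t, a < t < b -> exists2 d : R, 0 < d & forall s, `|s - t| < d ->
    (rdist g (gamma t) (gamma s) <= (K * `|s - t|)%:E)%E /\
    (rdist g (gamma s) (gamma t) <= (K * `|s - t|)%:E)%E) ->
  forall s t, a <= s -> s <= t -> t <= b ->
  (rdist g (gamma s) (gamma t) <= (K * (t - s))%:E)%E /\
  (rdist g (gamma t) (gamma s) <= (K * (t - s))%:E)%E.
Proof.
move=> K0 cg H s t as_ st tb.
have [->|st'] := eqVneq s t; first by rewrite subrr mulr0 rdist_refl.
have {st'} st : s < t by rewrite lt_neqAle st'.
have nr (u : R) : a <= u <= b -> forall e : R, 0 < e -> exists2 d : R, 0 < d & forall v : R, a <= v <= b ->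
    `|v - u| < d -> (rdist g (gamma u) (gamma v) <= e%:E)%E /\ (rdist g (gamma v) (gamma u) <= e%:E)%E.
  move=> uab e e0; move: cg => /subspace_continuousP/(_ u).
  rewrite /= in_itv/= => /(_ uab _ (rdist_near (gamma u) e0)).
  move=> cgu.
  have /nbhs_ballP[d /= d0 Hd] : \forall v \near u, `[a, b]%classic v ->
    (rdist g (gamma u) (gamma v) <= e%:E)%E /\ (rdist g (gamma v) (gamma u) <= e%:E)%E by exact: cgu.
  exists d => // v vab vu; apply: Hd; first by rewrite -ball_normE /= distrC.
  by rewrite /= in_itv.
suff key e : 0 < e -> (rdist g (gamma s) (gamma t) <= (K * (t - s) + e)%:E)%E /\
  (rdist g (gamma t) (gamma s) <= (K * (t - s) + e)%:E)%E.
  by split; apply/lee_addgt0Pr => e e0; rewrite -EFinD; apply key.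
move=> e0.
have e2 : 0 < e / 2 by rewrite divr_gt0.
have [|d1 d10 Hd1] := nr s _ _ e2; first by lra.
have [|d2 d20 Hd2] := nr t _ _ e2; first by lra.
pose d := Num.min (Num.min d1 d2) (t - s).
have d0 : 0 < d by rewrite !lt_min d10 d20/= subr_gt0.
have dd1 : d <= d1 by rewrite !ge_min lexx.
have dd2 : d <= d2 by rewrite !ge_min lexx orbT.
have dts : d <= t - s by rewrite !ge_min lexx orbT.
pose s' := s + d / 3; pose t' := t - d / 3.
have [| | h1 h2] := Hd1 s'; [by rewrite /s'; lra|by rewrite /s' addrC addKr ger0_norm; lra|].
have [| | h3 h4] := Hd2 t'; [by rewrite /t'; lra|by rewrite /t' addrC addKr ler0_norm; lra|].
have [| |h5 h6] := @rdist_lipschitz gamma s' t' K.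
- by rewrite /s' /t'; lra.
- move=> u uab; have [|e' e'0 He'] := H u; first by move: uab; rewrite /s' /t'; lra.
  by exists e' => // v _; exact: He'.
have le : K * (t' - s') <= K * (t - s) by apply: ler_wpM2l => //; rewrite /s' /t'; lra.
split.
- apply: (le_trans (rdist_triangle g _ (gamma s') _)).
  apply: (le_trans (leeD h1 (rdist_triangle g _ (gamma t') _))).
  apply: (le_trans (leeD2l _ (leeD h5 h4))).
  by rewrite -!EFinD lee_fin; lra.
- apply: (le_trans (rdist_triangle g _ (gamma t') _)).
  apply: (le_trans (leeD h3 (rdist_triangle g _ (gamma s') _))).
  apply: (le_trans (leeD2l _ (leeD h6 h2))).
  by rewrite -!EFinD lee_fin; lra.
Qed.

End Lines.

(** * Local characterization of orbits *)

Section Orbits.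
Context {R : realType} {n : nat} {M : topologicalType} {A : manifold R n M}.
Variables (g : riemannian A) (F : filippov A).
Local Notation ch := (chart_at A).
Local Notation h := (switch F).
Implicit Types (I J : set R) (gamma : R -> M).

Lemma near_oo (a b t : R) : a < t < b -> \forall s \near t, a < s < b.
Proof.
move=> tab; have : nbhs t `]a, b[%classic.
  by apply: open_nbhs_nbhs; split; [exact: interval_open|rewrite /= in_itv].
by apply: filterS => s /=; rewrite in_itv.
Qed.

Lemma has_velocity_ext gamma gamma' t v : (\forall s \near t, gamma s = gamma' s) ->
  has_velocity A gamma t v -> has_velocity A gamma' t v.
Proof.
move=> E; rewrite /has_velocity (nbhs_singleton E).
by apply: near_eq_is_derive; apply: filterS E => s /= ->.
Qed.

Lemma has_velocity_shift gamma (c t : R) v : has_velocity A gamma (c + t) v ->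
  has_velocity A (fun s => gamma (c + s)) t v.
Proof.
move=> H; rewrite /has_velocity.
have H' : is_derive (1 * t + c : R^o) (1 : R^o) (cmap (ch (gamma (c + t))) \o gamma) v.
  by rewrite mul1r addrC.
have := is_derive_affine H'; rewrite scale1r.
have -> : cmap (ch (gamma (c + t))) \o (fun s => gamma (c + s)) =
    (fun s => (cmap (ch (gamma (c + t))) \o gamma) (1 * s + c)).
  by apply/funext => s /=; rewrite mul1r (addrC s).
by [].
Qed.

Lemma smooth_piece_ext (a b : R) gamma gamma' : (forall s, a < s < b -> gamma s = gamma' s) ->
  smooth_piece g F `]a, b[ gamma -> smooth_piece g F `]a, b[ gamma'.
Proof.
move=> E; have nE s : a < s < b -> \forall u \near s, gamma u = gamma' u.
  by move=> /near_oo; apply: filterS.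
case=> H; [apply: Or31|apply: Or32|apply: Or33] => s; rewrite /= in_itv/= => sab.
- have [|h1 h2] := H s; first by rewrite /= in_itv.
  by rewrite -E//; split => //; exact: has_velocity_ext (nE _ sab) h2.
- have [|h1 h2] := H s; first by rewrite /= in_itv.
  by rewrite -E//; split => //; exact: has_velocity_ext (nE _ sab) h2.
- have [|v h1 h2] := H s; first by rewrite /= in_itv.
  by exists v; [rewrite -E|exact: has_velocity_ext (nE _ sab) h2].
Qed.

Lemma smooth_pieceS I J gamma : I `<=` J -> smooth_piece g F J gamma -> smooth_piece g F I gamma.
Proof.
move=> IJ [] H; [apply: Or31|apply: Or32|apply: Or33] => t /IJ; exact: H.
Qed.

Lemma plus_piece_shift (a b c : R) gamma : plus_piece F `]c + a, c + b[ gamma ->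
  plus_piece F `]a, b[ (fun s => gamma (c + s)).
Proof.
move=> H s; rewrite /= in_itv/= => sab; have [|h1 h2] := H (c + s).
  by rewrite /= in_itv/= !ltrD2l.
by split => //; exact: has_velocity_shift.
Qed.

Lemma minus_piece_shift (a b c : R) gamma : minus_piece F `]c + a, c + b[ gamma ->
  minus_piece F `]a, b[ (fun s => gamma (c + s)).
Proof.
move=> H s; rewrite /= in_itv/= => sab; have [|h1 h2] := H (c + s).
  by rewrite /= in_itv/= !ltrD2l.
by split => //; exact: has_velocity_shift.
Qed.

Lemma smooth_piece_shift (a b c : R) gamma : smooth_piece g F `]c + a, c + b[ gamma ->
  smooth_piece g F `]a, b[ (fun s => gamma (c + s)).
Proof.
case=> H; [apply: Or31; exact: plus_piece_shift|apply: Or32; exact: minus_piece_shift|].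
apply: Or33 => s; rewrite /= in_itv/= => sab; have [|v h1 h2] := H (c + s).
  by rewrite /= in_itv/= !ltrD2l.
by exists v => //; exact: has_velocity_shift.
Qed.

Lemma sliding_value_Sigma p v : sliding_value g F p v -> h p = 0.
Proof. by case=> [[[]]|[[]]]. Qed.

Lemma smooth_piece_plus J gamma s : smooth_piece g F J gamma -> J s -> 0 < h (gamma s) ->
  plus_piece F J gamma.
Proof.
case=> // H Js hs.
  by have [/(lt_trans hs)] := H s Js; rewrite ltxx.
by have [v /sliding_value_Sigma hs0] := H s Js; move: hs; rewrite hs0 ltxx.
Qed.

Lemma smooth_piece_minus J gamma s : smooth_piece g F J gamma -> J s -> h (gamma s) < 0 ->
  minus_piece F J gamma.
Proof.
case=> // H Js hs.
  by have [/lt_trans/(_ hs)] := H s Js; rewrite ltxx.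
by have [v /sliding_value_Sigma hs0] := H s Js; move: hs; rewrite hs0 ltxx.
Qed.

Lemma smooth_piece_sliding J gamma s : smooth_piece g F J gamma -> J s -> h (gamma s) = 0 ->
  sliding_piece g F J gamma.
Proof.
case=> // H Js hs.
  by have [] := H s Js; rewrite /Mplus/= hs ltxx.
by have [] := H s Js; rewrite /Mminus/= hs ltxx.
Qed.

Lemma smooth_piece_sg J gamma s t : smooth_piece g F J gamma -> J s -> J t ->
  Num.sg (h (gamma s)) = Num.sg (h (gamma t)).
Proof.
case=> H Js Jt; have := H s Js; have := H t Jt.
- by move=> [h1 _] [h2 _]; rewrite !gtr0_sg.
- by move=> [h1 _] [h2 _]; rewrite !ltr0_sg.
- by move=> [v /sliding_value_Sigma-> _] [w /sliding_value_Sigma-> _].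
Qed.

(** The kind of a piece is determined by the sign of [h] along it. That sign is locally constant,
    hence constant on the whole interval, so all the local pieces are of the same kind. *)
Lemma smooth_piece_glue (a b : R) gamma : a < b ->
  (forall t, a < t < b -> exists c d, [/\ c < t, t < d & smooth_piece g F `]c, d[ gamma]) ->
  smooth_piece g F `]a, b[ gamma.
Proof.
move=> ab H.
have sgP s t : a < s -> s <= t -> t < b -> Num.sg (h (gamma s)) = Num.sg (h (gamma t)).
  move=> as_ st tb.
  apply: (@cousin R s t (fun s t => Num.sg (h (gamma s)) = Num.sg (h (gamma t))) st).
    by move=> ? ? ? _ _ _ _ -> ->.
  move=> x xst; have [|c [d [cx xd pcd]]] := H x; first by lra.
  exists (Num.min (x - c) (d - x)); first by rewrite lt_min !subr_gt0 cx.
  move=> s' t' ss' s'x xt' t't h1 h2.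
  have [e1 e2] : Num.min (x - c) (d - x) <= x - c /\ Num.min (x - c) (d - x) <= d - x.
    by rewrite !ge_min !lexx orbT.
  apply: (smooth_piece_sg pcd); rewrite /= in_itv/=; lra.
have [t0 t0ab] : exists t0, a < t0 < b by exists ((a + b) / 2); lra.
have sgE t : a < t < b -> Num.sg (h (gamma t)) = Num.sg (h (gamma t0)).
  move=> tab; have [tt0|tt0] := leP t t0; first by apply: sgP; lra.
  by apply/esym/sgP; lra.
have loc t : a < t < b -> exists J, J t /\ smooth_piece g F J gamma.
  move=> tab; have [c [d [ct td p]]] := H t tab; exists `]c, d[%classic; split=> //.
  by rewrite /= in_itv/= ct.
have [h0|h0|h0] := ltgtP (h (gamma t0)) 0.
- apply: Or32 => t; rewrite /= in_itv/= => tab; have [J [Jt pJ]] := loc t tab.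
  by apply: (smooth_piece_minus pJ Jt) => //; rewrite -sgr_lt0 sgE// sgr_lt0.
- apply: Or31 => t; rewrite /= in_itv/= => tab; have [J [Jt pJ]] := loc t tab.
  by apply: (smooth_piece_plus pJ Jt) => //; rewrite -sgr_gt0 sgE// sgr_gt0.
- apply: Or33 => t; rewrite /= in_itv/= => tab; have [J [Jt pJ]] := loc t tab.
  apply: (smooth_piece_sliding pJ Jt) => //; apply/eqP; rewrite -sgr_eq0 sgE//.
  by rewrite sgr_eq0 h0.
Qed.

Definition crossing (c t d : R) gamma :=
  (plus_piece F `]c, t[ gamma /\ minus_piece F `]t, d[ gamma) \/
  (minus_piece F `]c, t[ gamma /\ plus_piece F `]t, d[ gamma).

(** Local form of [filippov_orbit], free of any gluing set: either a single piece passes through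
    [t], or [t] is a gluing time subject to the crossing rule. Witnesses are confined between given
    times of [I], so the condition passes to subintervals at once. *)
Definition orbit_at I gamma (t : R) :=
  [/\ (forall b, I b -> t < b -> exists c, [/\ t < c, c <= b & smooth_piece g F `]t, c[ gamma]),
      (forall a, I a -> a < t -> exists c, [/\ a <= c, c < t & smooth_piece g F `]c, t[ gamma]) &
      (forall a b, I a -> I b -> a < t -> t < b ->
        (exists c d, [/\ a <= c, c < t, t < d, d <= b & smooth_piece g F `]c, d[ gamma]) \/
        (Sigma F (gamma t) /\ (Sigma_c g F (gamma t) ->
          exists c d, [/\ a <= c, c < t, t < d, d <= b & crossing c t d gamma])))].

(* A gluing set which is valid on the whole interval can be recovered from
   local data as the set of interior times around which the curve is not a
   single smooth piece. *)
Lemma filippov_orbitP I gamma : filippov_orbit g F I gamma <->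
  [/\ is_interval I, (exists a b, [/\ I a, I b & a < b]),
      {within I, continuous gamma} & forall t, I t -> orbit_at I gamma t].
Proof.
split.
  move=> [itvI nI cI [S [SI Sfin Spiece Scross]]]; split => // t It.
  have II a b s : I a -> I b -> a <= s <= b -> I s by move=> Ia Ib; exact: itvI.
  have gap a b : I a -> I b -> a < t -> t < b ->
      exists c d, [/\ a <= c, c < t, t < d, d <= b & (S `\ t) `&` `]c, d[ = set0].
    move=> Ia Ib at_ tb.
    have fS : finite_set ((S `&` `[a, b]) `\ t) by apply: finite_setD; exact: Sfin.
    have [||c [d [ac ct td db E]]] := @finite_gap _ _ a b t fS; [by rewrite at_|by case=> _; apply|].
    exists c, d; split => //; apply/seteqP; split => // s [[Ss st] scd].
    rewrite -E; split => //; split => //; split => //.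
    by move: scd; rewrite /= !in_itv/=; lra.
  split.
  - move=> b Ib tb.
    have fS : finite_set ((S `&` `[t, b]) `\ t) by apply: finite_setD; exact: Sfin.
    have [||c [d [ac ct td db E]]] := @finite_gap _ _ (t - 1) b t fS; [by lra|by case=> _; apply|].
    exists d; split => //; apply: Spiece => //; first by apply: (II t b) => //; lra.
    apply/seteqP; split => // s [Ss std]; rewrite -E.
    move: std; rewrite /= !in_itv/= => std; split; last by lra.
    by split; [split => //; lra|move=> st; move: std; rewrite st ltxx].
  - move=> a Ia at_.
    have fS : finite_set ((S `&` `[a, t]) `\ t) by apply: finite_setD; exact: Sfin.
    have [||c [d [ac ct td db E]]] := @finite_gap _ _ a (t + 1) t fS; [by lra|by case=> _; apply|].
    exists c; split => //; apply: Spiece => //; first by apply: (II a t) => //; lra.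
    apply/seteqP; split => // s [Ss std]; rewrite -E.
    move: std; rewrite /= !in_itv/= => std; split; last by lra.
    by split; [split => //; lra|move=> st; move: std; rewrite st ltxx andbF].
  - move=> a b Ia Ib at_ tb; have [c [d [ac ct td db E]]] := gap a b Ia Ib at_ tb.
    have Ic : I c by apply: (II a b) => //; lra.
    have Id : I d by apply: (II a b) => //; lra.
    have [St|St] := pselect (S t); last first.
      left; exists c, d; split => //; apply: Spiece => //; first by lra.
      apply/seteqP; split => // s [Ss scd]; rewrite -E; split => //; split => //.
      by move=> st; apply: St; rewrite -st.
    right; split; first exact: (SI _ St).2.
    move=> cr; exists c, d; split => //; apply: (Scross c t d) => //; first by rewrite ct.
    apply/seteqP; split => s.
      move=> [Ss scd]; apply: contrapT => st; have : set0 s by rewrite -E.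
      by [].
    by move=> ->; split => //; rewrite /= in_itv/= ct.
move=> [itvI nI cI H]; split => //.
have II a b s : I a -> I b -> a <= s <= b -> I s by move=> Ia Ib; exact: itvI.
pose S := [set t | (exists a b, [/\ I a, I b, a < t & t < b]) /\
  ~ exists c d, [/\ c < t, t < d & smooth_piece g F `]c, d[ gamma]].
have glue a b : I a -> I b -> a < b -> S `&` `]a, b[ = set0 -> smooth_piece g F `]a, b[ gamma.
  move=> Ia Ib ab E; apply: smooth_piece_glue => // t tab.
  apply: contrapT => Nt; have : set0 t by rewrite -E; split; [split => //; exists a, b; split => //; lra|rewrite /= in_itv].
  by [].
exists S; split => //.
- move=> t [[a [b [Ia Ib at_ tb]]] Nt]; have It : I t by apply: (II a b) => //; lra.
  split => //; have [_ _ /(_ a b Ia Ib at_ tb)[|[]//]] := H t It.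
  by move=> [c [d [? ? ? ? p]]]; exfalso; apply: Nt; exists c, d.
(* Local finiteness: the one-sided pieces at [x] leave [x] as the only possible element of [S]
   nearby, and [cousin] adds up such neighbourhoods. *)
- move=> a b Ia Ib; have [ab|ba] := leP a b; last first.
    rewrite (_ : _ `&` _ = set0); first exact: finite_set0.
    by apply/seteqP; split => // s [_]; rewrite /= in_itv/=; lra.
  apply: (@cousin R a b (fun s t => finite_set (S `&` `[s, t])) ab).
    move=> s t u as_ st tu ub f1 f2.
    apply: (@sub_finite_set _ _ ((S `&` `[s, t]) `|` (S `&` `[t, u]))); last by rewrite finite_setU.
    move=> y [Sy]; rewrite /= in_itv/= => /andP[sy yu].
    by have [yt|yt] := leP y t; [left|right]; split => //=; rewrite in_itv/=; lra.
  move=> x /andP[ax xb]; have Ix : I x by apply: (II a b) => //; rewrite ax.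
  have [Hr Hl _] := H x Ix.
  have [d1 d10 Hd1] : exists2 d : R, 0 < d & forall y, x < y -> y < x + d -> y <= b -> ~ S y.
    have [xb'|xb'] := ltP x b; last by exists 1 => // y; lra.
    have [c [xc cb p]] := Hr b Ib xb'; exists (c - x); first by rewrite subr_gt0.
    by move=> y xy yc _ [_]; apply; exists x, c; split => //; lra.
  have [d2 d20 Hd2] : exists2 d : R, 0 < d & forall y, y < x -> x - d < y -> a <= y -> ~ S y.
    have [xb'|xb'] := ltP a x; last by exists 1 => // y; lra.
    have [c [xc cb p]] := Hl a Ia xb'; exists (x - c); first by rewrite subr_gt0.
    by move=> y xy yc _ [_]; apply; exists c, x; split => //; lra.
  exists (Num.min d1 d2); first by rewrite lt_min d10.
  have [e1 e2] : Num.min d1 d2 <= d1 /\ Num.min d1 d2 <= d2 by rewrite !ge_min !lexx orbT.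
  move=> s t as_ sx xt tb h1 h2; apply: (@sub_finite_set _ _ [set x]); last exact: finite_set1.
  move=> y [Sy]; rewrite /= in_itv/= => syt.
  have [yx|yx|//] := ltgtP y x.
    by exfalso; apply: (Hd2 y) => //; lra.
  by exfalso; apply: (Hd1 y) => //; lra.
- move=> a t b Ia Ib /andP[at_ tb] E Sc.
  have It : I t by apply: (II a b) => //; lra.
  have [St _] : (S `&` `]a, b[) t by rewrite E.
  have [_ _ /(_ a b Ia Ib at_ tb)[|[_ /(_ Sc)]]] := H t It.
    by move=> [c [d [? ? ? ? p]]]; exfalso; case: St => _; apply; exists c, d.
  have gl : smooth_piece g F `]a, t[ gamma.
    apply: glue => //; apply/seteqP; split => // s [Ss]; rewrite /= in_itv/= => sat.
    have : (S `&` `]a, b[) s by split => //; rewrite /= in_itv/=; lra.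
    by rewrite E => st; move: sat; rewrite st ltxx andbF.
  have gr : smooth_piece g F `]t, b[ gamma.
    apply: glue => //; apply/seteqP; split => // s [Ss]; rewrite /= in_itv/= => sat.
    have : (S `&` `]a, b[) s by split => //; rewrite /= in_itv/=; lra.
    by rewrite E => st; move: sat; rewrite st ltxx.
  move=> [c [d [ac ct td db]]].
  (* One sample time on each side of [t], common to the local crossing and to the full one-sided
     pieces [gl] and [gr], fixes the sign of [h] and hence the field driving each of them. *)
  pose y := (c + t) / 2; pose z := (t + d) / 2.
  have yc : `]c, t[%classic y by rewrite /= in_itv/= /y; lra.
  have ya : `]a, t[%classic y by rewrite /= in_itv/= /y; lra.
  have zd : `]t, d[%classic z by rewrite /= in_itv/= /z; lra.
  have zb : `]t, b[%classic z by rewrite /= in_itv/= /z; lra.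
  case=> -[p1 p2]; [left|right]; split.
  + exact: smooth_piece_plus gl ya (p1 _ yc).1.
  + exact: smooth_piece_minus gr zb (p2 _ zd).1.
  + exact: smooth_piece_minus gl ya (p1 _ yc).1.
  + exact: smooth_piece_plus gr zb (p2 _ zd).1.
Qed.

Lemma filippov_orbitS I J gamma : J `<=` I -> is_interval J ->
  (exists a b, [/\ J a, J b & a < b]) ->
  filippov_orbit g F I gamma -> filippov_orbit g F J gamma.
Proof.
move=> JI iJ nJ /filippov_orbitP[_ _ cI H]; apply/filippov_orbitP; split => //.
  exact: continuous_subspaceW cI.
move=> t /JI/H[h1 h2 h3]; split.
- by move=> b /JI; exact: h1.
- by move=> b /JI; exact: h2.
- by move=> a b /JI Ia /JI Ib; exact: h3.
Qed.

Lemma is_interval_itv (i : interval R) : is_interval [set` i].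
Proof. exact: interval_is_interval. Qed.

Lemma filippov_orbit_itv I gamma (a b : R) : filippov_orbit g F I gamma ->
  I a -> I b -> a < b -> filippov_orbit g F `[a, b] gamma.
Proof.
move=> oI Ia Ib ab; apply: (filippov_orbitS _ _ _ oI).
- by case: oI => iI _ _ _ s; rewrite /= in_itv/= => sab; exact: (iI a b).
- exact: is_interval_itv.
- by exists a, b; rewrite /= !in_itv/= !lexx ltW.
Qed.

(** Each clause of [orbit_at] involves only times between two points of [I], so compact subintervals
    suffice. Concatenations and unions of chains are reduced to this case. *)
Lemma filippov_orbit_compact I gamma : is_interval I ->
  (exists a b, [/\ I a, I b & a < b]) ->
  (forall a b, I a -> I b -> a < b -> filippov_orbit g F `[a, b] gamma) ->
  filippov_orbit g F I gamma.
Proof.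
move=> iI nI H.
have memL (a b : R) : a < b -> `[a, b]%classic a by move=> ab; rewrite /= in_itv/= lexx ltW.
have memR (a b : R) : a < b -> `[a, b]%classic b by move=> ab; rewrite /= in_itv/= lexx ltW.
apply/filippov_orbitP; split => //.
  apply/subspace_continuousP => t It O HO.
  (* [t] may be an end point of [I], so the two sides are treated separately; an absent side reduces
     to [t] itself. *)
  have [d1 d10 Hd1] : exists2 d : R, 0 < d & forall s, I s -> t <= s -> s < t + d -> O (gamma s).
    have [[b [Ib tb]]|Nb] := pselect (exists b, I b /\ t < b); last first.
      exists 1 => // s Is ts _; have [<-|st] := eqVneq t s; first exact: nbhs_singleton.
      by exfalso; apply: Nb; exists s; split => //; rewrite lt_neqAle st.
    have [_ _ cb _] := H t b It Ib tb.
    move/subspace_continuousP : cb => /(_ t (memL _ _ tb) _ HO) cb.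
    have /nbhs_ballP[d /= d0 Hd] : \forall s \near t, `[t, b]%classic s -> O (gamma s) by exact: cb.
    exists (Num.min d (b - t)); first by rewrite lt_min d0 subr_gt0.
    have [e1 e2] : Num.min d (b - t) <= d /\ Num.min d (b - t) <= b - t by rewrite !ge_min !lexx orbT.
    move=> s Is ts st; apply: Hd; last by rewrite /= in_itv/=; lra.
    by rewrite -ball_normE/= ler0_norm; lra.
  have [d2 d20 Hd2] : exists2 d : R, 0 < d & forall s, I s -> s <= t -> t - d < s -> O (gamma s).
    have [[b [Ib tb]]|Nb] := pselect (exists b, I b /\ b < t); last first.
      exists 1 => // s Is ts _; have [<-|st] := eqVneq t s; first exact: nbhs_singleton.
      by exfalso; apply: Nb; exists s; split => //; rewrite lt_neqAle eq_sym st.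
    have [_ _ cb _] := H b t Ib It tb.
    move/subspace_continuousP : cb => /(_ t (memR _ _ tb) _ HO) cb.
    have /nbhs_ballP[d /= d0 Hd] : \forall s \near t, `[b, t]%classic s -> O (gamma s) by exact: cb.
    exists (Num.min d (t - b)); first by rewrite lt_min d0 subr_gt0.
    have [e1 e2] : Num.min d (t - b) <= d /\ Num.min d (t - b) <= t - b by rewrite !ge_min !lexx orbT.
    move=> s Is ts st; apply: Hd; last by rewrite /= in_itv/=; lra.
    by rewrite -ball_normE/= ger0_norm; lra.
  have : \forall s \near t, t - d2 < s < t + d1 by apply: near_oo; lra.
  apply: filterS => s /andP[h1 h2] Is; have [st|st] := leP t s; first exact: Hd1.
  by apply: Hd2 => //; exact: ltW.
move=> t It; split.
- move=> b Ib tb; have /filippov_orbitP[_ _ _ /(_ t (memL _ _ tb))[+ _ _]] := H t b It Ib tb.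
  by apply => //; exact: memR.
- move=> b Ib tb; have /filippov_orbitP[_ _ _ /(_ t (memR _ _ tb))[_ + _]] := H b t Ib It tb.
  by apply => //; exact: memL.
- move=> a b Ia Ib at_ tb; have ab := lt_trans at_ tb.
  have /filippov_orbitP[_ _ _ /(_ t)[]] := H a b Ia Ib ab.
    by rewrite /= in_itv/= !ltW.
  by move=> _ _; apply => //; [exact: memL|exact: memR].
Qed.

Lemma filippov_orbit_ext I gamma gamma' : (forall t, I t -> gamma t = gamma' t) ->
  filippov_orbit g F I gamma -> filippov_orbit g F I gamma'.
Proof.
move=> E /filippov_orbitP[iI nI cI H]; apply/filippov_orbitP; split => //.
  by apply: subspace_eq_continuous cI => t /[!inE] /E.
have II a b s : I a -> I b -> a <= s <= b -> I s by move=> Ia Ib; exact: iI.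
have EE a b (c d : R) : I a -> I b -> a <= c -> d <= b -> forall s, c < s < d -> gamma s = gamma' s.
  by move=> Ia Ib ac db s scd; apply: E; apply: (II a b) => //; lra.
move=> t It; have [h1 h2 h3] := H t It; split.
- move=> b Ib tb; have [c [tc cb p]] := h1 b Ib tb; exists c; split => //.
  by apply: smooth_piece_ext p; exact: (EE t b).
- move=> b Ib tb; have [c [tc cb p]] := h2 b Ib tb; exists c; split => //.
  by apply: smooth_piece_ext p; exact: (EE b t).
- move=> a b Ia Ib at_ tb; rewrite -E//; case: (h3 a b Ia Ib at_ tb) => [[c [d [ac ct td db p]]]|[S1 S2]].
    by left; exists c, d; split => //; apply: smooth_piece_ext p; exact: (EE a b).
  right; split => // /S2[c [d [ac ct td db p]]]; exists c, d; split => //.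
  have E1 s : c < s < t -> \forall u \near s, gamma u = gamma' u.
    by move=> /near_oo; apply: filterS; apply: (EE a b) => //; lra.
  have E2 s : t < s < d -> \forall u \near s, gamma u = gamma' u.
    by move=> /near_oo; apply: filterS; apply: (EE a b) => //; lra.
  case: p => -[p1 p2]; [left|right]; split => s sI.
  + have [m v] := p1 s sI; move: sI; rewrite /= in_itv/= => /E1 nE.
    by rewrite -(nbhs_singleton nE); split => //; exact: has_velocity_ext v.
  + have [m v] := p2 s sI; move: sI; rewrite /= in_itv/= => /E2 nE.
    by rewrite -(nbhs_singleton nE); split => //; exact: has_velocity_ext v.
  + have [m v] := p1 s sI; move: sI; rewrite /= in_itv/= => /E1 nE.
    by rewrite -(nbhs_singleton nE); split => //; exact: has_velocity_ext v.
  + have [m v] := p2 s sI; move: sI; rewrite /= in_itv/= => /E2 nE.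
    by rewrite -(nbhs_singleton nE); split => //; exact: has_velocity_ext v.
Qed.

Lemma filippov_orbit_shift I gamma (c : R) : filippov_orbit g F I gamma ->
  filippov_orbit g F [set s | I (c + s)] (fun s => gamma (c + s)).
Proof.
move=> /filippov_orbitP[iI nI cI H]; apply/filippov_orbitP; split.
- by move=> a b /= Ia Ib s sab; apply: (iI _ _ Ia Ib); rewrite !lerD2l.
- have [a [b [Ia Ib ab]]] := nI; exists (a - c), (b - c) => /=.
  by rewrite !(addrC c) !subrK ltrD2r.
- apply/subspace_continuousP => t /= It O HO.
  move/subspace_continuousP : cI => /(_ _ It _ HO) cI.
  have : \forall s \near (c + t), I s -> O (gamma s) by exact: cI.
  have cv : (c + s) @[s --> t] --> c + t by apply: cvgD; [exact: cvg_cst|exact: cvg_id].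
  by move=> /cv.
- move=> t /= It; have [h1 h2 h3] := H _ It; split.
  + move=> b /= Ib tb; have [|d [td db p]] := h1 _ Ib; first by rewrite ltrD2l.
    exists (d - c); split; [lra|lra|]; apply: smooth_piece_shift.
    by rewrite (addrC c (d - c)) subrK.
  + move=> b /= Ib tb; have [|d [td db p]] := h2 _ Ib; first by rewrite ltrD2l.
    exists (d - c); split; [lra|lra|]; apply: smooth_piece_shift.
    by rewrite (addrC c (d - c)) subrK.
  + move=> a b /= Ia Ib at_ tb.
    have [||[x [y [ax xt ty yb p]]]|[S1 S2]] := h3 _ _ Ia Ib; [by rewrite ltrD2l|by rewrite ltrD2l| |].
      left; exists (x - c), (y - c); split; [lra|lra|lra|lra|]; apply: smooth_piece_shift.
      by rewrite !(addrC c (_ - c)) !subrK.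
    right; split => // /S2[x [y [ax xt ty yb p]]].
    exists (x - c), (y - c); split; [lra|lra|lra|lra|].
    case: p => -[p1 p2]; [left|right]; split;
      first [apply: plus_piece_shift|apply: minus_piece_shift];
      by rewrite (addrC c (_ - c)) subrK.
Qed.

(** Away from [b] the local condition is inherited from one of the two orbits. At [b] the one-sided
    pieces come from either side, and the crossing rule is vacuous because a tangency point is not
    in [Sigma_c]. *)
Lemma filippov_orbit_cat I J gamma (b : R) : I b -> J b ->
  (forall t, I t -> t <= b) -> (forall t, J t -> b <= t) ->
  Sigma_t g F (gamma b) ->
  filippov_orbit g F I gamma -> filippov_orbit g F J gamma ->
  filippov_orbit g F (I `|` J) gamma.
Proof.
move=> Ib Jb Ile Jge Tb oI oJ.
have [iI nI _ _] := oI; have [iJ _ _ _] := oJ.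
have IP s a : I a -> a <= s -> s <= b -> I s by move=> Ia as_ sb; apply: (iI a b) => //; rewrite as_.
have JP s a : J a -> s <= a -> b <= s -> J s by move=> Ia as_ sb; apply: (iJ b a) => //; rewrite as_ sb.
apply: filippov_orbit_compact.
- move=> x y Hx Hy s /andP[xs sy]; have [sb|bs] := leP s b.
    left; case: Hx => [Ix|/Jge bx]; first exact: IP Ix xs sb.
    by have -> : s = b by lra.
  right; case: Hy => [/Ile yb|Jy]; first by lra.
  by apply: JP Jy sy _; exact: ltW.
- by have [x [y [Ix Iy xy]]] := nI; exists x, y; split => //; left.
move=> x y Hx Hy xy.
have [yb|by_] := leP y b.
  have Iy : I y by case: Hy => // /Jge ?; have -> : y = b by lra.
  have Ix : I x by case: Hx => // /Jge ?; lra.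
  exact: filippov_orbit_itv oI Ix Iy xy.
have Jy : J y by case: Hy => // /Ile ?; lra.
have [bx|xb] := leP b x.
  have Jx : J x by case: Hx => // /Ile ?; have -> : x = b by lra.
  exact: filippov_orbit_itv oJ Jx Jy xy.
have Ix : I x by case: Hx => // /Jge ?; lra.
have /filippov_orbitP[_ _ c1 o1] := filippov_orbit_itv oI Ix Ib xb.
have /filippov_orbitP[_ _ c2 o2] := filippov_orbit_itv oJ Jb Jy by_.
apply/filippov_orbitP; split.
- exact: is_interval_itv.
- by exists x, y; rewrite /= !in_itv/= !lexx ltW.
- have -> : `[x, y]%classic = `[x, b]%classic `|` `[b, y]%classic.
    apply/seteqP; split => s /=; rewrite !in_itv/=.
      by move=> sxy; have [?|?] := leP s b; [left|right]; lra.
    by case; lra.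
  by apply: withinU_continuous => //; exact: interval_closed.
have m1 s : x <= s -> s <= b -> `[x, b]%classic s by move=> ? ?; rewrite /= in_itv/=; lra.
have m2 s : b <= s -> s <= y -> `[b, y]%classic s by move=> ? ?; rewrite /= in_itv/=; lra.
move=> t; rewrite /= in_itv/= => txy; split.
- move=> u; rewrite /= in_itv/= => uxy tu.
  have [bt|tb] := leP b t.
    have [|H _ _] := o2 t; first by apply: m2; lra.
    by apply: H => //; apply: m2; lra.
  have [|H _ _] := o1 t; first by apply: m1; lra.
  (* The first orbit is only known up to [b], so the target [u] is cut down to [b]. *)
  have [|| c [tc cu p]] := H (Num.min u b); [| by rewrite lt_min tu |].
    by apply: m1; [rewrite le_min; lra|rewrite ge_min lexx orbT].
  by exists c; split => //; rewrite (le_trans cu)// ge_min lexx.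
- move=> u; rewrite /= in_itv/= => uxy tu.
  have [tb|bt] := leP t b.
    have [|_ H _] := o1 t; first by apply: m1; lra.
    by apply: H => //; apply: m1; lra.
  have [|_ H _] := o2 t; first by apply: m2; lra.
  have [|| c [tc cu p]] := H (Num.max u b); [| by rewrite gt_max tu |].
    by apply: m2; [rewrite le_max lexx orbT|rewrite ge_max; lra].
  by exists c; split => //; rewrite (le_trans _ tc)// le_max lexx.
- move=> u v; rewrite /= !in_itv/= => uxy vxy ut tv.
  have [tb|bt|tb] := ltgtP t b.
  + have [|_ _ H] := o1 t; first by apply: m1; lra.
    have vb : Num.min v b <= v by rewrite ge_min lexx.
    have [||||[c [d [? ? ? ? p]]]|[S1 S2]] := H u (Num.min v b).
    * by apply: m1; lra.
    * by apply: m1; [rewrite le_min; lra|rewrite ge_min lexx orbT].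
    * by [].
    * by rewrite lt_min tv.
    * by left; exists c, d; split => //; lra.
    * right; split => // /S2[c [d [? ? ? ? p]]].
      by exists c, d; split => //; lra.
  + have [|_ _ H] := o2 t; first by apply: m2; lra.
    have vb : u <= Num.max u b by rewrite le_max lexx.
    have [||||[c [d [? ? ? ? p]]]|[S1 S2]] := H (Num.max u b) v.
    * by apply: m2; [rewrite le_max lexx orbT|rewrite ge_max; lra].
    * by apply: m2; lra.
    * by rewrite gt_max ut.
    * by [].
    * by left; exists c, d; split => //; lra.
    * right; split => // /S2[c [d [? ? ? ? p]]].
      by exists c, d; split => //; lra.
  + right; rewrite tb; case: Tb => S1 S2; split => // -[_].
    by rewrite S2 ltxx.
Qed.

End Orbits.

(** * Peano's theorem *)

Lemma fmap_ultra (T S : Type) (f : T -> S) (F : set_system T) :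
  UltraFilter F -> UltraFilter (f @ F).
Proof.
move=> UF; have PF : ProperFilter F by exact: ultra_proper.
split; first exact: fmap_proper_filter.
move=> G PG FG; apply/seteqP; split => // B GB.
have [//|FnB] := in_ultra_setVsetC (f @^-1` B) UF.
have GnB : G (~` B) by apply: FG.
have GE : G (B `&` ~` B) by exact: filterI.
by have [x []] := filter_ex GE.
Qed.

Section Peano.
Context {R : realType} {n : nat}.
Variables (f : 'rV[R]_n -> 'rV[R]_n) (x0 : 'rV[R]_n) (r B : R).
Hypotheses (r0 : 0 < r) (B0 : 0 < B).
Hypothesis f_cont : forall x, `|x - x0| <= r -> {for x, continuous f}.
Hypothesis f_bnd : forall x, `|x - x0| <= r -> `|f x| <= B.

Definition mesh (k : nat) : R := k.+1%:R^-1.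
(** A path of speed at most [B] needs at least this time to leave the ball of radius [r], so the
    Euler nodes up to [T] stay where [f] is controlled. *)
Local Notation T := (r / B).

Fixpoint euler (k i : nat) : 'rV[R]_n :=
  if i is j.+1 then euler k j + mesh k *: f (euler k j) else x0.

Let mesh_gt0 k : 0 < mesh k.
Proof. by rewrite /mesh invr_gt0. Qed.

(** The increments telescope, each compared with [mesh k *: w]. With [w = 0] this yields Lipschitz
    bounds, with [w] the value of [f] at the limit point it yields the derivative. *)
Lemma euler_step (k i m : nat) (w : 'rV[R]_n) (e : R) :
  (forall l, (i <= l < i + m)%N -> `|f (euler k l) - w| <= e) ->
  `|euler k (i + m) - euler k i - (m%:R * mesh k) *: w| <= m%:R * mesh k * e.
Proof.
elim: m => [|m IH] H; first by rewrite addn0 subrr !mul0r scale0r subr0 normr0.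
rewrite addnS /= -(natr1 m).
have -> : euler k (i + m) + mesh k *: f (euler k (i + m)) - euler k i - ((m%:R + 1) * mesh k) *: w =
    (euler k (i + m) - euler k i - (m%:R * mesh k) *: w) + mesh k *: (f (euler k (i + m)) - w).
  by apply/rowP => j; rewrite !mxE; ring.
rewrite (le_trans (ler_normD _ _))// !mulrDl mul1r lerD//.
  by apply: IH => l lm; apply: H; lia.
by rewrite normrZ gtr0_norm// ler_pM2l//; apply: H; lia.
Qed.

Lemma euler_ball (k i : nat) : i%:R * mesh k <= T -> `|euler k i - x0| <= i%:R * mesh k * B.
Proof.
elim: i => [|i IH] iT; first by rewrite /= subrr normr0 !mul0r.
have iT' : i%:R * mesh k <= T.
  by apply: le_trans iT; rewrite ler_pM2r// ler_nat.
have := IH iT' => {}IH /=.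
rewrite addrAC -(natr1 i) !mulrDl mul1r (le_trans (ler_normD _ _))// lerD//.
rewrite normrZ gtr0_norm// ler_pM2l// f_bnd// (le_trans IH)//.
by rewrite -ler_pdivlMr.
Qed.

Lemma euler_lipschitz (k i m : nat) : (i + m)%:R * mesh k <= T ->
  `|euler k (i + m) - euler k i| <= m%:R * mesh k * B.
Proof.
move=> imT; have := @euler_step k i m 0 B; rewrite scaler0 subr0; apply => l lm.
have lT : l%:R * mesh k <= T.
  by apply: le_trans imT; rewrite ler_pM2r// ler_nat; lia.
rewrite subr0 f_bnd// (le_trans (euler_ball lT))//.
by rewrite -ler_pdivlMr.
Qed.

(** Times are rounded down to the mesh, which gives step functions [Y] instead of interpolated
    polygons; the error is of order [mesh k] and vanishes in the limit. *)
Let idx (k : nat) (t : R) : nat := Num.truncn (t * k.+1%:R).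
Let Y (t : R) (k : nat) : 'rV[R]_n := euler k (idx k t).

Let idxP k t : 0 <= t -> (idx k t)%:R * mesh k <= t /\ t < (idx k t)%:R * mesh k + mesh k.
Proof.
move=> t0; have k0 : 0 < k.+1%:R :> R by rewrite ltr0n.
have /andP[h1 h2] := truncn_itv (mulr_ge0 t0 (ltW k0)).
split; first by rewrite ler_pdivrMr.
by rewrite -{2}[mesh k]mul1r -mulrDl natr1 ltr_pdivlMr.
Qed.

Let idx_le k s t : s <= t -> (idx k s <= idx k t)%N.
Proof. by move=> st; apply: le_truncn; rewrite ler_wpM2r. Qed.

(** The last error term is due to rounding: the elapsed mesh time differs from [t - s] by at most
    [mesh k]. *)
Let Y_step k s t (w : 'rV[R]_n) (e : R) : 0 <= s -> s <= t -> t <= T -> 0 <= e ->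
  (forall l, (idx k s <= l < idx k t)%N -> `|f (euler k l) - w| <= e) ->
  `|Y t k - Y s k - (t - s) *: w| <= (t - s) * e + mesh k * (e + `|w|).
Proof.
move=> s0 st tT e0 H; have [s1 s2] := idxP k s0.
have [t1 t2] := idxP k (le_trans s0 st).
have E := subnKC (idx_le k st).
set m := (idx k t - idx k s)%N in E.
have := @euler_step k (idx k s) m w e; rewrite E => /(_ H) K.
have mE : m%:R * mesh k = (idx k t)%:R * mesh k - (idx k s)%:R * mesh k.
  by rewrite -mulrBl -natrB ?idx_le.
have -> : Y t k - Y s k - (t - s) *: w = (euler k (idx k t) - euler k (idx k s) - (m%:R * mesh k) *: w)
   + (m%:R * mesh k - (t - s)) *: w.
  by apply/rowP => j; rewrite /Y !mxE; ring.
have h1 : `|m%:R * mesh k - (t - s)| <= mesh k by rewrite ler_norml mE; lra.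
rewrite (le_trans (ler_normD _ _))// mulrDr addrA lerD//; last first.
  by rewrite normrZ ler_wpM2r.
rewrite (le_trans K)// -mulrDl ler_wpM2r// mE; lra.
Qed.

Let Y_lip k s t : 0 <= s -> s <= t -> t <= T -> `|Y t k - Y s k| <= (t - s) * B + mesh k * B.
Proof.
move=> s0 st tT.
have := @Y_step k s t 0 B s0 st tT (ltW B0); rewrite scaler0 subr0 normr0 addr0; apply.
move=> l /andP[_ l2]; have [t1 _] := idxP k (le_trans s0 st).
have lT : l%:R * mesh k <= T.
  apply: le_trans (le_trans t1 tT); rewrite ler_pM2r// ler_nat; exact: ltnW.
by rewrite subr0 f_bnd// (le_trans (euler_ball lT))// -ler_pdivlMr.
Qed.

Let Y_ball k t : 0 <= t -> t <= T -> `|Y t k - x0| <= r.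
Proof.
move=> t0 tT; have [t1 _] := idxP k t0.
have iT := le_trans t1 tT.
by rewrite (le_trans (euler_ball iT))// -ler_pdivlMr.
Qed.

(* Euler polygons converge pointwise along an ultrafilter, which replaces the
   extraction of a uniformly convergent subsequence. *)
Lemma peano : exists y : R -> 'rV[R]_n,
  [/\ y 0 = x0,
      forall s t, 0 <= s -> s <= t -> t <= T -> `|y t - y s| <= (t - s) * B,
      forall t, 0 <= t -> t <= T -> `|y t - x0| <= r &
      forall t, 0 < t -> t < T -> is_derive (t : R^o) (1 : R^o) y (f (y t))].
Proof.
have [U [UU inftyU]] := @ultraFilterLemma nat \oo _.
have PU : ProperFilter U by exact: ultra_proper.
have lims t : 0 <= t -> t <= T -> exists z : 'rV[R]_n, Y t k @[k --> U] --> z.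
  move=> t0 tT.
  have := @rV_compact R n (fun i => `[x0 0 i - r, x0 0 i + r]%classic) (fun i => @segment_compact _ _ _).
  rewrite compact_ultra => HC.
  have UY : UltraFilter (Y t @ U) by exact: fmap_ultra.
  have [|z [_ Hz]] := HC _ UY; last by exists z.
  apply: (@filterE _ U) => k i /=; rewrite in_itv/=.
  have := le_trans (rV_norm_coord (Y t k - x0) i) (Y_ball k t0 tT).
  by rewrite !mxE ler_norml; lra.
have /choice[y Hy] t : exists z : 'rV[R]_n, 0 <= t -> t <= T -> Y t k @[k --> U] --> z.
  have [t0|t0] := boolP (0 <= t); last by exists 0.
  have [tT|tT] := boolP (t <= T); last by exists 0.
  by have [z Hz] := lims t t0 tT; exists z.
have T0 : 0 <= T by rewrite divr_ge0 ?ltW.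
have meshU : mesh k @[k --> U] --> 0.
  by apply: cvg_trans (@cvg_harmonic R); exact: cvg_app inftyU.
have le_limU (a : nat -> R) (l c c' : R) : a k @[k --> U] --> l ->
    (\forall k \near U, a k <= c + mesh k * c') -> l <= c.
  move=> al ac; have cc : c + mesh k * c' @[k --> U] --> c.
    rewrite -[X in _ --> X]addr0 -[X in _ --> _ + X](mul0r c').
    by apply: cvgD; [exact: cvg_cst|apply: cvgM => //; exact: cvg_cst].
  exact: ler_cvg_to al cc ac.
have y_lip s t : 0 <= s -> s <= t -> t <= T -> `|y t - y s| <= (t - s) * B.
  move=> s0 st tT.
  have cvy : `|Y t k - Y s k| @[k --> U] --> `|y t - y s|.
    by apply: cvg_norm; apply: cvgB; apply: Hy => //; lra.
  apply: (le_limU _ _ _ B cvy); apply: filterE => k; exact: Y_lip.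
have y_ball t : 0 <= t -> t <= T -> `|y t - x0| <= r.
  move=> t0 tT.
  have cvy : `|Y t k - x0| @[k --> U] --> `|y t - x0|.
    by apply: cvg_norm; apply: cvgB; [apply: Hy|exact: cvg_cst].
  apply: (le_limU _ _ _ 0 cvy); apply: filterE => k; rewrite mulr0 addr0; exact: Y_ball.
exists y; split => //.
  have cvy : Y 0 k @[k --> U] --> y 0 by exact: Hy.
  have cv0 : Y 0 k @[k --> U] --> x0.
    rewrite (_ : (fun k => _) = cst x0); first exact: cvg_cst.
    by apply/funext => k; rewrite /Y /idx mul0r truncn0.
  exact: (cvg_unique _ cvy cv0).
move=> t t0 tT.
set z := y t; have zr : `|z - x0| <= r by apply: y_ball; exact: ltW.
have key (e : R) : 0 < e -> exists2 d : R, 0 < d & forall s, `|s - t| < d ->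
    `|y s - y t - (s - t) *: f z| <= `|s - t| * e.
  move=> e0; have /cvgrPdist_le/(_ e e0) := f_cont zr.
  move=> /nbhs_ballP[rho /= rho0 Hrho].
  (* The first two bounds keep [s] in the time interval. The third makes the motion during time [d]
     at most [rho / 4]; one more [rho / 4] is left for the distance of [Y t k] from its limit and
     one for a mesh step, so all nodes visited between [s] and [t] lie within [rho] of [z]. *)
  pose d := Num.min (Num.min t (T - t)) (rho / (4 * B)).
  have [d1 [d2 d3]] : d <= t /\ d <= T - t /\ d <= rho / (4 * B).
    by rewrite /d !ge_min !lexx !orbT.
  have d0 : 0 < d by rewrite !lt_min t0 subr_gt0 tT divr_gt0// mulr_gt0.
  exists d => // s; rewrite ltr_norml => /andP[h1 h2].
  have dB : d * B <= rho / 4.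
    by rewrite -ler_pdivlMr// -mulrA -invfM.
  have nU1 : \forall k \near U, `|z - Y t k| < rho / 4.
    have /cvgrPdist_lt : Y t k @[k --> U] --> z by apply: Hy; exact: ltW.
    by apply; rewrite divr_gt0.
  have nU2 : \forall k \near U, mesh k < rho / (4 * B).
    by apply: (cvgr_lt 0 meshU); rewrite divr_gt0// mulr_gt0.
  have near_z k u v l : `|z - Y t k| < rho / 4 -> mesh k < rho / (4 * B) ->
      0 <= u -> u <= v -> v <= T -> v - u <= d -> u = t \/ v = t ->
      (idx k u <= l < idx k v)%N -> `|f (euler k l) - f z| <= e.
    move=> n1 n2 u0 uv vT vud uvt /andP[l1 l2].
    have [u1 u2] := idxP k u0; have [v1 v2] := idxP k (le_trans u0 uv).
    have lT : l%:R * mesh k <= (idx k v)%:R * mesh k by rewrite ler_pM2r// ler_nat ltnW.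
    have ul : (idx k u)%:R * mesh k <= l%:R * mesh k by rewrite ler_pM2r// ler_nat.
    rewrite distrC; apply: Hrho; rewrite -ball_normE/=.
    have hB : mesh k * B < rho / 4.
      by rewrite -ltr_pdivlMr// -mulrA -invfM.
    have lY : `|Y t k - euler k l| <= (d + mesh k) * B.
      case: uvt => [ut|vt].
        rewrite -ut distrC /Y -(subnKC l1).
        have := @euler_lipschitz k (idx k u) (l - idx k u); rewrite subnKC// => H.
        apply: (le_trans (H _)); first by lra.
        by rewrite ler_pM2r// natrB// mulrBl; lra.
      rewrite -vt /Y -(subnKC (ltnW l2)).
      have := @euler_lipschitz k l (idx k v - l); rewrite subnKC ?(ltnW l2)// => H.
      apply: (le_trans (H _)); first by lra.
      by rewrite ler_pM2r// natrB ?(ltnW l2)// mulrBl; lra.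
    rewrite -(subrK (Y t k) z) -addrA (le_lt_trans (ler_normD _ _))//.
    have : `|z - Y t k| + `|Y t k - euler k l| <= `|z - Y t k| + (d * B + mesh k * B).
      by rewrite lerD2l -mulrDl.
    by move=> /le_lt_trans; apply; lra.
  have cvy : `|Y s k - Y t k - (s - t) *: f z| @[k --> U] --> `|y s - z - (s - t) *: f z|.
    apply: cvg_norm; apply: cvgB; last exact: cvg_cst.
    by apply: cvgB; apply: Hy; lra.
  apply: (le_limU _ _ _ (e + `|f z|) cvy).
  apply: filterS2 nU1 nU2 => k n1 n2.
  have [ts|st] := leP t s.
    rewrite ger0_norm ?subr_ge0//; apply: Y_step => //; [lra|lra|lra|].
    by move=> l; apply: near_z => //; [lra|lra|lra|left].
  rewrite ler0_norm; last by rewrite subr_le0 ltW.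
  rewrite opprB.
  have -> : Y s k - Y t k - (s - t) *: f z = - (Y t k - Y s k - (t - s) *: f z).
    by apply/rowP => j; rewrite !mxE; ring.
  rewrite normrN.
  apply: Y_step => //; [lra|lra|lra|lra|].
  by move=> l; apply: near_z => //; [lra|lra|lra|lra|right].
have dq : h^-1 *: ((y \o shift (t : R^o)) (h *: (1 : R^o)) - y t) @[h --> 0^'] --> f z.
  apply/cvgrPdist_le => e e0; rewrite near_withinE.
  have [d d0 Hd] := key e e0.
  apply/nbhs_ballP; exists d => //= h; rewrite -ball_normE /= sub0r normrN => hd hn0.
  have hE : h *: (1 : R^o) = h by rewrite [LHS]mulr1.
  rewrite hE; have := Hd (h + t); rewrite addrK => /(_ hd) H.
  have -> : f z - h^-1 *: (y (h + t) - y t) = - (h^-1 *: (y (h + t) - y t - h *: f z)).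
    by rewrite [in RHS]scalerBr scalerA mulVf// scale1r opprB.
  rewrite normrN normrZ normfV -ler_pdivlMl ?invr_gt0 ?normr_gt0//.
  by rewrite invrK.
apply: DeriveDef; first by apply/cvg_ex; exists (f z).
exact: cvg_lim dq.
Qed.

End Peano.

(** * Existence and extension of orbits *)

Section Existence.
Context {R : realType} {n : nat} {M : topologicalType} {A : manifold R n M}.
Variables (g : riemannian A) (F : filippov A).
Local Notation ch := (chart_at A).
Local Notation h := (switch F).
Implicit Types (I J : set R) (gamma : R -> M) (p q : M).

Lemma chart_nbhs q (x : 'rV[R]_n) (P : M -> Prop) : ccod (ch q) x ->
  (\forall z \near cinv (ch q) x, P z) -> \forall y \near x, ccod (ch q) y -> P (cinv (ch q) y).
Proof.
move=> qx nP; have : nbhs (cinv (ch q) x) [set z | P z] by exact: nP.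
rewrite nbhsE => -[U [Uo Ux] UP].
by apply: filterS (cinv_near qx Uo Ux) => y Uy /Uy /UP.
Qed.

(** Peano's theorem for the coordinate expression [f] of the field, on a ball so small that the
    curve stays inside the chart and in [P]; the velocity is then carried back to the chart at each
    point by [tchangeK]. *)
Lemma integral_curve q (x : 'rV[R]_n) (X : M -> 'rV[R]_n) (k : nat) (P : M -> Prop) :
  nbhs x (ccod (ch q)) -> Ck_vfield A k X ->
  (\forall y \near x, ccod (ch q) y -> P (cinv (ch q) y)) ->
  exists (T : R) (gamma : R -> M), [/\ 0 < T, gamma 0 = cinv (ch q) x,
    {within `[0, T], continuous gamma} &
    forall t, 0 < t < T -> P (gamma t) /\ has_velocity A gamma t (X (gamma t))].
Proof.
move=> nx cX nP.
pose f (y : 'rV[R]_n) := let p := cinv (ch q) y in tchange (ch p) (ch q) p (X p).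
have f_cont y : nbhs y (ccod (ch q)) -> {for y, continuous f}.
  move=> ny; have qy := nbhs_singleton ny.
  have := Ck_at_cvg qy (cX q y qy).
  by rewrite (within_interior ny).
have fx := f_cont x nx.
have nf : \forall y \near x, `|f y| <= `|f x| + 1.
  have /cvgrPdist_le/(_ 1 ltr01) := fx; apply: filterS => y fy.
  rewrite -[f y](subrK (f x)) addrC (le_trans (ler_normD _ _))// lerD2l.
  by rewrite distrC.
have nn : \forall y \near x, nbhs y (ccod (ch q)) by exact: near_join.
have /nbhs_ballP[d /= d0 Hd] : \forall y \near x, [/\ nbhs y (ccod (ch q)), `|f y| <= `|f x| + 1
    & ccod (ch q) y -> P (cinv (ch q) y)] by apply: filterS3 nn nf nP.
have r0 : 0 < d / 2 by rewrite divr_gt0.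
have B0 : 0 < `|f x| + 1 by rewrite ltr_wpDl.
have bnd y : `|y - x| <= d / 2 -> ball x d y.
  by move=> yx; rewrite -ball_normE/= distrC; lra.
have [||y [y0 ylip yball yder]] := @peano R n f x (d / 2) (`|f x| + 1) r0 B0.
- by move=> y /bnd/Hd[ny _ _]; exact: f_cont.
- by move=> y /bnd/Hd[].
set T := d / 2 / (`|f x| + 1) in ylip yball yder.
have T0 : 0 < T by rewrite divr_gt0.
have good t : 0 <= t -> t <= T -> nbhs (y t) (ccod (ch q)) /\ P (cinv (ch q) (y t)).
  by move=> t0 tT; have [ny _ Py] := Hd _ (bnd _ (yball t t0 tT)); split => //; apply: Py; exact: nbhs_singleton.
exists T, (cinv (ch q) \o y); split => //=; first by rewrite y0.
  apply/subspace_continuousP => t /=; rewrite in_itv/= => /andP[t0 tT] O HO.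
  have [ny _] := good t t0 tT.
  have /nbhs_ballP[e /= e0 He] := chart_nbhs (nbhs_singleton ny) HO.
  apply/nbhs_ballP; exists (e / (`|f x| + 1)) => /=; first by rewrite divr_gt0.
  move=> s; rewrite -ball_normE /= => st; rewrite in_itv/= => /andP[s0 sT].
  apply: He; last by exact: nbhs_singleton (good s s0 sT).1.
  rewrite ltr_pdivlMr// in st; rewrite -ball_normE/=.
  have [ts|st'] := leP t s.
    rewrite distrC (le_lt_trans (ylip t s t0 ts sT))//.
    by rewrite -[s - t]ger0_norm ?subr_ge0// distrC.
  rewrite (le_lt_trans (ylip s t s0 (ltW st') tT))//.
  by rewrite -[X in X * _]ger0_norm ?subr_ge0 ?ltW// ltW.
move=> t /andP[t0 tT]; have [ny Py] := good t (ltW t0) (ltW tT); split => //.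
have near_t : \forall s \near t, 0 < s < T by apply: near_oo; rewrite t0.
have yt := nbhs_singleton ny.
rewrite /has_velocity /=.
have dv : is_derive (t : R^o) (1 : R^o) (cmap (ch q) \o (cinv (ch q) \o y)) (f (y t)).
  apply: (@near_eq_is_derive _ R^o _ y); last exact: yder.
  apply: filterS near_t => s /andP[s0 sT] /=; rewrite cinvK//.
  by apply: nbhs_singleton; apply: (good s _ _).1; exact: ltW.
have qt : \forall s \near t, cdom (ch q) ((cinv (ch q) \o y) s).
  apply: filterS near_t => s /andP[s0 sT] /=; apply: cinv_dom.
  by apply: nbhs_singleton; apply: (good s _ _).1; exact: ltW.
have pt := chart_at_dom A (cinv (ch q) (y t)).
have := is_derive_change qt pt dv.
by rewrite /f /= tchangeK//; exact: cinv_dom.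
Qed.

Lemma switch_cvg q (x : 'rV[R]_n) : ccod (ch q) x ->
  h (cinv (ch q) y) @[y --> within (ccod (ch q)) (nbhs x)] --> h (cinv (ch q) x).
Proof. by move=> qx; exact: Ck_at_cvg qx (switch_Ck F qx). Qed.

Lemma orbit_at_regular q (x : 'rV[R]_n) : nbhs x (ccod (ch q)) ->
  h (cinv (ch q) x) != 0 ->
  exists (T : R) (gamma : R -> M), [/\ 0 < T, gamma 0 = cinv (ch q) x
    & filippov_orbit g F `[0, T] gamma].
Proof.
move=> nx hx; have qx := nbhs_singleton nx.
have orb (T : R) (gamma : R -> M) : 0 < T -> {within `[0, T], continuous gamma} ->
    smooth_piece g F `]0, T[ gamma -> filippov_orbit g F `[0, T] gamma.
  move=> T0 cg p; split => //; first exact: is_interval_itv.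
    by exists 0, T; rewrite /= !in_itv/= !lexx ltW.
  exists set0; split.
  - by move=> ?.
  - by move=> a b _ _; rewrite set0I; exact: finite_set0.
  - move=> a b; rewrite /= !in_itv/= => a0T b0T _ _; apply: smooth_pieceS p.
    by move=> s; rewrite /= !in_itv/=; lra.
  - by move=> a t b _ _ _; rewrite set0I => E; have : set0 t by rewrite E.
case: (ltgtP (h (cinv (ch q) x)) 0) hx => // hx _.
- have nP : \forall y \near x, ccod (ch q) y -> Mminus F (cinv (ch q) y).
    exact: (cvgr_lt _ (switch_cvg qx) 0 hx).
  have [T [gamma [T0 g0 cg H]]] := integral_curve nx (Fminus_Ck F) nP.
  exists T, gamma; split => //; apply: orb => //; apply: Or32 => t.
  by rewrite /= in_itv/= => /H.
- have nP : \forall y \near x, ccod (ch q) y -> Mplus F (cinv (ch q) y).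
    exact: (cvgr_gt _ (switch_cvg qx) 0 hx).
  have [T [gamma [T0 g0 cg H]]] := integral_curve nx (Fplus_Ck F) nP.
  exists T, gamma; split => //; apply: orb => //; apply: Or31 => t.
  by rewrite /= in_itv/= => /H.
Qed.

(** The diagonal direction makes the constrained coordinate strictly positive, so it leads from a
    boundary point into the interior. *)
Lemma model_open_interior (C : set 'rV[R]_n) x : model_open C -> C x ->
  \forall t \near (0 : R), 0 < t -> nbhs (t *: (const_mx 1) + x) C.
Proof.
move=> mC Cx; have cv := @cvg_line R _ (const_mx 1) x.
case: mC => [Co|[U Uo CE]].
  have : \forall t \near (0 : R), C (t *: (const_mx 1) + x).
    by apply: cv; exact: open_nbhs_nbhs.
  by apply: filterS => t Ct _; exact: open_nbhs_nbhs.
have Ux : U x by move: Cx; rewrite CE => -[].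
have : \forall t \near (0 : R), U (t *: (const_mx 1) + x).
  by apply: cv; exact: open_nbhs_nbhs.
apply: filterS => t Ut t0; rewrite CE.
have nU : nbhs (t *: const_mx 1 + x) U by exact: open_nbhs_nbhs.
apply: filterI nU _.
have : nbhs (t *: const_mx 1 + x) [set y : 'rV[R]_n | forall i : 'I_n, i = 0%N :> nat -> 0 < y 0 i].
  suff HI (i : 'I_n) : \forall y \near (t *: const_mx 1 + x), i = 0%N :> nat -> 0 < (y : 'rV[R]_n) 0 i.
    exact: (@filter_forall _ _ (fun (i : 'I_n) (y : 'rV[R]_n) => i = 0%N :> nat -> 0 < y 0 i) (nbhs (t *: const_mx 1 + x)) _ HI).
  have [i0|i0] := eqVneq (i : nat) 0%N; last by apply: (@filterE _ (nbhs (t *: const_mx 1 + x))) => y yi; move: i0; rewrite yi.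
  have cc : y 0 i @[y --> t *: const_mx 1 + x] --> (t *: const_mx 1 + x) 0 i.
    exact: coord_continuous.
  have xi : 0 < (t *: const_mx 1 + x) 0 i.
    rewrite !mxE mulr1 ltr_pwDl//; move: Cx; rewrite CE => -[_]; exact.
  have : nbhs (t *: const_mx 1 + x) [set y : 'rV[R]_n | 0 < y 0 i] by exact: (cvgr_gt _ cc 0 xi).
  by apply: filterS => y yi _.
by apply: filterS => y yi i /yi/ltW.
Qed.

(** Otherwise [h] would vanish identically near [p]; then [p] itself would lie on the switching
    manifold and have zero differential, against regularity of the value 0. *)
Lemma near_regular p (P : M -> Prop) : (\forall z \near p, P z) ->
  exists x, [/\ nbhs x (ccod (ch p)), h (cinv (ch p) x) != 0 & P (cinv (ch p) x)].
Proof.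
move=> nP; have pp := chart_at_dom A p; have cp := cmap_cod pp.
set x0 := cmap (ch p) p in cp.
have nP' : \forall y \near x0, ccod (ch p) y -> P (cinv (ch p) y).
  by apply: chart_nbhs => //; rewrite cmapK.
apply: contrapT => NE.
have : nbhs x0 [set y | ccod (ch p) y -> P (cinv (ch p) y)] by exact: nP'.
rewrite nbhsE => -[U [Uo Ux0] UP].
(* Boundary points included: a nonzero value of [h] at [y] would persist at an interior point
   reached along the diagonal. *)
have h0 y : U y -> ccod (ch p) y -> h (cinv (ch p) y) = 0.
  move=> Uy cy; apply: contrapT => /eqP hy.
  have ny : \forall z \near y, ccod (ch p) z -> h (cinv (ch p) z) != 0.
    have := switch_cvg cy => cvh.
    case: (ltgtP (h (cinv (ch p) y)) 0) hy => // hy _.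
      have H : \forall z \near y, ccod (ch p) z -> h (cinv (ch p) z) < 0 by exact: (cvgr_lt _ cvh 0 hy).
      by apply: filterS H => z H /H Hz; rewrite lt_eqF.
    have H : \forall z \near y, ccod (ch p) z -> 0 < h (cinv (ch p) z) by exact: (cvgr_gt _ cvh 0 hy).
    by apply: filterS H => z H /H Hz; rewrite gt_eqF.
  have nU : nbhs y U by exact: open_nbhs_nbhs.
  have cv := @cvg_line R _ (const_mx 1) y.
  have n1 : \forall t \near (0 : R), U (t *: const_mx 1 + y) by exact: cv nU.
  have n2 : \forall t \near (0 : R), ccod (ch p) (t *: const_mx 1 + y) -> h (cinv (ch p) (t *: const_mx 1 + y)) != 0.
    exact: cv ny.
  have n3 := model_open_interior (@ccod_open _ _ _ (ch p)) cy.
  have /nbhs_ballP[d /= d0 Hd] : \forall t \near (0 : R),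
    [/\ U (t *: const_mx 1 + y), ccod (ch p) (t *: const_mx 1 + y) -> h (cinv (ch p) (t *: const_mx 1 + y)) != 0
      & 0 < t -> nbhs (t *: const_mx 1 + y) (ccod (ch p))] by apply: filterS3 n1 n2 n3.
  have [|Ut ht nt] := Hd (d / 2).
    by rewrite -ball_normE /= sub0r normrN gtr0_norm ?divr_gt0//; lra.
  have {}nt : nbhs (d / 2 *: const_mx 1 + y) (ccod (ch p)) by apply: nt; rewrite divr_gt0.
  have ct := nbhs_singleton nt.
  by apply: NE; exists (d / 2 *: const_mx 1 + y); split; [|exact: ht|exact: UP].
have hp : h p = 0 by rewrite -(cmapK pp); exact: h0.
have [v] := switch_regular hp.
rewrite /mdiff (@diff_withinE _ _ _ _ _ (cst 0 : _ -> R^o)).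
- by rewrite diff_cst eqxx.
- exact: ccod_open.
- exact: cp.
- exact: differentiable_cst.
- have nU : nbhs x0 U by exact: open_nbhs_nbhs.
  by apply: filterS nU => y Uy cy /=; rewrite h0.
Qed.

Lemma orbit_near p (e : R) : 0 < e -> exists (T : R) (gamma : R -> M),
  [/\ 0 < T, (rdist g p (gamma 0%R) <= e%:E)%E & filippov_orbit g F `[0, T] gamma].
Proof.
move=> e0; have [x [nx hx [px _]]] := near_regular (rdist_near g p e0).
have [T [gamma [T0 g0 og]]] := orbit_at_regular nx hx.
by exists T, gamma; split => //; rewrite g0.
Qed.

(** Any two times of the union already lie in one member of the chain, so [filippov_orbit_compact]
    applies. It serves both Zorn's lemma and the infinite gluing. *)
Lemma filippov_orbit_chain (C : set (set R * (R -> M))) :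
  C !=set0 -> (forall s, C s -> filippov_orbit g F s.1 s.2) ->
  (forall s t, C s -> C t ->
     (s.1 `<=` t.1 /\ forall r, s.1 r -> t.2 r = s.2 r) \/
     (t.1 `<=` s.1 /\ forall r, t.1 r -> s.2 r = t.2 r)) ->
  exists gamma, filippov_orbit g F (\bigcup_(s in C) s.1) gamma /\
    forall s, C s -> forall r, s.1 r -> gamma r = s.2 r.
Proof.
move=> [s0 Cs0] Corb Ctot.
have [gamma Hg] : exists gamma : R -> M, forall r s, C s -> s.1 r -> gamma r = s.2 r.
  have : forall r, exists z, forall s, C s -> s.1 r -> z = s.2 r.
    move=> r; have [[s [Cs sr]]|N] := pselect (exists s, C s /\ s.1 r); last first.
      by exists (s0.2 r) => s Cs sr; exfalso; apply: N; exists s.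
    exists (s.2 r) => t Ct tr; have [[_ E]|[_ E]] := Ctot s t Cs Ct.
      by rewrite E.
    by rewrite E.
  by move=> /choice[gamma Hg]; exists gamma.
exists gamma; split; last by move=> s Cs r; exact: Hg.
have both a b : (\bigcup_(s in C) s.1) a -> (\bigcup_(s in C) s.1) b ->
    exists s, [/\ C s, s.1 a & s.1 b].
  move=> [s Cs sa] [t Ct tb]; have [[st _]|[ts _]] := Ctot s t Cs Ct.
    by exists t; split => //; exact: st.
  by exists s; split => //; exact: ts.
apply: filippov_orbit_compact.
- move=> a b Ha Hb r rab; have [s [Cs sa sb]] := both a b Ha Hb.
  by exists s => //; have [iI _ _ _] := Corb s Cs; exact: iI sa sb _ rab.
- have [_ [a [b [sa sb ab]]] _ _] := Corb s0 Cs0.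
  by exists a, b; split => //; exists s0.
- move=> a b Ha Hb ab; have [s [Cs sa sb]] := both a b Ha Hb.
  have os := Corb s Cs; have [iI _ _ _] := os.
  apply: (filippov_orbit_ext _ (filippov_orbit_itv os sa sb ab)) => r.
  by rewrite /= in_itv/= => rab; rewrite (Hg r s Cs)//; exact: iI sa sb _ rab.
Qed.

(** Pairs of a domain and a curve are only preordered by extension, since curves may differ outside
    their domains. A maximal element in this sense has a domain that cannot grow, as [maximal_orbit]
    asks. *)
Lemma maximal_orbit_extension I gamma : filippov_orbit g F I gamma ->
  exists J gamma', [/\ maximal_orbit g F J gamma', I `<=` J
    & forall t, I t -> gamma' t = gamma t].
Proof.
move=> oI.
pose ext (s t : set R * (R -> M)) := s.1 `<=` t.1 /\ forall r, s.1 r -> t.2 r = s.2 r.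
have ext_trans s t u : ext s t -> ext t u -> ext s u.
  move=> [st E1] [tu E2]; split; first exact: subset_trans tu.
  by move=> r sr; rewrite E2 ?E1//; exact: st.
pose T := {s : set R * (R -> M) | filippov_orbit g F s.1 s.2 /\ ext (I, gamma) s}.
have t0 : T by exists (I, gamma); split => //; split.
pose rel (s t : T) := `[< ext (sval s) (sval t) >].
have [||C Ctot|t Ht] := @ZL_preorder T t0 rel.
- by move=> s; apply/asboolP; split.
- by move=> s t u /asboolP h1 /asboolP h2; apply/asboolP; exact: ext_trans h1 h2.
- have [[s Cs]|C0] := pselect (C !=set0); last first.
    by exists t0 => s Cs; exfalso; apply: C0; exists s.
  have [||| gam [ogam Hgam]] := @filippov_orbit_chain (sval @` C).
  + by exists (sval s); exists s.
  + by move=> _ [u Cu <-]; exact: (svalP u).1.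
  + move=> _ _ [u Cu <-] [v Cv <-].
    by case: (Ctot u v Cu Cv) => /asboolP ?; [left|right].
  have extI : ext (I, gamma) (\bigcup_(s in sval @` C) s.1, gam).
    apply: (ext_trans _ (sval s)); first exact: (svalP s).2.
    split => r sr; first by exists (sval s) => //; exists s.
    by apply: Hgam => //; exists s.
  exists (exist _ (\bigcup_(s in sval @` C) s.1, gam) (conj ogam extI)) => u Cu.
  apply/asboolP; split => r ur /=; first by exists (sval u) => //; exists u.
  by apply: Hgam => //; exists u.
exists (sval t).1, (sval t).2; have [ot [It Et]] := svalP t; split => //.
split => // J gamma' oJ tJ EJ.
apply/seteqP; split => //.
have extJ : ext (I, gamma) (J, gamma') by apply: (ext_trans _ (sval t)).
have := Ht (exist _ (J, gamma') (conj oJ extJ)).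
by rewrite /rel => /(_ (asboolT (conj tJ EJ)))/asboolP[].
Qed.

End Existence.

(** * Velocity bounds and the Lipschitz property of orbits *)

Section SpeedBound.
Context {R : realType} {n : nat} {M : topologicalType} {A : manifold R n M}.
Variables (g : riemannian A) (F : filippov A).
Local Notation ch := (chart_at A).
Local Notation h := (switch F).
Variable K : R.
Hypothesis FK : forall p v, Fval F p v -> tnorm g p v <= K.

Lemma tnorm_Fplus p : 0 < h p -> tnorm g p (Fplus F p) <= K.
Proof.
move=> hp; apply: FK; exists 1; first by split => //; [move=> hn; lra|lra].
by apply/rowP => i; rewrite !mxE; field.
Qed.

Lemma tnorm_Fminus p : h p < 0 -> tnorm g p (Fminus F p) <= K.
Proof.
move=> hp; apply: FK; exists (-1); first by split => //; [move=> hn; lra|lra].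
by apply/rowP => i; rewrite !mxE; field.
Qed.

Lemma tnorm_sliding p : Sigma_s g F p -> tnorm g p (sliding g F p) <= K.
Proof.
move=> [hp0]; rewrite /sliding; set a := Fplus_h g F p; set b := Fminus_h g F p => ab.
have ba0 : b - a != 0.
  apply/negP; rewrite subr_eq0 => /eqP E; move: ab; rewrite E.
  by rewrite ltNge -expr2 sqr_ge0.
(* The sliding vector is the convex combination of the two fields with weights [b / (b - a)] and
   [- a / (b - a)]; solving [(1 + s) / 2 = b / (b - a)] gives this [s], which lies in [[-1, 1]]
   because [a] and [b] have opposite signs. *)
apply: FK; exists ((b - a)^-1 * (b + a)).
  split; rewrite ?hp0 ?ltxx//.
  have [a0|a0] := ltP a 0.
    have b0 : 0 < b by rewrite -(nmulr_rlt0 _ a0).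
    have ba : 0 < b - a by lra.
    by rewrite ler_pdivlMl// ler_pdivrMl//; apply/andP; split; lra.
  have {}a0 : 0 < a.
    by rewrite lt_neqAle a0 andbT; apply: contraTneq ab => <-; rewrite mul0r ltxx.
  have b0 : b < 0 by rewrite -(pmulr_rlt0 _ a0).
  have ba : 0 < a - b by lra.
  have -> : (b - a)^-1 * (b + a) = (a - b)^-1 * (- (b + a)).
    by rewrite -opprB invrN mulNr mulrN.
  by rewrite ler_pdivlMl// ler_pdivrMl//; apply/andP; split; lra.
by apply/rowP => i; rewrite !mxE; field.
Qed.

(** At a tangency point [v] is a limit of sliding vectors: a norm above [K] would persist, in the
    chart at [p], at points of [Sigma_s] nearby, and the closure condition provides such points. *)
Lemma tnorm_sliding_value p v : sliding_value g F p v -> tnorm g p v <= K.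
Proof.
case=> [[Sp ->]|[Tp clS cv]]; first exact: tnorm_sliding.
have pp := chart_at_dom A p.
have <- : gnorm g p (cmap (ch p) p) v = tnorm g p v.
  by rewrite gnorm_cmap// tchange_id.
rewrite leNgt; apply/negP => Kv.
have np : \forall q \near p, cdom (ch p) q.
  by apply: open_nbhs_nbhs; split => //; exact: cdom_open.
have cx : cmap (ch p) q @[q --> within (Sigma_s g F) (nbhs p)] --> cmap (ch p) p.
  by apply: cvg_trans (cmap_cvg pp); apply: cvg_app; exact: cvg_within.
have nc : \forall q \near within (Sigma_s g F) (nbhs p), ccod (ch p) (cmap (ch p) q).
  by apply: cvg_within; apply: filterS np => q; exact: cmap_cod.
have H : gnorm g p (cmap (ch p) q) (tchange (ch q) (ch p) q (sliding g F q))
    @[q --> within (Sigma_s g F) (nbhs p)] --> gnorm g p (cmap (ch p) p) v.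
  by apply: gnorm_cvg => //; exact: cmap_cod.
have n1 : \forall q \near p, Sigma_s g F q ->
    K < gnorm g p (cmap (ch p) q) (tchange (ch q) (ch p) q (sliding g F q)).
  exact: (cvgr_gt _ H K Kv).
have [q [Sq [/(_ Sq) + pq]]] := clS _ (filterI n1 np).
rewrite gnorm_cmap// tchangeK//; last exact: chart_at_dom.
by rewrite ltNge tnorm_sliding.
Qed.

Lemma smooth_piece_velocity J gamma t : smooth_piece g F J gamma -> J t ->
  exists2 v, has_velocity A gamma t v & tnorm g (gamma t) v <= K.
Proof.
case=> H Jt.
- by have [h1 h2] := H t Jt; eexists; [exact: h2|exact: tnorm_Fplus].
- by have [h1 h2] := H t Jt; eexists; [exact: h2|exact: tnorm_Fminus].
- by have [v h1 h2] := H t Jt; exists v => //; exact: tnorm_sliding_value.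
Qed.

(** The strict [K < C] is what [rdist_curve] needs inside a smooth piece. Every time has a piece on
    each side, closed up by continuity, and the local bounds add up across the gluing times. *)
Lemma orbit_lipschitz I gamma (C : R) : K < C -> 0 <= C -> filippov_orbit g F I gamma ->
  forall s t, I s -> I t -> s <= t ->
  (rdist g (gamma s) (gamma t) <= (C * (t - s))%:E)%E /\
  (rdist g (gamma t) (gamma s) <= (C * (t - s))%:E)%E.
Proof.
move=> KC C0 oI s t Is It st.
have [->|st'] := eqVneq s t; first by rewrite subrr mulr0 rdist_refl.
have {}st' : s < t by rewrite lt_neqAle st'.
have /filippov_orbitP[_ _ cI H] := filippov_orbit_itv oI Is It st'.
have piece (c d : R) : s <= c -> d <= t -> smooth_piece g F `]c, d[ gamma ->
    forall x y, c <= x -> x <= y -> y <= d ->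
    (rdist g (gamma x) (gamma y) <= (C * (y - x))%:E)%E /\
    (rdist g (gamma y) (gamma x) <= (C * (y - x))%:E)%E.
  move=> sc dt p; apply: rdist_lipschitz_oo => //.
    apply: continuous_subspaceW cI => z; rewrite /= !in_itv/=; lra.
  move=> z zcd; have [|v hv vK] := smooth_piece_velocity p (t := z).
    by rewrite /= in_itv.
  apply: rdist_curve hv (le_lt_trans vK KC).
  apply: within_itv_continuous cI _; lra.
apply: rdist_lipschitz st _ => x /andP[sx xt].
have xI : `[s, t]%classic x by rewrite /= in_itv/= sx.
have [h1 h2 _] := H x xI.
have [d1 d10 Hd1] : exists2 d : R, 0 < d & forall y, x <= y -> y <= t -> y < x + d ->
    (rdist g (gamma x) (gamma y) <= (C * (y - x))%:E)%E /\
    (rdist g (gamma y) (gamma x) <= (C * (y - x))%:E)%E.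
  have [xt'|xt'] := ltP x t; last first.
    by exists 1 => // y xy yt _; have -> : y = x by [lra]; rewrite subrr mulr0 rdist_refl.
  have [||c [xc ct p]] := h1 t; [by rewrite /= in_itv/= ltW//=|by []|].
  exists (c - x); first by rewrite subr_gt0.
  by move=> y xy yt yc; apply: (piece _ _ sx ct p) => //; lra.
have [d2 d20 Hd2] : exists2 d : R, 0 < d & forall y, y <= x -> s <= y -> x - d < y ->
    (rdist g (gamma y) (gamma x) <= (C * (x - y))%:E)%E /\
    (rdist g (gamma x) (gamma y) <= (C * (x - y))%:E)%E.
  have [xt'|xt'] := ltP s x; last first.
    by exists 1 => // y xy yt _; have -> : y = x by [lra]; rewrite subrr mulr0 rdist_refl.
  have [||c [sc cx p]] := h2 s; [by rewrite /= in_itv/= lexx ltW|by []|].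
  exists (x - c); first by rewrite subr_gt0.
  by move=> y xy yt yc; apply: (piece _ _ sc xt p) => //; lra.
exists (Num.min d1 d2); first by rewrite lt_min d10.
move=> y /andP[sy yt]; rewrite lt_min => /andP[].
have [xy|yx] := leP x y.
  rewrite ger0_norm ?subr_ge0// => h _; apply: Hd1 => //; lra.
rewrite distrC ger0_norm; last by rewrite subr_ge0 ltW.
by move=> _ h3; have [] := Hd2 y (ltW yx) sy _; [lra|].
Qed.

End SpeedBound.

(** * The orbit space *)

Section GeometricSums.
Context {R : realType}.
Local Open Scope ereal_scope.

(** [e] enumerates the indices that matter, and 4 is the sum of the geometric series of ratio
    [3 / 4]. This ratio, larger than that of the weights, leaves room for linear growth. *)
Lemma esum_geometric_le (a : int -> \bar R) (e : nat -> int) (B : R) :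
  injective e -> (0 <= B)%R -> (forall i, 0 <= a i) ->
  (forall i, ~ range e i -> a i = 0) ->
  (forall j, a (e j) <= (B * (3 / 4) ^+ j)%:E) ->
  \esum_(i in [set: int]) a i <= (4 * B)%:E.
Proof.
move=> einj B0 a0 aout ain.
have -> : \esum_(i in [set: int]) a i = \esum_(i in range e) a i.
  rewrite [RHS]esum_mkcond; apply: eq_esum => i _; case: ifPn => // /negP H.
  by apply: aout => ei; apply: H; rewrite inE.
rewrite (@reindex_esum _ _ _ [set: nat] (range e) e); last first.
  by split => // x y _ _ /einj.
rewrite -nneseries_esumT//.
apply: lime_le; first by apply: is_cvg_nneseries.
apply: nearW => k /=.
apply: (@le_trans _ _ (\sum_(0 <= j < k) (B * (3 / 4) ^+ j)%:E)).
  by apply: lee_sum => j _; exact: ain.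
rewrite sumEFin lee_fin.
suff -> : (\sum_(0 <= j < k) B * (3 / 4) ^+ j = 4 * B * (1 - (3 / 4) ^+ k))%R.
  rewrite -[leRHS]mulr1 ler_wpM2l ?mulr_ge0// gerBl exprn_ge0//; lra.
elim: k => [|k IH]; first by rewrite big_geq// expr0 subrr mulr0.
by rewrite big_nat_recr//= IH exprS; lra.
Qed.

(** Linear growth is dominated by [2 * (3 / 2) ^+ j], and [3 / 2] times one half is [3 / 4]. *)
Lemma half_exp_le (j : nat) : ((j.+1)%:R * 2^-1 ^+ j <= 2 * (3 / 4) ^+ j :> R)%R.
Proof.
have H : ((j.+1)%:R <= 2 * (3 / 2) ^+ j :> R)%R.
  elim: j => [|j IH]; first by rewrite expr0; lra.
  rewrite exprS -natr1.
  have : (1 <= (3 / 2) ^+ j :> R)%R by rewrite exprn_ege1//; lra.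
  lra.
have -> : (3 / 4 = (3 / 2) * 2^-1 :> R)%R by field.
by rewrite exprMn mulrA ler_wpM2r// exprn_ge0.
Qed.

End GeometricSums.

(** * Upper and lower bounds for the orbit distance *)

Section OrbitDistance.
Context {R : realType} {n : nat} {M : topologicalType} {A : manifold R n M}.
Variable g : riemannian A.
Local Notation mu := (@lebesgue_measure R).
Implicit Types (gamma : R -> M).

Let term gamma0 gamma1 (i : int) : \bar R :=
  ((2^-1 ^+ `|i|%N)%:E * \int[mu]_(t in `[i%:~R, (i%:~R + 1)%R]) rdist g (gamma0 t) (gamma1 t))%E.

Let term_ge0 gamma0 gamma1 i : (0 <= term gamma0 gamma1 i)%E.
Proof.
rewrite mule_ge0 ?lee_fin ?exprn_ge0//; apply: integral_ge0 => t _; exact: rdist_ge0.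
Qed.

Let term_le gamma0 gamma1 (i : int) (c : R) : 
  (forall t : R, i%:~R <= t <= i%:~R + 1 -> (rdist g (gamma0 t) (gamma1 t) <= c%:E)%E) ->
  (term gamma0 gamma1 i <= (2^-1 ^+ `|i|%N * c)%:E)%E.
Proof.
move=> H; rewrite EFinM lee_wpmul2l// ?lee_fin ?exprn_ge0//.
pose J : set R := `[i%:~R, i%:~R + 1]%classic.
apply: (@le_trans _ _ (c%:E * mu J)%E).
  apply: integral_le_cst; first exact: measurable_itv.
    by move=> t _; exact: rdist_ge0.
  by move=> t; rewrite /= in_itv/=; exact: H.
by rewrite /J lebesgue_measure_itv/= lte_fin ltrDl ltr01 -EFinD addrC addKr mule1.
Qed.

Lemma orbit_dist_right gamma0 gamma1 (N : nat) (C : R) : 0 <= C ->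
  (forall t, t <= N%:R -> gamma0 t = gamma1 t) ->
  (forall t, N%:R <= t -> (rdist g (gamma0 t) (gamma1 t) <= (C * (t - N%:R))%:E)%E) ->
  (orbit_dist g gamma0 gamma1 <= (8 * C * 2^-1 ^+ N)%:E)%E.
Proof.
move=> C0 E1 E2.
have -> : 8 * C * 2^-1 ^+ N = 4 * (2 * C * 2^-1 ^+ N) :> R by ring.
(* On the unit interval starting at [N + j] the curves are at most [C * (j + 1)] apart, and earlier
   intervals contribute nothing. The 8 is the 2 of [half_exp_le] times the 4 of the series. *)
apply: (@esum_geometric_le _ (term gamma0 gamma1) (fun j => (N + j)%N%:Z)) => //.
- by move=> i j [] /addnI.
- by rewrite !mulr_ge0// exprn_ge0.
- move=> i Ni; apply/eqP; rewrite eq_le term_ge0 andbT.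
  have iN : (i < N%:Z)%R.
    rewrite ltNge; apply/negP => Ni'; apply: Ni; exists (`|i - N%:Z|)%N => //; lia.
  rewrite -[leRHS]/(0%:E) -(mulr0 (2^-1 ^+ `|i|%N)); apply: term_le => t tI.
  have iN1 : (i + 1 <= N%:Z)%R by lia.
  have {}iN1 : (i%:~R + 1 <= N%:R :> R) by rewrite -[1]/(1%:~R) -intrD -[N%:R]/(N%:Z%:~R) ler_int.
  by rewrite E1 ?rdist_refl//; lra.
- move=> j; apply: (@le_trans _ _ (2^-1 ^+ (N + j) * (C * j.+1%:R))%:E).
    apply: (@term_le _ _ (N + j)%N%:Z) => t; rewrite -pmulrn natrD => tI.
    have tN : N%:R <= t by have : 0 <= j%:R :> R by []; lra.
    apply: (le_trans (E2 t tN)); rewrite lee_fin ler_wpM2l// -natr1; lra.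
  rewrite lee_fin exprD.
  have := half_exp_le (R := R) j.
  have p0 : 0 <= C * 2^-1 ^+ N :> R by rewrite mulr_ge0 ?exprn_ge0.
  move=> /(ler_wpM2l p0) H; apply: le_trans (le_trans _ H) _; rewrite le_eqVlt; apply/orP; left; apply/eqP; ring.
Qed.

Lemma orbit_dist_left gamma0 gamma1 (N : nat) (C : R) : 0 <= C ->
  (forall t, - N%:R <= t -> gamma0 t = gamma1 t) ->
  (forall t, t <= - N%:R -> (rdist g (gamma0 t) (gamma1 t) <= (C * (- N%:R - t))%:E)%E) ->
  (orbit_dist g gamma0 gamma1 <= (8 * C * 2^-1 ^+ N)%:E)%E.
Proof.
move=> C0 E1 E2.
have -> : 8 * C * 2^-1 ^+ N = 4 * (2 * C * 2^-1 ^+ N) :> R by ring.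
(* A unit interval is indexed by its left end, so the first one before [- N] has index [- (N + 1)];
   the extra factor one half in the weight is given away. *)
apply: (@esum_geometric_le _ (term gamma0 gamma1) (fun j => - (N + j).+1%:Z)) => //.
- by move=> i j; lia.
- by rewrite !mulr_ge0// exprn_ge0.
- move=> i Ni; apply/eqP; rewrite eq_le term_ge0 andbT.
  have iN : (- N%:Z <= i)%R.
    rewrite leNgt; apply/negP => Ni'; apply: Ni; exists (absz (- N%:Z - i - 1)%R) => //; lia.
  rewrite -[leRHS]/(0%:E) -(mulr0 (2^-1 ^+ `|i|%N)); apply: term_le => t tI.
  have {}iN1 : (- N%:R <= i%:~R :> R) by rewrite -[N%:R]/(N%:Z%:~R) -mulrNz ler_int.
  by rewrite E1 ?rdist_refl//; lra.
- move=> j; apply: (@le_trans _ _ (2^-1 ^+ (N + j).+1 * (C * j.+1%:R))%:E).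
    have := @term_le gamma0 gamma1 (- (N + j).+1%:Z) (C * j.+1%:R).
    rewrite abszN absz_nat; apply => t; rewrite mulrNz -pmulrn -(natr1 (N + j)) natrD => tI.
    have tN : t <= - N%:R by have : 0 <= j%:R :> R by []; lra.
    apply: (le_trans (E2 t tN)); rewrite lee_fin ler_wpM2l// -natr1; lra.
  rewrite lee_fin exprS exprD.
  have := half_exp_le (R := R) j.
  have p0 : 0 <= C * 2^-1 ^+ N :> R by rewrite mulr_ge0 ?exprn_ge0.
  move=> /(ler_wpM2l p0) H.
  have H0 : 0 <= C * 2^-1 ^+ N * (j.+1%:R * 2^-1 ^+ j) by rewrite !mulr_ge0 ?exprn_ge0.
  have -> : 2^-1 * (2^-1 ^+ N * 2^-1 ^+ j) * (C * j.+1%:R) = 2^-1 * (C * 2^-1 ^+ N * (j.+1%:R * 2^-1 ^+ j)) :> R by ring.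
  have -> : 2 * C * 2^-1 ^+ N * (3 / 4) ^+ j = C * 2^-1 ^+ N * (2 * (3 / 4) ^+ j) :> R by ring.
  by lra.
Qed.

(** The summand of index 0, whose weight is 1, already has this size. *)
Lemma orbit_dist_ge gamma0 gamma1 (d c : R) : 0 <= d <= 1 -> 0 <= c ->
  (forall t, 0 <= t <= d -> (c%:E <= rdist g (gamma0 t) (gamma1 t))%E) ->
  ((c * d)%:E <= orbit_dist g gamma0 gamma1)%E.
Proof.
move=> /andP[d0 d1] c0 H.
apply: (@le_trans _ _ (term gamma0 gamma1 0)).
  rewrite /term absz0 expr0 mul1e mulr0z add0r.
  have <- : (c%:E * mu (`[0%R, d]%classic : set R))%E = (c * d)%:E.
    rewrite lebesgue_measure_itv/= lte_fin; case: ifPn => [_|].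
      by rewrite oppr0 adde0 EFinM.
    by rewrite -leNgt => d0'; have -> : d = 0 by [lra]; rewrite mulr0 mule0.
  have m0d : measurable (`[0, d]%classic : set R) by exact: measurable_itv.
  have m01 : measurable (`[0, 1]%classic : set R) by exact: measurable_itv.
  apply: (integral_ge_cst m01 m0d _ c0).
  - by move=> t; rewrite /= !in_itv/=; lra.
  - by move=> t _; exact: rdist_ge0.
  - by move=> t; rewrite /= in_itv/=; exact: H.
apply: esum_ge; exists [set 0]; first by split => //; exact: finite_set1.
by rewrite fsbig_set1.
Qed.

End OrbitDistance.

(** * Gluing of orbits and the two transitivity statements *)

Section Main.
Context {R : realType} {n : nat} {M : topologicalType} {A : manifold R n M}.
Variables (g : riemannian A) (F : filippov A).
Hypothesis global : forall I gamma, maximal_orbit g F I gamma -> I = [set: R].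
Local Notation orbits := (orbit_space g F).
Implicit Types (I J : set R) (gamma : R -> M) (p q : M).

Lemma orbit_spaceP gamma : orbits gamma <-> filippov_orbit g F [set: R] gamma.
Proof.
split => [[]//|H]; split => // J gamma' _ TJ _.
by apply/seteqP; split.
Qed.

Lemma orbit_space_shift gamma (t : R) : orbits gamma -> orbits (orbit_flow t gamma).
Proof.
move=> /orbit_spaceP H; apply/orbit_spaceP.
have := filippov_orbit_shift t H.
by rewrite (_ : [set s | _] = [set: R])//; apply/seteqP; split.
Qed.

Lemma orbit_space_near p (e : R) : 0 < e ->
  exists2 gamma, orbits gamma & (rdist g p (gamma 0%R) <= e%:E)%E.
Proof.
move=> e0; have [T [gamma [T0 pg og]]] := orbit_near g F p e0.
have [J [gamma' [mJ IJ E]]] := maximal_orbit_extension og.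
exists gamma'; first by move: (mJ); rewrite (global mJ).
by rewrite E//= in_itv/= lexx ltW.
Qed.

Variable C : R.
Hypothesis C0 : 0 < C.
Hypothesis lip : forall gamma, orbits gamma -> forall s t : R, s <= t ->
  (rdist g (gamma s) (gamma t) <= (C * (t - s))%:E)%E /\
  (rdist g (gamma t) (gamma s) <= (C * (t - s))%:E)%E.

Lemma flow_transitive_filippov :
  flow_transitive orbits (orbit_dist g) (@orbit_flow R M) -> filippov_transitive g F.
Proof.
move=> [gamma0 og0 [_ dense]].
exists [set: R], gamma0; split; first exact/orbit_spaceP.
split => // p _ e e0.
have e4 : 0 < e / 4 by rewrite divr_gt0.
have [gamma og pg] := orbit_space_near p e4.
(* In time [d] the orbit [gamma] moves by at most [e / 4]. An orbit distance below [e / 4 * d]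
   forces the two orbits within [e / 4] at some time of [[0, d]]; together with the distance from
   [p] to [gamma 0] the total is [3 * e / 4]. *)
pose d := Num.min 1 (e / (4 * C)).
have d0 : 0 < d by rewrite lt_min ltr01 divr_gt0// mulr_gt0.
have [d1 d2] : d <= 1 /\ d <= e / (4 * C) by rewrite /d !ge_min !lexx orbT.
have [|_ [t _ <-] Ht] := dense gamma og (e / 4 * d); first by rewrite mulr_gt0.
have [s [s01 Hs]] : exists s, 0 <= s <= d /\ (rdist g (gamma s) (orbit_flow t gamma0 s) < (e / 4)%:E)%E.
  apply: contrapT => N; move: Ht; rewrite ltNge => /negP; apply.
  apply: orbit_dist_ge; [lra|exact: ltW|].
  by move=> s sd; rewrite leNgt; apply/negP => H; apply: N; exists s.
exists (gamma0 (t + s)); first by exists (t + s).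
have h1 : (rdist g (gamma 0%R) (gamma s) <= (e / 4)%:E)%E.
  have [+ _] := lip og (t := s) (s := 0) (ltac:(lra)).
  move=> /le_trans; apply; rewrite lee_fin subr0.
  apply: (@le_trans _ _ (C * (e / (4 * C)))); first by rewrite ler_pM2l//; lra.
  by rewrite le_eqVlt; apply/orP; left; apply/eqP; field; rewrite gt_eqF.
apply: (le_lt_trans (rdist_triangle g _ (gamma s) _)).
apply: (@le_lt_trans _ _ ((e / 4 + e / 4) + e / 4)%:E); last by rewrite lte_fin; lra.
rewrite !EFinD; apply: leeD; last exact: ltW Hs.
apply: (le_trans (rdist_triangle g _ (gamma 0) _)); exact: leeD.
Qed.

(** The second orbit is translated so that its time [b] falls on [a]; the two formulas of the
    piecewise curve agree there. *)
Lemma orbit_join I J gamma gamma1 (a b : R) :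
  filippov_orbit g F I gamma -> I a -> (forall t, I t -> t <= a) ->
  filippov_orbit g F J gamma1 -> J b -> (forall t, J t -> b <= t) ->
  gamma a = gamma1 b -> Sigma_t g F (gamma a) ->
  exists gamma', [/\ filippov_orbit g F (I `|` [set t | J (b - a + t)]) gamma',
    forall t, I t -> gamma' t = gamma t &
    forall t, J (b - a + t) -> gamma' t = gamma1 (b - a + t)].
Proof.
move=> oI Ia Iub oJ Jb Jlb ab Ta.
pose gamma' t := if t <= a then gamma t else gamma1 (b - a + t).
have E1 t : I t -> gamma' t = gamma t by move=> /Iub ta; rewrite /gamma' ta.
have E2 t : J (b - a + t) -> gamma' t = gamma1 (b - a + t).
  move=> /Jlb bt; rewrite /gamma'; case: ifPn => // ta.
  by have -> : t = a by [lra]; rewrite subrK.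
exists gamma'; split => //.
apply: (@filippov_orbit_cat _ _ _ _ _ _ _ _ _ a) => //.
- by rewrite /= subrK.
- by move=> t /= /Jlb; lra.
- by rewrite E1.
- by apply: filippov_orbit_ext oI => t /E1.
- by apply: filippov_orbit_ext (filippov_orbit_shift (b - a) oJ) => t /E2.
Qed.

Variable TT : set M.
Hypothesis TTS : TT `<=` Sigma_t g F.
Hypothesis connecting : forall T T', TT T -> TT T' ->
  exists (s : R) (theta : R -> M),
    [/\ 0 <= s, (0 < s -> filippov_orbit g F `[- s, s] theta),
        theta (- s) = T & theta s = T'].
Hypothesis forward : forall gamma, orbits gamma ->
  exists (T : M) (s : R), [/\ TT T, 0 < s & gamma s = T].
Hypothesis backward : forall gamma, orbits gamma ->
  exists (T : M) (s : R), [/\ TT T, s < 0 & gamma s = T].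

(** Translates of orbits are orbits, so visits at positive times yield arbitrarily late visits. *)
Lemma forward_after gamma (N : R) : orbits gamma -> exists2 s, N < s & TT (gamma s).
Proof.
move=> og; have [T [s [TT_T s0 gs]]] := forward (orbit_space_shift N og).
by exists (N + s); [rewrite ltrDl|rewrite -[gamma _]/(orbit_flow N gamma s) gs].
Qed.

Lemma backward_before gamma (N : R) : orbits gamma -> exists2 s, s < N & TT (gamma s).
Proof.
move=> og; have [T [s [TT_T s0 gs]]] := backward (orbit_space_shift N og).
by exists (N + s); [rewrite gtrDl|rewrite -[gamma _]/(orbit_flow N gamma s) gs].
Qed.

Lemma orbit_connect I gamma (a : R) (T : M) :
  filippov_orbit g F I gamma -> I a -> (forall t, I t -> t <= a) ->
  TT (gamma a) -> TT T ->
  exists I' gamma' a', [/\ filippov_orbit g F I' gamma', I `<=` I',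
    I' a' /\ (forall t, I' t -> t <= a'), (forall t, I t -> gamma' t = gamma t) &
    a <= a' /\ gamma' a' = T].
Proof.
move=> oI Ia Iub Ta TT_T.
have [s [theta [s0 otheta th1 th2]]] := connecting Ta TT_T.
(* For [s = 0] there is no nondegenerate segment to glue: the two tangency points coincide.
   Otherwise the segment adds a duration [s + s]. *)
have [s00|sn0] := eqVneq s 0.
  exists I, gamma, a; split => //; split => //.
  by rewrite -th2 -th1 s00 oppr0.
have {}s0 : 0 < s by rewrite lt_neqAle eq_sym sn0.
have [||| |gamma' [og' E1 E2]] := orbit_join oI Ia Iub (otheta s0) (b := - s).
- by rewrite /= in_itv/=; lra.
- by move=> t; rewrite /= in_itv/= => /andP[].
- by [].
- exact: TTS.
exists (I `|` [set t | `[- s, s]%classic (- s - a + t)]), gamma', (a + (s + s)); split => //.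
- split; first by right; rewrite /= in_itv/=; lra.
  by move=> t [/Iub|/=]; rewrite ?in_itv/=; lra.
- split; first by lra.
  rewrite E2; last by rewrite /= in_itv/=; lra.
  by have -> : - s - a + (a + (s + s)) = s by ring.
Qed.

Lemma orbit_space_topologically_transitive :
  topologically_transitive orbits (orbit_dist g) (@orbit_flow R M).
Proof.
move=> U V [UX Uo] [VX Vo] [gamma0 U0] [gamma1 V1].
have [e0 e00 He0] := Uo _ U0; have [e1 e10 He1] := Vo _ V1.
have og0 := UX _ U0; have og1 := VX _ V1.
pose e := Num.min e0 e1.
have e_gt0 : 0 < e by rewrite lt_min e00.
(* Two orbits that agree at one time separate at rate at most [2 * C], each moving at rate at most
   [C]; this is the constant passed to [orbit_dist_right] and [orbit_dist_left]. *)
have [N HN] : exists N : nat, 8 * (2 * C) * 2^-1 ^+ N < e.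
  have K0 : 0 < 8 * (2 * C) by rewrite !mulr_gt0.
  have /cvgrPdist_lt/(_ (e / (8 * (2 * C)))) : (2^-1 : R) ^+ k @[k --> \oo] --> (0 : R).
    by apply: cvg_expr; rewrite ger0_norm ?invr_ge0// invf_lt1// ltr1n.
  rewrite divr_gt0// => /(_ isT)[N _ HN]; exists N.
  have := HN N (leqnn N); rewrite sub0r normrN ger0_norm ?exprn_ge0//.
  by rewrite ltr_pdivlMr// mulrC.
have [a Na TTa] := forward_after N%:R og0.
have [b bN TTb] := backward_before (- N%:R) og1.
have oL : filippov_orbit g F `]-oo, a]%classic gamma0.
  apply: filippov_orbitS ((orbit_spaceP _).1 og0) => //; first exact: is_interval_itv.
  by exists (a - 1), a; rewrite /= !in_itv/= lexx; split => //; lra.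
have oR : filippov_orbit g F `[b, +oo[%classic gamma1.
  apply: filippov_orbitS ((orbit_spaceP _).1 og1) => //; first exact: is_interval_itv.
  by exists b, (b + 1); rewrite /= !in_itv/= lexx !andbT; split => //; lra.
have [||I' [gamma' [a' [oI' II' [I'a' I'ub] E' [aa' g'a']]]]] := orbit_connect oL _ _ TTa TTb.
- by rewrite /= in_itv/=.
- by move=> t; rewrite /= in_itv/=.
have [|||| gam [ogam EL ER]] := orbit_join oI' I'a' I'ub oR (b := b).
- by rewrite /= in_itv/= lexx.
- by move=> t; rewrite /= in_itv/= andbT.
- by rewrite g'a'.
- by rewrite g'a'; exact: TTS.
have {}ogam : orbits gam.
  apply/orbit_spaceP; move: ogam; rewrite (_ : _ `|` _ = [set: R])//.
  apply/seteqP; split => // t _; have [ta|at_] := leP t a'; last first.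
    by right; rewrite /= in_itv/= andbT; lra.
  left; have [ta1|ta1] := leP t a; first by apply: II'; rewrite /= in_itv.
  have [iI' _ _ _] := oI'; apply: (iI' a a') => //; last by rewrite ltW.
  by apply: II'; rewrite /= in_itv/=.
have E0 t : t <= a -> gam t = gamma0 t.
  move=> ta; have It : `]-oo, a]%classic t by rewrite /= in_itv.
  by rewrite EL ?E'//; exact: II'.
have E1 t : b <= t -> orbit_flow (a' - b) gam t = gamma1 t.
  move=> bt; rewrite /orbit_flow ER; first by congr gamma1; ring.
  by rewrite /= in_itv/= andbT; lra.
(* This translation brings the glued orbit onto [gamma1] from time [b] on; it is positive since [a']
   exceeds [N] and [b] is below [- N]. *)
exists (a' - b); first by have : 0 <= N%:R :> R by []; lra.
have oshift : orbits (orbit_flow (a' - b) gam) by exact: orbit_space_shift.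
have C2 : 0 <= 2 * C by rewrite mulr_ge0// ltW.
exists (orbit_flow (a' - b) gam); split.
  exists gam => //; apply: He0 => //.
  apply: (@le_lt_trans _ _ (8 * (2 * C) * 2^-1 ^+ N)%:E); last first.
    by rewrite lte_fin (lt_le_trans HN)// ge_min lexx.
  apply: orbit_dist_right => // t Nt; first by rewrite E0//; lra.
  apply: (le_trans (rdist_triangle g _ (gamma0 N%:R) _)).
  have -> : gamma0 N%:R = gam N%:R by rewrite E0//; lra.
  have [_ h1] := lip og0 Nt; have [h2 _] := lip ogam Nt.
  rewrite -(E0 N%:R) in h1; last by lra.
  by apply: (le_trans (leeD h1 h2)); rewrite -EFinD lee_fin; lra.
apply: He1 => //.
apply: (@le_lt_trans _ _ (8 * (2 * C) * 2^-1 ^+ N)%:E); last first.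
  by rewrite lte_fin (lt_le_trans HN)// ge_min lexx orbT.
apply: orbit_dist_left => // t Nt; first by rewrite E1//; lra.
have EN : orbit_flow (a' - b) gam (- N%:R) = gamma1 (- N%:R) by rewrite E1//; lra.
apply: (le_trans (rdist_triangle g _ (gamma1 (- N%:R)) _)).
have [h1 _] := lip og1 Nt; have [_ h2] := lip oshift Nt.
rewrite EN in h2.
by apply: (le_trans (leeD h1 h2)); rewrite -EFinD lee_fin; lra.
Qed.

Lemma orbit_segment gamma : orbits gamma -> exists b c : R,
  [/\ b < 0, 0 < c, TT (gamma b), TT (gamma c) & filippov_orbit g F `[b, c]%classic gamma].
Proof.
move=> og; have [b b0 TTb] := backward_before 0 og; have [c c0 TTc] := forward_after 0 og.
exists b, c; split => //.
by apply: filippov_orbit_itv ((orbit_spaceP _).1 og) _ _ _ => //; exact: lt_trans c0.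
Qed.

(** A domain, a curve and a final time. The final point lies in [TT], so the curve can always be
    prolonged to the right. *)
Definition orbit_state : Type := {x : set R * (R -> M) * R |
  [/\ filippov_orbit g F x.1.1 x.1.2, x.1.1 x.2, forall t, x.1.1 t -> t <= x.2
    & TT (x.1.2 x.2)]}.

Definition state_ext (x y : orbit_state) :=
  (sval x).1.1 `<=` (sval y).1.1 /\
  forall t, (sval x).1.1 t -> (sval y).1.2 t = (sval x).1.2 t.

(** An orbit starting near [p] is cut at visits to [TT] before and after time 0; this segment is
    appended through a connecting segment, and its end in [TT] makes the result a state again. *)
Lemma orbit_state_step (x : orbit_state) p (e : R) : 0 < e ->
  exists y, state_ext x y /\
    exists2 t, (sval y).1.1 t & (rdist g p ((sval y).1.2 t) <= e%:E)%E.
Proof.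
case: x => [[[I gamma] a] [/= oI Ia Iub TTa]] e0.
have [gammap ogp pg] := orbit_space_near p e0.
have [b [c [b0 c0 TTb TTc obc]]] := orbit_segment ogp.
have [I' [gamma' [a' [oI' II' [I'a' I'ub] E' [aa' g'a']]]]] := orbit_connect oI Ia Iub TTa TTb.
have [|||| gam [ogam EL ER]] := orbit_join oI' I'a' I'ub obc (b := b).
- by rewrite /= in_itv/=; lra.
- by move=> t; rewrite /= in_itv/= => /andP[].
- by rewrite g'a'.
- by rewrite g'a'; exact: TTS.
set I2 := _ `|` _ in ogam.
have I2c : I2 (a' - b + c) by right; rewrite /= in_itv/=; lra.
have I2ub t : I2 t -> t <= a' - b + c by case=> [/I'ub|/=]; rewrite ?in_itv/=; lra.
have TTe : TT (gam (a' - b + c)).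
  rewrite ER; last by rewrite /= in_itv/=; lra.
  by have -> : b - a' + (a' - b + c) = c by ring.
have st : [/\ filippov_orbit g F (I2, gam, a' - b + c).1.1 (I2, gam, a' - b + c).1.2,
  (I2, gam, a' - b + c).1.1 (I2, gam, a' - b + c).2,
  forall t, (I2, gam, a' - b + c).1.1 t -> t <= (I2, gam, a' - b + c).2
    & TT ((I2, gam, a' - b + c).1.2 (I2, gam, a' - b + c).2)] by split.
exists (exist _ (I2, gam, a' - b + c) st); split => /=.
  split => t It /=; first by left; exact: II'.
  by rewrite EL ?E'//; exact: II'.
(* The time at which the appended segment passes through its own time 0. *)
exists (a' - b); first by right; rewrite /= in_itv/=; lra.
rewrite ER; last by rewrite /= in_itv/=; lra.
by have -> : b - a' + (a' - b) = 0 by ring.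
Qed.

Lemma filippov_transitive_of_connecting : [set: M] !=set0 ->
  dseparable [set: M] (rdist g) -> filippov_transitive g F.
Proof.
move=> [p0 _] [S cS [_ Sd]].
have /countable_injP[f finj] := cS.
(* [P] inverts the injection [f] on the dense set [S], with default value [p0] off the image. *)
have /choice[P HP] : forall k, exists p, forall x, S x -> f x = k -> p = x.
  move=> k; have [[x [Sx fx]]|N] := pselect (exists x, S x /\ f x = k).
    exists x => y Sy fy; apply: finj; rewrite ?inE//.
    by rewrite fx fy.
  by exists p0 => x Sx fx; exfalso; apply: N; exists x.
(* Step [k] treats a pair of a dense point and a precision; as [pickle] encodes every pair, each
   dense point is approached within every tolerance. *)
pose dec (k : nat) : nat * nat := odflt (0%N, 0%N) (unpickle k).
have /choice[step Hstep] : forall xk : orbit_state * nat, exists y,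
    state_ext xk.1 y /\ exists2 t, (sval y).1.1 t &
      (rdist g (P (dec xk.2).1) ((sval y).1.2 t) <= ((dec xk.2).2.+1%:R^-1)%:E)%E.
  by move=> [x k]; apply: orbit_state_step; rewrite invr_gt0.
have [gamma0 og0 _] := orbit_space_near p0 (@ltr01 R).
have [b [c [b0 c0 TTb TTc obc]]] := orbit_segment og0.
have st0 : [/\ filippov_orbit g F (`[b, c]%classic, gamma0, c).1.1 (`[b, c]%classic, gamma0, c).1.2,
  (`[b, c]%classic, gamma0, c).1.1 (`[b, c]%classic, gamma0, c).2,
  forall t, (`[b, c]%classic, gamma0, c).1.1 t -> t <= (`[b, c]%classic, gamma0, c).2
    & TT ((`[b, c]%classic, gamma0, c).1.2 (`[b, c]%classic, gamma0, c).2)].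
  by split => //= [|t]; rewrite in_itv/= ?lexx ?andbT; [lra|move=> /andP[]].
pose seq_ := fix seq_ k : orbit_state :=
  if k is k'.+1 then step (seq_ k', k') else exist _ (`[b, c]%classic, gamma0, c) st0.
have seq_ext i j : (i <= j)%N -> state_ext (seq_ i) (seq_ j).
  elim: j => [|j IH]; first by rewrite leqn0 => /eqP ->; split.
  rewrite leq_eqVlt => /predU1P[->|]; first by split.
  rewrite ltnS => /IH[h1 h2]; have [[h3 h4] _] := Hstep (seq_ j, j); split.
    by move=> t /h1/h3.
  by move=> t It; rewrite /= h4 ?h2//; exact: h1.
have [||| gamma [og Hg]] := @filippov_orbit_chain R n M A g F (range (fun k => (sval (seq_ k)).1)).
- by exists (sval (seq_ 0%N)).1; exists 0%N.
- by move=> _ [k _ <-]; have [] := svalP (seq_ k).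
- move=> _ _ [i _ <-] [j _ <-]; have [ij|ji] := leqP i j.
    by left; exact: seq_ext.
  by right; apply: seq_ext; exact: ltnW.
eexists; exists gamma; split; first exact: og.
split => // x _ e e0.
have e2 : 0 < e / 2 by rewrite divr_gt0.
have [y Sy xy] := Sd x I (e / 2) e2.
have [m Hm] : exists m : nat, m.+1%:R^-1 < e / 2.
  have /cvgrPdist_lt/(_ _ e2)[m _ Hm] := @cvg_harmonic R; exists m.
  by have := Hm m (leqnn m); rewrite sub0r normrN ger0_norm// invr_ge0.
pose k := pickle (f y, m).
have [_ [t It Ht]] := Hstep (seq_ k, k).
have dk : dec k = (f y, m) by rewrite /dec pickleK.
rewrite /= dk /= (HP _ y Sy erefl) in Ht.
exists (gamma t).
  exists t => //; exists (sval (seq_ k.+1)).1 => //; by exists k.+1.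
have Ck : range (fun k => (sval (seq_ k)).1) (sval (seq_ k.+1)).1 by exists k.+1.
rewrite (Hg _ Ck t It).
apply: (le_lt_trans (rdist_triangle g _ y _)).
apply: (@lt_le_trans _ _ ((e / 2)%:E + (e / 2)%:E)%E); last by rewrite -EFinD lee_fin; lra.
apply: lte_leD => //; first by rewrite ge0_fin_numE ?rdist_ge0// (le_lt_trans Ht)// ltey.
by apply: (le_trans Ht); rewrite lee_fin ltW.
Qed.

End Main.

(** A supremum over the empty set would not be positive, which gives a point of [M]; its finite
    value serves as [K]. *)
Lemma Fnorm_fin {R : realType} {n : nat} {M : topologicalType} {A : manifold R n M}
    (g : riemannian A) (F : filippov A) : (Fnorm g F < +oo)%E -> (0 < Fnorm g F)%E ->
  [set: M] !=set0 /\ exists2 K : R, 0 < K & forall p v, Fval F p v -> tnorm g p v <= K.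
Proof.
move=> Foo F0.
have Ffin : Fnorm g F \is a fin_num by rewrite ge0_fin_numE// ltW.
split.
  by have [_ [p [v [_ _]]] _] := ereal_sup_gt F0; exists p.
exists (fine (Fnorm g F)); first by rewrite fine_gt0// F0.
move=> p v pv; rewrite -lee_fin fineK//; apply: ereal_sup_ubound.
by exists p, v.
Qed.

Theorem theoremC (R : realType) (n : nat) (M : topologicalType)
    (A : manifold R n M) (g : riemannian A) (F : filippov A)
    (M_separable : dseparable [set: M] (rdist g))
    (M_complete : dcomplete [set: M] (rdist g))
    (M_perfect : dperfect [set: M] (rdist g))
    (maximal_orbits_global :
       forall I gamma, maximal_orbit g F I gamma -> I = [set: R])
    (F_bounded : (Fnorm g F < +oo)%E)
    (F_norm_pos : (0 < Fnorm g F)%E)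
    (Sigma_t_finite : finite_set (Sigma_t g F))
    (Sigma_t_multiplicity :
       forall p, Sigma_t g F p -> finite_multiplicity g F p) :
  (flow_transitive (orbit_space g F) (orbit_dist g) (@orbit_flow R M) ->
     filippov_transitive g F) /\
  (connected [set: M] ->
   forall TT : set M, TT `<=` Sigma_t g F ->
   (forall T T', TT T -> TT T' ->
      exists (s : R) (theta : R -> M),
        [/\ 0 <= s, (0 < s -> filippov_orbit g F `[- s, s] theta),
            theta (- s) = T & theta s = T']) ->
   (forall gamma, orbit_space g F gamma ->
      exists (T : M) (s : R), [/\ TT T, 0 < s & gamma s = T]) ->
   (forall gamma, orbit_space g F gamma ->
      exists (T : M) (s : R), [/\ TT T, s < 0 & gamma s = T]) ->
   topologically_transitive (orbit_space g F) (orbit_dist g) (@orbit_flow R M)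
   /\ filippov_transitive g F).
Proof.
have [M0 [K K0 FK]] := Fnorm_fin F_bounded F_norm_pos.
(* [K + 1] provides the strict inequality required by [orbit_lipschitz]. *)
have K10 : 0 < K + 1 by rewrite addr_gt0.
have lip gamma : orbit_space g F gamma -> forall s t : R, s <= t ->
    (rdist g (gamma s) (gamma t) <= ((K + 1) * (t - s))%:E)%E /\
    (rdist g (gamma t) (gamma s) <= ((K + 1) * (t - s))%:E)%E.
  move=> /orbit_spaceP og s t st.
  by apply: (orbit_lipschitz FK _ (ltW K10) og) => //; rewrite ltrDl.
split; first exact: (flow_transitive_filippov maximal_orbits_global K10 lip).
move=> _ TT TTS conn fwd bwd; split.
  exact: (orbit_space_topologically_transitive K10 lip TTS conn fwd bwd).
exact: (filippov_transitive_of_connecting maximal_orbits_global TTS conn fwd bwd).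
Qed.
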